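(* Let $F:\mathbb{R}^n\times\mathbb{R}\times\mathbb{R}^n\times\mathcal{S}^n\to\mathbb{R}$ satisfy: (i) (degenerate ellipticity) $F(x,u,p,X)\ge F(x,v,p,Y)$ whenever $x,p\in\mathbb{R}^n$, $u\ge v$ and $X\le Y$; (ii) $-F(x,0,p,X)\le \phi(|p|)-\mathcal{P}^-_{\lambda,\Lambda}(X)$ for all $x,p\in\mathbb{R}^n$, $X\in\mathcal{S}^n$; (iii) $F(x,s,p,X)\le\phi(|p|)+\mathcal{P}^+_{\lambda,\Lambda}(X)+\gamma(s)$ for all $s\in[0,\infty)$, $x,p\in\mathbb{R}^n$, $X\in\mathcal{S}^n$, where $0<\lambda\le\Lambda$; $\phi:[0,\infty)\to[0,\infty)$ is strictly increasing and continuous with $\phi(t)\ge t$ for all $t\geq 0$ and $\int_0^1\frac{dt}{\phi(t)}=\infty$; $\gamma$ is a function with $\gamma(s)\le C^*\phi(s)$ whenever $0\le s\le1$, for a constant $C^*$; and (iv) for every sufficiently small $\epsilon>0$, $\int_0^\epsilon f_\nu(t)\,dt\to\infty$ as $\nu\to\infty$, where $f_\nu$ solves $f_\nu'(t)=-\phi(f_\nu(t))$ with $f_\nu(0)=\nu$. Let $\Omega\subset\mathbb{R}^n$ be a domain satisfying the ball condition with radius $r_b$, let $w\in\partial\Omega$ and $0<r<r_b$. Assume that $u$ is a positive viscosity solution of $F(x,u,Du,D^2u)=0$ in $\Omega\cap B(w,6r)$ satisfying $u=0$ on $\partial\Omega\cap B(w,6r)$. Put $\Gamma_{w,r}=\{x\in\Omega:r<d(x,\partial\Omega)<3r\}\cap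 B(w,6r)$. Then there exists a constant $c\geq 1$, depending only on $\lambda,\Lambda,n,\phi,r_b,C^*$, $r^{-1}\inf_{\Gamma_{w,r}}u$ and $r^{-1}\sup_{B(w,6r)\cap\Omega}u$, such that $$c^{-1}d(x,\partial\Omega)\le u(x)\le c\,d(x,\partial\Omega)\qquad\text{for all }x\in\Omega\cap B(w,r).$$
   Context: A domain is an open connected set; $B(x,r)$ is the open ball; $d(x,E)$ is the Euclidean distance from $x$ to $E$. $\Omega$ satisfies the ball condition with radius $r_b>0$ if for every $w\in\partial\Omega$ there are $\eta^i\in\Omega$ with $B(\eta^i,r_b)\subset\Omega$, $\partial B(\eta^i,r_b)\cap\partial\Omega=\{w\}$, and $\eta^e\in\mathbb{R}^n\setminus\Omega$ with $B(\eta^e,r_b)\subset\mathbb{R}^n\setminus\Omega$, $\partial B(\eta^e,r_b)\cap\partial\Omega=\{w\}$. $\mathcal{S}^n$ is the set of symmetric $n\times n$ real matrices with the positive semi-definite ordering. For $X\in\mathcal{S}^n$ with eigenvalues $e_1,\dots,e_n$, $\mathcal{P}^+_{\lambda,\Lambda}(X):=-\lambda\sum_{e_i\ge0}e_i-\Lambda\sum_{e_i<0}e_i$ and $\mathcal{P}^-_{\lambda,\Lambda}(X):=-\Lambda\sum_{e_i\ge0}e_i-\lambda\sum_{e_i<0}e_i$. A continuous $u:U\to\mathbb{R}$ on an open set $U$ is a viscosity solution of $F(x,u,Du,D^2u)=0$ in $U$ if for every $\varphi\in C^2(U)$ and $x_0\in U$: $F(x_0,u(x_0),D\varphi(x_0),D^2\varphi(x_0))\le0$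 if $u-\varphi$ has a local maximum at $x_0$, and $F(x_0,u(x_0),D\varphi(x_0),D^2\varphi(x_0))\ge0$ if $u-\varphi$ has a local minimum at $x_0$.
   Formalization: The formal theorem assumes that the infimum of u over Γ_{w,r} is positive and its supremum over B(w,6r)∩Ω is finite (otherwise no c depending only on the listed data exists), and reads ''u=0 on ∂Ω∩B(w,6r)'' as u being continuous up to that boundary. *)

(* Defs.v *)
From HB Require Import structures.
From mathcomp Require Import all_boot all_order all_algebra.
From mathcomp Require Import all_classical all_reals all_analysis.
From mathcomp Require complex.
Set Implicit Arguments.
Unset Strict Implicit.
Unset Printing Implicit Defensive.
Import Order.TTheory GRing.Theory Num.Theory numFieldNormedType.Exports.
Local Open Scope classical_set_scope.
Local Open Scope ring_scope.

(* R^n is 'rV[R]_n.  The norm that the library puts on 'rV[R]_n is the sup norm;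
   it induces the usual topology, so open, closure, connected and continuous are
   the library's, but balls and distances below are the Euclidean ones. *)

Section EuclideanGeometry.
Context {R : realType} {n : nat}.
Implicit Types (x y w : 'rV[R]_n) (A E Omega : set 'rV[R]_n).

Definition eucl_norm x : R := Num.sqrt (\sum_(i < n) x ord0 i ^+ 2).

Definition eucl_ball x (r : R) : set 'rV[R]_n := [set y | eucl_norm (y - x) < r].

Definition eucl_dist x E : R := inf [set eucl_norm (x - y) | y in E].

Definition topo_boundary A : set 'rV[R]_n := closure A `\` interior A.

Definition is_domain Omega : Prop := open Omega /\ connected Omega.

Definition ball_condition Omega (rb : R) : Prop :=
  forall w, topo_boundary Omega w ->
    (exists etai, [/\ Omega etai, eucl_ball etai rb `<=` Omega &
       topo_boundary (eucl_ball etai rb) `&` topo_boundary Omega = [set w]]) /\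
    (exists etae, [/\ (~` Omega) etae, eucl_ball etae rb `<=` ~` Omega &
       topo_boundary (eucl_ball etae rb) `&` topo_boundary Omega = [set w]]).

Definition Gamma_wr Omega w (r : R) : set 'rV[R]_n :=
  [set x | Omega x /\ r < eucl_dist x (topo_boundary Omega) < 3 * r] `&` eucl_ball w (6 * r).

End EuclideanGeometry.

Section SymmetricMatrices.
Context {R : realType} {n : nat}.
Implicit Types X Y : 'M[R]_n.

Definition psd_le X Y : Prop :=
  forall xi : 'rV[R]_n, (xi *m X *m xi^T) ord0 ord0 <= (xi *m Y *m xi^T) ord0 ord0.

(* The eigenvalues e_1, ..., e_n listed with multiplicity, in some order; the
   default [::] is never reached for symmetric X, by symmetric_eigenvaluesP. *)
Definition eigenvalues X : seq R :=
  xget [::] [set s : seq R | char_poly X = \prod_(e <- s) ('X - e%:P)].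

Definition Pucci_plus (lam Lam : R) X : R :=
  - lam * (\sum_(e <- eigenvalues X | 0 <= e) e)
  - Lam * (\sum_(e <- eigenvalues X | e < 0) e).

Definition Pucci_minus (lam Lam : R) X : R :=
  - Lam * (\sum_(e <- eigenvalues X | 0 <= e) e)
  - lam * (\sum_(e <- eigenvalues X | e < 0) e).

End SymmetricMatrices.

Section EigenvaluesOfSymmetric.
Import complex.

Lemma symmetric_eigenvaluesP (R : realType) (n : nat) (X : 'M[R]_n) :
  X \is symmetricmx ->
  char_poly X = \prod_(e <- eigenvalues X) ('X - e%:P).
Proof.
move=> /is_hermitianmxP; rewrite expr0 scale1r => Xsym.
rewrite /eigenvalues; case: xgetP => [s _ -> //|noroot]; exfalso.
pose rc : {rmorphism R -> R[i]%C} := real_complex R.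
pose A := map_mx rc X.
have Aherm : A \is hermsymmx.
  apply/is_hermitianmxP; rewrite expr0 scale1r.
  apply/matrixP => i j; rewrite !mxE.
  have -> : X i j = X j i by rewrite [in LHS]Xsym !mxE.
  by apply/esym/conj_Creal/complex_realP; exists (X j i).
have Asp := orthomx_spectralP (hermitian_normalmx Aherm).
have dreal := hermitian_spectral_diag_real Aherm.
set P := spectralmx A in Asp; set d := spectral_diag A in Asp dreal.
have Pu : P \in unitmx := spectral_unit A.
have charA : char_poly A = \prod_(i < n) ('X - (d ord0 i)%:P).
  have -> : char_poly A = char_poly (diag_mx d).
    have PVP : map_mx polyC (invmx P) *m map_mx polyC P = 1%:M.
      by rewrite -map_mxM mulVmx// map_mx1.
    rewrite Asp /char_poly /char_poly_mx !map_mxM/=.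
    set Q := map_mx polyC P; set Q' := map_mx polyC (invmx P).
    have -> : 'X%:M - Q' *m map_mx polyC (diag_mx d) *m Q =
              Q' *m ('X%:M - map_mx polyC (diag_mx d)) *m Q.
      by rewrite mulmxBr mulmxBl scalar_mxC -(mulmxA _ Q' Q) PVP mulmx1.
    by rewrite !det_mulmx mulrAC -[\det Q' * _]det_mulmx PVP det1 mul1r.
  rewrite char_poly_trig ?diag_mx_is_trig//.
  by apply: eq_bigr => i _; rewrite mxE eqxx mulr1n.
apply: (noroot [seq complex.Re (d ord0 i) | i <- index_enum 'I_n]).
rewrite /= big_map; apply: (map_poly_inj rc).
rewrite map_char_poly -/A charA rmorph_prod /=; apply: eq_bigr => i _.
rewrite rmorphB/= map_polyX map_polyC /=; congr (_ - _%:P).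
have /complex_realP[x dx] : d ord0 i \is Num.real by have /mxOverP := dreal.
by rewrite dx.
Qed.

End EigenvaluesOfSymmetric.

Section Viscosity.
Context {R : realType} {n : nat}.
Implicit Types (f u psi : 'rV[R]_n -> R) (x : 'rV[R]_n) (U : set 'rV[R]_n).

Definition unit_row (i : 'I_n) : 'rV[R]_n := delta_mx ord0 i.

Definition partial (i : 'I_n) f : 'rV[R]_n -> R := fun x => 'D_(unit_row i) f x.

Definition gradient f x : 'rV[R]_n := \row_i partial i f x.

Definition hessian f x : 'M[R]_n := \matrix_(i, j) partial j (partial i f) x.

Definition C2_on U f : Prop :=
  forall x, U x ->
    [/\ {for x, continuous f},
        forall i, derivable f x (unit_row i) /\ {for x, continuous (partial i f)} &
        forall i j, derivable (partial i f) x (unit_row j) /\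
                    {for x, continuous (partial j (partial i f))}].

Definition local_max f x : Prop := \forall y \near x, f y <= f x.
Definition local_min f x : Prop := \forall y \near x, f x <= f y.

(* Here U is meant to be open; only the values of u and psi on U matter. *)
Definition viscosity_solution
    (F : 'rV[R]_n -> R -> 'rV[R]_n -> 'M[R]_n -> R) U u : Prop :=
  {in U, continuous u} /\
  forall psi, C2_on U psi -> forall x0, U x0 ->
    (local_max (fun y => u y - psi y) x0 ->
       F x0 (u x0) (gradient psi x0) (hessian psi x0) <= 0) /\
    (local_min (fun y => u y - psi y) x0 ->
       0 <= F x0 (u x0) (gradient psi x0) (hessian psi x0)).

End Viscosity.

Section StructureConditions.
Context {R : realType}.
Implicit Types (phi gam : R -> R) (lam Lam Cstar : R).
Local Notation mu := (@lebesgue_measure R).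

(* phi : [0,oo) -> [0,oo) is represented by a total function whose values at
   negative arguments are irrelevant; nonnegativity follows from phi t >= t. *)
Definition admissible_phi phi : Prop :=
  [/\ {in `[0, +oo[ &, {homo phi : s t / s < t}},
      {within `[0, +oo[, continuous phi},
      forall t, 0 <= t -> t <= phi t &
      (\int[mu]_(t in `]0%R, 1%R]) ((phi t)^-1)%:E = +oo)%E].

(* The initial value problem g' = - phi(g), g(0) = nu on [0,oo). *)
Definition decay_solution phi (nu : R) (g : R -> R) : Prop :=
  [/\ g 0 = nu, {within `[0, +oo[, continuous g},
      forall t, 0 <= t -> 0 <= g t &
      forall t : R, 0 < t -> is_derive t 1 g (- phi (g t))].

Definition decay_integral_blowup phi : Prop :=
  exists2 f : R -> R -> R,
    forall nu, 0 < nu -> decay_solution phi nu (f nu) &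
    \forall eps \near (0 : R)^'+,
      (\int[mu]_(t in `[0%R, eps]) (f nu t)%:E)%E @[nu --> +oo] --> (+oo)%E.

Definition gamma_bound phi Cstar gam : Prop :=
  forall s, 0 <= s <= 1 -> gam s <= Cstar * phi s.

Context {n : nat}.
Implicit Types F : 'rV[R]_n -> R -> 'rV[R]_n -> 'M[R]_n -> R.

Definition degenerate_elliptic F : Prop :=
  forall x p (s t : R) X Y, X \is symmetricmx -> Y \is symmetricmx ->
    t <= s -> psd_le X Y -> F x t p Y <= F x s p X.

Definition lower_structure lam Lam phi F : Prop :=
  forall x p X, X \is symmetricmx ->
    - F x 0 p X <= phi (eucl_norm p) - Pucci_minus lam Lam X.

Definition upper_structure lam Lam phi gam F : Prop :=
  forall x s p X, 0 <= s -> X \is symmetricmx ->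
    F x s p X <= phi (eucl_norm p) + Pucci_plus lam Lam X + gam s.

End StructureConditions.

(* Main.v *)
(* The proof only uses quadratic test functions, on which the structure conditions
   give two one-sided inequalities for [u] (for [u] itself and for [- u]).
   Let [w'] be the point of the boundary nearest to [x].  By the ball condition [x]
   lies on the inner normal at [w'], and two balls of radius [r] touch the boundary
   there, from inside and from outside.
   Upper bound: compare [u] with the radial barrier built on the exterior ball from
   the integral of [f_nu], with [nu] so large that it exceeds [sup u] at distance [r].
   Lower bound: the infimum over Gamma only controls [u] at the centre of the interior
   ball, as Gamma may degenerate there to a thin set when [r] is close to [rb].  A
   Harnack argument is thus needed: near the centre one picks a point [x0] beyond which
   [u] rises by at most [r h] within distance [O(r)], and shows that [u] and
   [u(x0) + r h - u] cannot both be small near [x0].  Each of them, if small somewhere,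
   is touched from below by paraboloids on more than half of the dyadic cubes of every
   level (Savin's sliding paraboloids with a finite Calderon-Zygmund iteration); the
   two contact sets then come arbitrarily close to each other.  The lower bound on a
   small ball is carried to the boundary by a radial barrier built from [f_nu], which
   stays positive by Osgood's condition on [phi]. *)

From HB Require Import structures.
From mathcomp Require Import all_boot all_order all_algebra.
From mathcomp Require Import all_classical all_reals all_analysis.
From mathcomp Require Import measurable_realfun ring lra.
Require Import Defs.
Set Implicit Arguments.
Unset Strict Implicit.
Unset Printing Implicit Defensive.
Import Order.TTheory GRing.Theory Num.Theory numFieldNormedType.Exports.
Local Open Scope classical_set_scope.
Local Open Scope ring_scope.

(** The term [phi |p|] may be superlinear, so the equation is not scale invariant and a Harnack
    inequality cannot be applied at unit scale. The test inequality is therefore used only where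
    value and gradient are at most [V]; a zoom to a small scale [r] turns it there into
    [b - C0 a <= 1]. After the zoom the height [S] of the solution is of order [1 / r], so a bound
    [S <= 2 V] with [V] depending on [C0] and [n] alone is a contradiction. A viscosity solution has
    no pointwise second derivatives, so contact sets are not measured by the area formula. At each
    dyadic scale the vertex of a touching paraboloid depends on the contact point in a Lipschitz
    way, and counting dyadic cubes takes the place of measure. Hessians [b e^T e - a I] suffice
    because both the crease between two paraboloids and a convex decreasing radial function can be
    approximated from below by such quadratics. *)

(** * Euclidean inner product, norm and topology of row vectors *)

Section Euclid.
Context {R : realType} {n : nat}.
Implicit Types x y z : 'rV[R]_n.

Definition dot x y : R := \sum_(i < n) x ord0 i * y ord0 i.

Lemma dotC x y : dot x y = dot y x.
Proof. by apply: eq_bigr => i _; rewrite mulrC. Qed.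

Lemma dotDl x y z : dot (x + y) z = dot x z + dot y z.
Proof. by rewrite -big_split; apply: eq_bigr => i _; rewrite mxE mulrDl. Qed.

Lemma dotZl (k : R) x y : dot (k *: x) y = k * dot x y.
Proof. by rewrite mulr_sumr; apply: eq_bigr => i _; rewrite mxE mulrA. Qed.

Lemma dotNl x y : dot (- x) y = - dot x y.
Proof. by rewrite -scaleN1r dotZl mulN1r. Qed.

Lemma dotDr x y z : dot x (y + z) = dot x y + dot x z.
Proof. by rewrite dotC dotDl !(dotC x). Qed.

Lemma dotZr (k : R) x y : dot x (k *: y) = k * dot x y.
Proof. by rewrite dotC dotZl (dotC x). Qed.

Lemma dotNr x y : dot x (- y) = - dot x y.
Proof. by rewrite dotC dotNl (dotC x). Qed.

Lemma dot0l x : dot 0 x = 0.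
Proof. by rewrite -(scale0r 0) dotZl mul0r. Qed.

Lemma dot0r x : dot x 0 = 0.
Proof. by rewrite dotC dot0l. Qed.

Definition dotE := (dotDl, dotDr, dotNl, dotNr, dotZl, dotZr, dot0l, dot0r).

Lemma dot_ge0 x : 0 <= dot x x.
Proof. by apply: sumr_ge0 => i _; rewrite -expr2 sqr_ge0. Qed.

Lemma eucl_normE x : eucl_norm x = Num.sqrt (dot x x).
Proof. by congr Num.sqrt; apply: eq_bigr => i _; rewrite expr2. Qed.

Lemma eucl_norm_ge0 x : 0 <= eucl_norm x.
Proof. exact: sqrtr_ge0. Qed.

Lemma sqr_eucl_norm x : eucl_norm x ^+ 2 = dot x x.
Proof. by rewrite eucl_normE sqr_sqrtr// dot_ge0. Qed.

Lemma dot_eq0 x : dot x x = 0 -> x = 0.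
Proof.
move=> /eqP; rewrite psumr_eq0 => [/allP x0|i _]; last by rewrite -expr2 sqr_ge0.
apply/rowP => i; rewrite mxE.
by have := x0 i (mem_index_enum _); rewrite -expr2 sqrf_eq0 => /eqP.
Qed.

Lemma eucl_norm0 : eucl_norm (0 : 'rV[R]_n) = 0.
Proof. by rewrite eucl_normE dot0l sqrtr0. Qed.

Lemma eucl_norm_eq0 x : eucl_norm x = 0 -> x = 0.
Proof. by move=> x0; apply: dot_eq0; rewrite -sqr_eucl_norm x0 expr0n. Qed.

Lemma eucl_normN x : eucl_norm (- x) = eucl_norm x.
Proof. by rewrite !eucl_normE !dotE opprK. Qed.

Lemma eucl_normZ (k : R) x : eucl_norm (k *: x) = `|k| * eucl_norm x.
Proof. by rewrite !eucl_normE !dotE mulrA -expr2 sqrtrM ?sqr_ge0// sqrtr_sqr. Qed.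

Lemma CauchySchwarz_dot x y : dot x y ^+ 2 <= dot x x * dot y y.
Proof.
have [y0|y0] := eqVneq (dot y y) 0.
  by rewrite (dot_eq0 y0) !dot0r mulr0 expr0n.
have yp : 0 < dot y y by rewrite lt_neqAle eq_sym y0 dot_ge0.
have := dot_ge0 (dot y y *: x - dot x y *: y).
rewrite !dotE (dotC y x) => H.
rewrite -subr_ge0 -(pmulr_rge0 _ yp).
by apply: le_trans H _; rewrite le_eqVlt; apply/orP; left; apply/eqP; ring.
Qed.

Lemma ler_eucl_sqr x (k : R) : 0 <= k -> (eucl_norm x <= k) = (dot x x <= k ^+ 2).
Proof. by move=> k0; rewrite -sqr_eucl_norm ler_sqr// nnegrE// eucl_norm_ge0. Qed.

Lemma dot_le x y : dot x y <= eucl_norm x * eucl_norm y.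
Proof.
have := CauchySchwarz_dot x y; rewrite -!sqr_eucl_norm -exprMn => H.
apply: le_trans (ler_norm _) _.
by rewrite -ler_sqr ?nnegrE ?mulr_ge0 ?eucl_norm_ge0// real_normK ?num_real.
Qed.

Lemma abs_dot_le x y : `|dot x y| <= eucl_norm x * eucl_norm y.
Proof.
by rewrite ler_norml dot_le andbT lerNl -dotNl (le_trans (dot_le _ _))// eucl_normN.
Qed.

Lemma eucl_normD x y : eucl_norm (x + y) <= eucl_norm x + eucl_norm y.
Proof.
rewrite ler_eucl_sqr ?addr_ge0 ?eucl_norm_ge0// !dotE (dotC y x).
rewrite sqrrD !sqr_eucl_norm; have := dot_le x y; lra.
Qed.

Lemma eucl_distC x y : eucl_norm (x - y) = eucl_norm (y - x).
Proof. by rewrite -eucl_normN opprB. Qed.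

Lemma eucl_distD z x y : eucl_norm (x - y) <= eucl_norm (x - z) + eucl_norm (z - y).
Proof. by rewrite -{1}(subrK z x) -addrA eucl_normD. Qed.

Lemma eucl_normB x y : eucl_norm (x - y) <= eucl_norm x + eucl_norm y.
Proof. by rewrite (le_trans (eucl_normD _ _))// eucl_normN. Qed.

Lemma coord_le_eucl x i : `|x ord0 i| <= eucl_norm x.
Proof.
rewrite -ler_sqr ?nnegrE ?eucl_norm_ge0// real_normK ?num_real// sqr_eucl_norm.
rewrite /dot (bigD1 i)//= -expr2 lerDl; apply: sumr_ge0 => j _.
by rewrite -expr2 sqr_ge0.
Qed.

Lemma eucl_le_coord x (k : R) : 0 <= k -> (forall i, `|x ord0 i| <= k) ->
  eucl_norm x <= n%:R * k.
Proof.
move=> k0 xk; rewrite ler_eucl_sqr ?mulr_ge0//.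
apply: (@le_trans _ _ (\sum_(i < n) k ^+ 2)).
  apply: ler_sum => i _; rewrite -expr2 -[x _ _ ^+ 2]real_normK ?num_real//.
  by rewrite ler_sqr// nnegrE.
rewrite sumr_const card_ord exprMn -[leLHS]mulr_natl; apply: ler_wpM2r.
  exact: sqr_ge0.
case: (n) => [|m]; first by rewrite expr0n.
by rewrite expr2 -natrM ler_nat leq_pmulr.
Qed.

Lemma norm_le_eucl x : `|x| <= eucl_norm x.
Proof.
have -> : `|x| = mx_norm x by [].
rewrite mx_normrE; apply: bigmax_le => [|[i j] _]; first exact: eucl_norm_ge0.
by rewrite (ord1 i) coord_le_eucl.
Qed.

Lemma coord_le_norm x i : `|x ord0 i| <= `|x|.
Proof.
have -> : `|x| = mx_norm x by [].
by rewrite mx_normrE; apply: (le_bigmax _ (fun ij => `|x ij.1 ij.2|) (ord0, i)).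
Qed.

Lemma eucl_le_norm x : eucl_norm x <= n%:R * `|x|.
Proof. by apply: eucl_le_coord => // i; exact: coord_le_norm. Qed.

Lemma near_eucl (x : 'rV[R]_n) (P : set 'rV[R]_n) :
  (\near x, P x) <-> exists2 d : R, 0 < d & forall y, eucl_norm (y - x) < d -> P y.
Proof.
split.
  move=> /nbhs_ballP[d d0 dP]; exists d => // y yd; apply: dP.
  rewrite -ball_normE /= distrC; exact: le_lt_trans (norm_le_eucl _) yd.
move=> [d d0 dP]; apply/nbhs_ballP; exists (d / n.+1%:R); first by rewrite /= divr_gt0.
move=> y; rewrite -ball_normE /= distrC => yd; apply: dP.
apply: (@le_lt_trans _ _ (n.+1%:R * `|y - x|)).
  by apply: le_trans (eucl_le_norm _) _; rewrite ler_wpM2r// ler_nat.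
by move: yd; rewrite ltr_pdivlMr// mulrC.
Qed.

Lemma closed_eucl_ball_closed (c : 'rV[R]_n) (r : R) :
  closed [set y | eucl_norm (y - c) <= r].
Proof.
rewrite -openC openE => y /negP; rewrite -ltNge => yc.
apply: (near_eucl _ _).2; exists (eucl_norm (y - c) - r); first by rewrite subr_gt0.
move=> z zy; apply/negP; rewrite -ltNge.
by have := eucl_distD z y c; rewrite (eucl_distC y z); lra.
Qed.

Lemma closed_eucl_ball_compact (c : 'rV[R]_n) (r : R) :
  compact [set y | eucl_norm (y - c) <= r].
Proof.
apply: bounded_closed_compact; last exact: closed_eucl_ball_closed.
exists (`|c| + r); split; first exact: num_real.
move=> M hM y /= yc; apply: le_trans (ltW hM).
rewrite -{1}(subrK c y) (le_trans (ler_normD _ _))// addrC lerD2l.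
exact: le_trans (norm_le_eucl _) yc.
Qed.

Lemma eucl_ball_open (c : 'rV[R]_n) (r : R) : open (eucl_ball c r).
Proof.
rewrite openE => y yc; apply: (near_eucl _ _).2; exists (r - eucl_norm (y - c)).
  by rewrite subr_gt0.
move=> z zy; rewrite /eucl_ball /=; have := eucl_distD y z c; lra.
Qed.

End Euclid.

(** * One-dimensional expansions by the mean value theorem *)

Section Taylor.
Context {R : realType}.

(** [G1] is assumed differentiable at [rho] only, so the Lagrange remainder is not at hand. Near
    [rho] the difference quotient of [G1] exceeds [b]; hence the derivative of the error has the
    sign of [t - rho], and the mean value theorem concludes on either side. *)
Lemma second_order_below (G G1 : R -> R) (rho g2 b d : R) : 0 < d -> b < g2 ->
  (forall t, `|t - rho| < d -> is_derive t 1 G (G1 t)) ->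
  is_derive rho 1 G1 g2 ->
  exists2 d', 0 < d' & forall t, `|t - rho| < d' ->
    G rho + G1 rho * (t - rho) + b / 2 * (t - rho) ^+ 2 <= G t.
Proof.
move=> d0 bg2 dG dG1.
have [D1 D1E] : derivable G1 rho 1 /\ 'D_1 G1 rho = g2.
  by split; [exact: ex_derive|exact: derive_val].
have : h^-1 *: (G1 (h *: 1 + rho) - G1 rho) @[h --> 0^'] --> g2.
  by rewrite -D1E; exact: D1.
move=> /cvgrPdist_lt /(_ (g2 - b)); rewrite subr_gt0 => /(_ bg2).
move=> /nbhs_ballP[d1 /= d10 Hd1].
have key t : `|t - rho| < d1 -> t != rho ->
    0 <= (G1 t - G1 rho - b * (t - rho)) * (t - rho).
  move=> td tr.
  have := Hd1 (t - rho); rewrite /ball /= sub0r normrN => /(_ td).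
  rewrite subr_eq0 => /(_ tr); rewrite /GRing.scale /= mulr1 subrK => H.
  have tr0 : t - rho != 0 by rewrite subr_eq0.
  have : b <= (t - rho)^-1 * (G1 t - G1 rho) by move: H; rewrite ltr_norml; lra.
  move=> H2.
  have s0 : 0 <= (t - rho) ^+ 2 by exact: sqr_ge0.
  have := ler_wpM2r s0 H2.
  have -> : (t - rho)^-1 * (G1 t - G1 rho) * (t - rho) ^+ 2
    = (G1 t - G1 rho) * (t - rho) by field.
  lra.
exists (Num.min d d1); first by rewrite lt_min d0 d10.
move=> t; rewrite lt_min => /andP[td td1].
pose k s := G s - (G rho + G1 rho * (s - rho) + b / 2 * (s - rho) ^+ 2).
pose k1 s := G1 s - G1 rho - b * (s - rho).
have dk s : `|s - rho| < d -> is_derive s 1 k (k1 s).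
  move=> sd; have ? := dG s sd.
  apply: is_derive_eq.
  rewrite /GRing.scale /=; rewrite /k1; lra.
have krho : k rho = 0 by rewrite /k; ring.
suff : 0 <= k t by rewrite /k; lra.
have [tr|rt|->] := ltgtP t rho; last by rewrite krho.
- have [||c] := @MVT R k k1 t rho tr.
  + move=> s; rewrite in_itv /= => /andP[ts sr]; apply: dk.
    by move: td; rewrite !ltr_norml; lra.
  + apply: derivable_within_continuous => s; rewrite in_itv /= => /andP[ts sr].
    have ? : is_derive s 1 k (k1 s).
      by apply: dk; move: td; rewrite !ltr_norml; lra.
    exact: ex_derive.
  + rewrite in_itv /= => /andP[tc cr]; rewrite krho => E.
    have cr' : c != rho by rewrite lt_eqF.
    have cd1 : `|c - rho| < d1 by move: td1; rewrite !ltr_norml; lra.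
    have := key c cd1 cr'; rewrite -/(k1 c) => H.
    have k1c : k1 c <= 0 by rewrite -(@nmulr_lge0 _ (c - rho)) ?subr_lt0.
    have : k1 c * (rho - t) <= 0 by rewrite mulr_le0_ge0// subr_ge0 ltW.
    by rewrite -E; lra.
- have [||c] := @MVT R k k1 rho t rt.
  + move=> s; rewrite in_itv /= => /andP[ts sr]; apply: dk.
    by move: td; rewrite !ltr_norml; lra.
  + apply: derivable_within_continuous => s; rewrite in_itv /= => /andP[ts sr].
    have ? : is_derive s 1 k (k1 s).
      by apply: dk; move: td; rewrite !ltr_norml; lra.
    exact: ex_derive.
  + rewrite in_itv /= => /andP[tc cr]; rewrite krho => E.
    have cr' : c != rho by rewrite gt_eqF.
    have cd1 : `|c - rho| < d1 by move: td1; rewrite !ltr_norml; lra.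
    have := key c cd1 cr'; rewrite -/(k1 c) => H.
    have k1c : 0 <= k1 c by rewrite -(@pmulr_lge0 _ (c - rho)) ?subr_gt0.
    have : 0 <= k1 c * (t - rho) by rewrite mulr_ge0// subr_ge0 ltW.
    by rewrite -E; lra.
Qed.

Lemma derive_le0_nonincreasing (G G1 : R -> R) (x y : R) :
  (forall t, x <= t <= y -> is_derive t 1 G (G1 t)) ->
  (forall t, x <= t <= y -> G1 t <= 0) -> x <= y -> G y <= G x.
Proof.
move=> dG G10; rewrite le_eqVlt => /predU1P[->//|xy].
have [||c] := @MVT R G G1 x y xy.
- by move=> s; rewrite in_itv /= => /andP[? ?]; apply: dG; rewrite !ltW.
- apply: derivable_within_continuous => s; rewrite in_itv /= => sxy.
  have ? := dG s sxy; exact: ex_derive.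
- rewrite in_itv /= => /andP[xc cy] E.
  have : G1 c * (y - x) <= 0.
    by rewrite mulr_le0_ge0 ?subr_ge0 ?(ltW xy)// G10// !ltW.
  by rewrite -E subr_le0.
Qed.

End Taylor.

(** * Quadratic tests and radial comparison functions *)

Section QuadSuper.
Context {R : realType} {n : nat}.
Implicit Types (x y z c e p : 'rV[R]_n) (U : set 'rV[R]_n) (v : 'rV[R]_n -> R).

(* The viscosity supersolution property, restricted to quadratic test functions
   with Hessian [b e^T e - a I]; the inequality between [b] and [a], the value
   and the gradient that it yields is abstracted as [P]. *)
Definition quad_super (C0 : R) U (P : R -> R -> R -> Prop) v : Prop :=
  forall x0 p e (a b d : R), U x0 -> 0 <= a -> 0 <= b -> dot e e = 1 -> 0 < d ->
  (forall z, eucl_norm (z - x0) < d ->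
     v x0 + dot p (z - x0)
     + (b * dot e (z - x0) ^+ 2 - a * dot (z - x0) (z - x0)) / 2 <= v z) ->
  P (v x0) (eucl_norm p) (b - C0 * a).

(* AM-GM gives [|z - c| <= rho + t] with [t = e.h + |h|^2 / (2 rho)],
   [h = z - x0], [rho = |x0 - c|]; as [G] is nonincreasing, [G |z - c|] lies
   above [G (rho + t)]. *)
Lemma quad_super_radial C0 U P v (G G1 : R -> R) c xh x0 (al g2 b d eps : R) :
  quad_super C0 U P v -> 0 <= al -> U x0 -> x0 != c -> 0 < d ->
  0 <= b -> b < g2 -> 0 < eps ->
  (forall t, `|t - eucl_norm (x0 - c)| < d -> is_derive t 1 G (G1 t)) ->
  (forall t, `|t - eucl_norm (x0 - c)| < d -> G1 t <= 0) ->
  is_derive (eucl_norm (x0 - c)) 1 G1 g2 ->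
  (forall z, eucl_norm (z - x0) < d ->
    v x0 - G (eucl_norm (x0 - c)) + al / 2 * dot (x0 - xh) (x0 - xh) <=
    v z - G (eucl_norm (z - c)) + al / 2 * dot (z - xh) (z - xh)) ->
  let rho := eucl_norm (x0 - c) in
  P (v x0) (eucl_norm ((G1 rho / rho) *: (x0 - c) - al *: (x0 - xh)))
    (b - C0 * (al - G1 rho / rho + eps)).
Proof.
move=> vP al0 Ux0 x0c d0 b0 bg2 eps0 dG G10 dG1 vmin rho.
have rho0 : 0 < rho.
  rewrite lt_neqAle eucl_norm_ge0 andbT eq_sym; apply: contra x0c => /eqP r0.
  by rewrite -subr_eq0; apply/eqP; apply: eucl_norm_eq0.
have [d' d'0 tay] := second_order_below d0 bg2 dG dG1.
pose e := rho^-1 *: (x0 - c).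
have ee : dot e e = 1.
  rewrite /e dotZl dotZr -sqr_eucl_norm -/rho.
  by field; rewrite gt_eqF.
have G1r : G1 rho <= 0 by apply: G10; rewrite subrr normr0.
have en : eucl_norm e = 1 by rewrite eucl_normE ee sqrtr1.
(* As [|t| <= 2 N], the halves keep [rho + t] in the range of [dG] and [tay]; [N < rho] gives
   [N ^+ 2 / (2 * rho) <= N]; the last bound makes the cubic cross term of [b * t ^+ 2] at most
   [eps * N ^+ 2], which the extra opening [eps] absorbs. *)
pose D := Num.min (Num.min d (Num.min d d' / 2)) (Num.min rho (eps * rho / (b + 1))).
have b1 : 0 < b + 1 by lra.
apply: (vP x0 _ e (al - G1 rho / rho + eps) b D) => //.
- have : G1 rho / rho <= 0 by rewrite mulr_le0_ge0// invr_ge0 ltW.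
  by lra.
- by rewrite !lt_min d0 rho0 !divr_gt0 ?mulr_gt0 ?lt_min ?d0 ?d'0.
move=> z; rewrite !lt_min => /andP[/andP[zd zdd]] /andP[zr zeps].
pose h := z - x0; rewrite -/h in zd zdd zr zeps *.
have hn0 := eucl_norm_ge0 h; set N := eucl_norm h in zd zdd zr zeps hn0 *.
have hh : dot h h = N ^+ 2 by rewrite sqr_eucl_norm.
have eh : `|dot e h| <= N by rewrite (le_trans (abs_dot_le _ _))// en mul1r.
pose t := dot e h + N ^+ 2 / (2 * rho).
have zc : eucl_norm (z - c) ^+ 2 = rho ^+ 2 + 2 * rho * dot e h + N ^+ 2.
  rewrite sqr_eucl_norm -hh /e dotZl.
  have -> : z - c = (x0 - c) + h by rewrite /h [RHS]addrC addrA subrK.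
  rewrite dotDl !(dotDr _ (x0 - c)) -sqr_eucl_norm -/rho (dotC h).
  by field; rewrite gt_eqF.
have zct : eucl_norm (z - c) <= rho + t.
  have H : 0 <= (eucl_norm (z - c) - rho) ^+ 2 by exact: sqr_ge0.
  have -> : rho + t = (eucl_norm (z - c) ^+ 2 + rho ^+ 2) / (2 * rho).
    by rewrite zc /t; field; rewrite gt_eqF.
  by rewrite ler_pdivlMr ?mulr_gt0//; nra.
have N2 : N ^+ 2 / (2 * rho) <= N.
  by rewrite ler_pdivrMr ?mulr_gt0//; nra.
have N20 : 0 <= N ^+ 2 / (2 * rho) by rewrite divr_ge0 ?sqr_ge0// mulr_ge0// ltW.
have zdd2 : N < d / 2 /\ N < d' / 2.
  by move: zdd; rewrite ltr_pdivlMr// lt_min => /andP[? ?]; split; lra.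
have [zdd1 zdd'] := zdd2.
have tN : `|t| <= 2 * N by move: eh; rewrite /t !ler_norml; lra.
have zcr : `|eucl_norm (z - c) - rho| <= N.
  rewrite ler_norml /N /h /rho.
  have := eucl_distD x0 z c; have := eucl_distD z x0 c; rewrite (eucl_distC x0 z).
  by lra.
have Gmon : G (rho + t) <= G (eucl_norm (z - c)).
  apply: (@derive_le0_nonincreasing _ G G1) => // s /andP[s1 s2].
  - by apply: dG; rewrite -/rho; move: zcr tN; rewrite ler_norml ltr_norml ler_norml; lra.
  - by apply: G10; rewrite -/rho; move: zcr tN; rewrite ler_norml ltr_norml ler_norml; lra.
have := tay (rho + t); rewrite -/rho addrAC subrr add0r => /(_ (le_lt_trans tN _)).
move=> /(_ _)/[dup] tay' _; have {}tay' := tay' ltac:(lra).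
have := vmin z zd; rewrite -/rho => vm.
apply: le_trans (_ : v x0 - G rho + al / 2 * dot (x0 - xh) (x0 - xh)
   - al / 2 * dot (z - xh) (z - xh) + G (rho + t) <= _); last by lra.
have Et : G1 rho * t = G1 rho / rho * (rho * dot e h) + G1 rho / rho * N ^+ 2 / 2.
  by rewrite /t; field; rewrite gt_eqF.
have -> : z - xh = (x0 - xh) + h by rewrite /h [RHS]addrC addrA subrK.
set Y := G1 rho / rho in Et tay' *; set w := x0 - xh.
have -> : dot (w + h) (w + h) = dot w w + 2 * dot w h + N ^+ 2.
  by rewrite -hh (dotDl w h) !(dotDr _ w h) (dotC h w); ring.
have -> : dot (Y *: (x0 - c) - al *: w) h = Y * (rho * dot e h) - al * dot w h.
  rewrite (dotDl (Y *: _) (- _)) dotNl !dotZl; congr (Y * _ - _).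
  by rewrite mulrA divff ?gt_eqF// mul1r.
rewrite -/h hh.
have tsq : dot e h ^+ 2 - N ^+ 2 * (N / rho) <= t ^+ 2.
  rewrite /t sqrrD.
  have : 0 <= (N ^+ 2 / (2 * rho)) ^+ 2 by exact: sqr_ge0.
  have -> : dot e h * (N ^+ 2 / (2 * rho)) *+ 2 = N ^+ 2 * (dot e h / rho).
    by rewrite mulr2n; field; rewrite gt_eqF.
  have : N ^+ 2 * (- N / rho) <= N ^+ 2 * (dot e h / rho).
    rewrite ler_wpM2l ?sqr_ge0// ler_pdivlMr// divfK ?gt_eqF//.
    by move: eh; rewrite ler_norml; lra.
  rewrite mulNr mulrN; lra.
have bN : b * (N ^+ 2 * (N / rho)) <= eps * N ^+ 2.
  rewrite mulrCA mulrC; apply: ler_wpM2r; first exact: sqr_ge0.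
  move: zeps; rewrite ltr_pdivlMr// mulrA ler_pdivrMr// => H; nra.
have btsq := ler_wpM2l b0 tsq.
rewrite Et in tay'; lra.
Qed.

End QuadSuper.

(** * Counting dyadic cubes as a discrete measure *)

Section DyadicCubes.
Context {R : realType} {n : nat}.
Implicit Types (c y : 'rV[R]_n) (A B : set 'rV[R]_n) (s : R).

Definition cube c s : set 'rV[R]_n :=
  [set y | forall i, `|y ord0 i - c ord0 i| <= s / 2].

Definition child c s (ep : {ffun 'I_n -> bool}) : 'rV[R]_n :=
  \row_i (c ord0 i + (if ep i then s / 4 else - (s / 4))).

(** Counts, among the [2 ^ (n * j)] dyadic subcubes of side [s / 2 ^+ j], those that meet [A]. The
    cubes are closed, so a point on a common face may count several times; the pigeonhole argument
    tolerates this. *)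
Fixpoint hits A (j : nat) c s : nat :=
  if j is j'.+1 then (\sum_ep hits A j' (child c s ep) (s / 2))%N
  else `[< A `&` cube c s !=set0 >].

Lemma cube_child c s y : cube c s y -> exists ep, cube (child c s ep) (s / 2) y.
Proof.
move=> yc; exists [ffun i => c ord0 i <= y ord0 i] => i; rewrite mxE ffunE.
by have := yc i; case: ifPn => [|/negP]; rewrite -?ltNge !ler_norml; lra.
Qed.

Lemma child_sub_cube c s ep y : cube (child c s ep) (s / 2) y -> cube c s y.
Proof.
move=> yc i; have := yc i; rewrite mxE.
by case: ifP => _; rewrite !ler_norml; lra.
Qed.

Lemma card_children : #|{ffun 'I_n -> bool}| = (2 ^ n)%N.
Proof. by rewrite card_ffun card_bool card_ord. Qed.

Lemma hits_miss A j c s : ~ (A `&` cube c s !=set0) -> hits A j c s = 0%N.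
Proof.
elim: j c s => [|j IH] c s /= H; first by rewrite asboolF.
apply: big1 => ep _; apply: IH => -[y [Ay yc]]; apply: H.
by exists y; split => //; exact: child_sub_cube yc.
Qed.

(** Two points more than a side length apart in some coordinate cannot share a cube of level [j].
    The induction sorts the points by a child that contains them. *)
Lemma hits_separated A (I : finType) (T : {set I}) (f : I -> 'rV[R]_n) j c s :
  0 <= s -> (forall t, t \in T -> A (f t) /\ cube c s (f t)) ->
  (forall t t', t \in T -> t' \in T -> t != t' ->
     exists i, s / 2 ^+ j < `|f t ord0 i - f t' ord0 i|) ->
  (#|T| <= hits A j c s)%N.
Proof.
elim: j c s T => [|j IH] c s T s0 TA Tsep /=.
  have [->//|] := posnP #|T|.
  rewrite card_gt0 => /set0Pn[t tT]; have [At ct] := TA t tT.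
  rewrite asboolT; last by exists (f t).
  rewrite /= -(cards1 t); apply: subset_leq_card; apply/fintype.subsetP => t' t'T.
  rewrite inE; apply/negPn/negP => tt'.
  have [i] := Tsep t' t t'T tT tt'; rewrite expr0 divr1.
  have [_ ct'] := TA t' t'T.
  have := ct i; have := ct' i; rewrite !ler_norml => H1 H2.
  by rewrite ltNge ler_norml => /negP; apply; lra.
pose g t := xget [ffun=> true] [set ep | cube (child c s ep) (s / 2) (f t)].
have gP t : t \in T -> cube (child c s (g t)) (s / 2) (f t).
  move=> tT; have [ep epP] := cube_child (TA t tT).2.
  by rewrite /g; case: xgetP => [x _ //|/(_ ep)].
rewrite -sum1_card (partition_big g xpredT)//=; apply: leq_sum => ep _.
rewrite sum1dep_card; apply: IH; first by rewrite divr_ge0.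
- move=> t; rewrite inE => /andP[tT /eqP <-].
  by split; [exact: (TA t tT).1|exact: gP].
- move=> t t'; rewrite !inE => /andP[tT _] /andP[t'T _] tt'.
  have [i H] := Tsep t t' tT t'T tt'; exists i; apply: le_lt_trans H.
  by rewrite exprS invfM mulrA.
Qed.

(** Pigeonhole: if no child inherited the strict inequality, summing over the [2 ^ n] children would
    contradict it; at level [0] it says that both sets meet the cube. *)
Lemma hits_common A B j c s :
  (2 ^ (n * j) < hits A j c s + hits B j c s)%N ->
  exists y z, [/\ A y, B z, cube c s y, cube c s z &
    forall i, `|y ord0 i - z ord0 i| <= s / 2 ^+ j].
Proof.
elim: j c s => [|j IH] c s /=.
  rewrite muln0; case: asboolP => [[y [Ay yc]]|_]; case: asboolP => [[z [Bz zc]]|_]//= _.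
  exists y, z; split => // i; have := yc i; have := zc i.
  by rewrite expr0 !ler_norml; lra.
rewrite -big_split/= => H.
have [ep Hep] : exists ep, (2 ^ (n * j) <
    hits A j (child c s ep) (s / 2) + hits B j (child c s ep) (s / 2))%N.
  apply: contrapT => /forallNP H'; move: H; apply/negP; rewrite -leqNgt.
  apply: (@leq_trans (\sum_(ep : {ffun 'I_n -> bool}) 2 ^ (n * j))%N).
    by apply: leq_sum => ep _; rewrite leqNgt; apply/negP.
  by rewrite sum_nat_const card_children mulnS expnD.
have [y [z [Ay Bz yc zc yz]]] := IH _ _ Hep.
exists y, z; split => //; [exact: child_sub_cube yc|exact: child_sub_cube zc|].
by move=> i; apply: le_trans (yz i) _; rewrite exprS invfM mulrA.
Qed.

(* A finite form of the Calderon-Zygmund covering argument: in a maximal dyadic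
   cube missing [A], whose parent therefore meets [A], [B] has density [mu]. *)
Lemma hits_growth A B (good : 'rV[R]_n -> R -> Prop) (mu : R) : A `<=` B ->
  0 <= mu <= 1 ->
  (forall c s ep, good c s -> good (child c s ep) (s / 2)) ->
  (forall c s ep j, good c s -> A `&` cube c s !=set0 ->
     mu * 2 ^+ (n * j) <= (hits B j (child c s ep) (s / 2))%:R) ->
  forall c s j, good c s -> A `&` cube c s !=set0 ->
    2 ^+ (n * j) - (hits B j c s)%:R <=
    (1 - mu) * (2 ^+ (n * j) - (hits A j c s)%:R).
Proof.
move=> AB /andP[mu0 mu1] gchild dens c s j; elim: j c s => [|j IH] c s gs Ac.
  have Bc : B `&` cube c s !=set0.
    by case: Ac => y [Ay yc]; exists y; split => //; exact: AB.
  by rewrite /= !asboolT// muln0 expr0 subrr mulr0.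
rewrite /= mulnS exprD !natr_sum.
have E k : (2 : R) ^+ n * k = \sum_(ep : {ffun 'I_n -> bool}) k.
  by rewrite sumr_const card_children -[RHS]mulr_natl natrX.
rewrite E -!sumrB mulr_sumr; apply: ler_sum => ep _.
have [m|m] := pselect (A `&` cube (child c s ep) (s / 2) !=set0).
  by apply: IH => //; exact: gchild.
rewrite (hits_miss _ m) subr0.
by have := dens c s ep j gs Ac; lra.
Qed.

End DyadicCubes.

(** * Continuity of real-valued expressions *)

Section RealContinuity.
Context {R : realType} {T : topologicalType}.
Implicit Types f g : T -> R.

Lemma continuous_add f g :
  continuous f -> continuous g -> continuous (fun z => f z + g z).
Proof. by move=> cf cg x; exact: (cvgD (cf x) (cg x)). Qed.

Lemma continuous_sub f g :
  continuous f -> continuous g -> continuous (fun z => f z - g z).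
Proof. by move=> cf cg x; exact: (cvgB (cf x) (cg x)). Qed.

Lemma continuous_mul f g :
  continuous f -> continuous g -> continuous (fun z => f z * g z).
Proof. by move=> cf cg x; exact: (cvgM (cf x) (cg x)). Qed.

Lemma continuous_sqr f : continuous f -> continuous (fun z => f z ^+ 2).
Proof. by move=> cf; under eq_fun do rewrite expr2; exact: continuous_mul. Qed.

Lemma continuous_const (k : R) : continuous (fun _ : T => k).
Proof. by move=> x; exact: cvg_cst. Qed.

Lemma continuous_opp f : continuous f -> continuous (fun z => - f z).
Proof. by move=> cf x; exact: (cvgN (cf x)). Qed.

Lemma continuous_postcomp (h : R -> R) f :
  continuous h -> continuous f -> continuous (fun z => h (f z)).
Proof. by move=> ch cf x; exact: (continuous_comp (cf x) (ch (f x))). Qed.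

End RealContinuity.

(** * Attained minima of a function plus a continuous perturbation *)

Section Minimisers.
Context {R : realType} {n : nat}.
Implicit Types (x y z c e p : 'rV[R]_n) (v : 'rV[R]_n -> R).

Lemma continuous_eucl_dist c : continuous (fun z : 'rV[R]_n => eucl_norm (z - c)).
Proof.
move=> x; have FF : Filter (nbhs x) := nbhs_filter x.
apply: (iffRL (@cvgrPdist_lt _ _ _ _ FF _ _)) => e e0.
apply: (near_eucl _ _).2; exists e => // y yx.
apply: le_lt_trans yx; rewrite ler_norml.
have := eucl_distD x y c; have := eucl_distD y x c; rewrite (eucl_distC x y).
by lra.
Qed.

Lemma continuous_sqdist c : continuous (fun z : 'rV[R]_n => dot (z - c) (z - c)).
Proof.
under eq_fun do rewrite -sqr_eucl_norm.
exact: continuous_sqr (@continuous_eucl_dist c).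
Qed.

Lemma continuous_dot e : continuous (fun z : 'rV[R]_n => dot e z).
Proof.
have -> : (fun z : 'rV[R]_n => dot e z) =
    (fun z => (dot e e + dot (z - 0) (z - 0) - dot (z - e) (z - e)) / 2).
  apply/funext => z; rewrite subr0 !dotE (dotC z e); lra.
exact: (continuous_mul (continuous_sub (continuous_add (@continuous_const _ _ _)
  (@continuous_sqdist 0)) (@continuous_sqdist e)) (@continuous_const _ _ _)).
Qed.

Lemma closed_sublevel (g : 'rV[R]_n -> R) k : continuous g -> closed [set z | g z <= k].
Proof.
move=> cg; exact: (iffLR (continuous_closedP g) cg [set t : R | t <= k] (@closed_le _ k)).
Qed.

Lemma min_attained (A D : set 'rV[R]_n) v (g : 'rV[R]_n -> R) c r :
  {within D, continuous v} -> A `<=` D -> continuous g -> closed A ->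
  (forall z, A z -> eucl_norm (z - c) <= r) -> A !=set0 ->
  exists2 z, A z & forall t, A t -> v z + g z <= v t + g t.
Proof.
move=> cv AD cg clA Ar A0.
have cA : compact A := subclosed_compact clA (@closed_eucl_ball_compact _ _ c r) Ar.
have cvg' : {within A, continuous (fun z => v z + g z)}.
  have cvA : {within A, continuous v} := continuous_subspaceW AD cv.
  have cgA : {within A, continuous g} := continuous_subspaceT cg.
  by move=> x; exact: (cvgD (cvA x) (cgA x)).
have [z zA zmin] := EVT_min_rV A0 cA cvg'.
exists z; first exact: set_mem.
by move=> t At; apply: zmin; rewrite inE.
Qed.

End Minimisers.

(** * Contact sets of sliding paraboloids *)

Section Contact.
Context {R : realType} {n : nat}.
Implicit Types (x y z c e p : 'rV[R]_n) (v : 'rV[R]_n -> R).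

Lemma sqdistD x y z : dot (z - x) (z - x) =
  dot (y - x) (y - x) + 2 * dot (y - x) (z - y) + dot (z - y) (z - y).
Proof. by rewrite !dotE (dotC x y) (dotC z y) (dotC z x); ring. Qed.

Lemma sqdist_le x y (k : R) : eucl_norm (x - y) <= k -> dot (x - y) (x - y) <= k ^+ 2.
Proof.
move=> H; rewrite -sqr_eucl_norm ler_sqr// nnegrE; first exact: eucl_norm_ge0.
exact: le_trans (eucl_norm_ge0 _) H.
Qed.

(* [y] is a point where a concave paraboloid of opening [a] and vertex [x] touches
   the graph of [v] from below, over the ball of radius [Rd]. *)
Definition contact_at (Rd : R) v (a : R) x y : Prop :=
  [/\ eucl_norm x <= Rd, eucl_norm y <= Rd &
      forall z, eucl_norm z <= Rd ->
        v y + a / 2 * dot (y - x) (y - x) <= v z + a / 2 * dot (z - x) (z - x)].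

Definition contact Rd v a : set 'rV[R]_n := [set y | exists x, contact_at Rd v a x y].

(** Moving the vertex to [y + (a / b) (x - y)] keeps the gradient of the paraboloid at [y], so the
    larger opening only lowers it away from [y]. The new vertex lies on the segment from [x] to [y],
    hence in the ball. *)
Lemma contact_mono Rd v a b : 0 < a -> a <= b -> contact Rd v a `<=` contact Rd v b.
Proof.
move=> a0 ab y [x [xR yR H]].
have b0 : 0 < b by lra.
pose th := a / b.
have th0 : 0 <= th by rewrite divr_ge0// ltW.
have th1 : th <= 1 by rewrite ler_pdivrMr// mul1r.
have bth : b * th = a by rewrite /th mulrC divfK// gt_eqF.
exists (y + th *: (x - y)); split => //.
  have -> : y + th *: (x - y) = (1 - th) *: y + th *: x.
    by apply/rowP => i; rewrite !mxE; ring.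
  apply: le_trans (eucl_normD _ _) _; rewrite !eucl_normZ !ger0_norm ?subr_ge0//.
  by nra.
move=> z zR; have := H z zR.
rewrite (sqdistD x y z) (sqdistD (y + th *: (x - y)) y z).
have -> : y - (y + th *: (x - y)) = th *: (y - x).
  by apply/rowP => i; rewrite !mxE; ring.
set w := y - x; set h := z - y; rewrite !dotZl !dotZr.
have := dot_ge0 h.
have -> : b / 2 * (th * (th * dot w w) + 2 * (th * dot w h) + dot h h) =
  b * th / 2 * (th * dot w w) + b * th * dot w h + b / 2 * dot h h by field.
have -> : b / 2 * (th * (th * dot w w)) = b * th / 2 * (th * dot w w) by field.
rewrite bth => h0.
have : a / 2 * dot h h <= b / 2 * dot h h by apply: ler_wpM2r => //; lra.
by lra.
Qed.

(** Compare the touching inequality at [x0]: the vertex is within [2 Rd] of it, which costs at most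
    [a / 2 * (2 Rd)^2]. *)
Lemma contact_value Rd v a x0 y : 0 <= a -> 0 <= Rd -> eucl_norm x0 <= Rd ->
  (forall z, eucl_norm z <= Rd -> 0 <= v z) ->
  v x0 <= 1 -> contact Rd v a y -> 0 <= v y <= 1 + 2 * a * Rd ^+ 2.
Proof.
move=> a0 R0 x0R v0 vx0 [x [xR yR H]]; rewrite v0//=.
have := H x0 x0R.
have : dot (x0 - x) (x0 - x) <= (2 * Rd) ^+ 2.
  by apply: sqdist_le; apply: le_trans (eucl_normB _ _) _; lra.
have : 0 <= a / 2 * dot (y - x) (y - x) by rewrite mulr_ge0 ?dot_ge0// divr_ge0.
rewrite exprMn => H1 H2.
have := ler_wpM2l (divr_ge0 a0 (ler0n _ 2)) H2.
by lra.
Qed.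

(* Otherwise the two paraboloids form a crease at the scale of [y2 - y1], into
   which a quadratic with a large Hessian across it and a small one along it fits. *)
Lemma contact_lipschitz (C0 Rd V a de : R) v x1 x2 y1 y2 :
  1 <= C0 -> 1 <= Rd -> 1 <= a -> 0 < de ->
  {within [set z | eucl_norm z <= Rd], continuous v} ->
  (forall z, eucl_norm z <= Rd -> 0 <= v z) ->
  quad_super C0 [set z | eucl_norm z < Rd]
    (fun t q s => t <= V -> q <= V -> s <= 1) v ->
  v y1 + 12 * a * Rd ^+ 2 <= V ->
  eucl_norm y1 + 32 * C0 * de < Rd ->
  contact_at Rd v a x1 y1 -> contact_at Rd v a x2 y2 ->
  eucl_norm (y1 - y2) <= de -> eucl_norm (x1 - x2) <= 8 * (C0 + 1) * de.
Proof.
move=> C1 R1 a1 de0 cv v0 vS vV yK [x1R y1R H1] [x2R y2R H2] y12.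
rewrite leNgt; apply/negP => xL.
pose q := eucl_norm (x2 - x1).
have qL : 8 * (C0 + 1) * de < q by rewrite /q eucl_distC.
have q0 : 0 < q by nra.
have qR : q <= 2 * Rd by apply: le_trans (eucl_normB _ _) _; lra.
pose K := 32 * C0.
have K32 : 32 <= K by rewrite /K; lra.
have K0 : 0 < K by lra.
have a0 : 0 < a by lra.
have a20 : 0 <= a / 2 by lra.
have Rd0 : 0 <= Rd by lra.
pose e := q^-1 *: (x2 - x1).
have ee : dot e e = 1.
  by rewrite dotZl dotZr -sqr_eucl_norm -/q; field; rewrite gt_eqF.
have en : eucl_norm e = 1 by rewrite eucl_normE ee sqrtr1.
have qe z : q * dot e z = dot (x2 - x1) z by rewrite dotZl mulrA divff ?gt_eqF// mul1r.
clearbody e.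
pose k1 := v y1 + a / 2 * dot (y1 - x1) (y1 - x1).
pose k2 := v y2 + a / 2 * dot (y2 - x2) (y2 - x2).
(* The two paraboloids differ by an affine function. Once [a / 2 |z - x1|^2] is added, the touching
   inequalities put [f0] above both [k1] and [k1 + a q (dot e z - t0)]: a crease along
   [dot e z = t0], with [y1] and [y2] on opposite sides. *)
pose t0 := (k1 - k2 + a / 2 * (dot x2 x2 - dot x1 x1)) / (a * q).
have aq0 : 0 < a * q by rewrite mulr_gt0.
pose f0 z := v z + a / 2 * dot (z - x1) (z - x1).
have E z : f0 z = v z + a / 2 * dot (z - x2) (z - x2) - k2 + k1 + a * q * (dot e z - t0).
  rewrite mulrBr (mulrC (a * q) t0) divfK ?gt_eqF// -(mulrA a q) qe /f0 !dotE.
  by rewrite (dotC z x1) (dotC z x2); lra.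
have f01 z : eucl_norm z <= Rd -> k1 <= f0 z by move=> zR; exact: H1.
have f02 z : eucl_norm z <= Rd -> k1 + a * q * (dot e z - t0) <= f0 z.
  by move=> zR; rewrite E; have := H2 z zR; rewrite -/k2; lra.
have s1 : dot e y1 - t0 <= 0.
  by have := f02 y1 y1R; rewrite -/k1 gerDl pmulr_rle0.
have s2 : 0 <= dot e y2 - t0.
  by rewrite -(pmulr_rge0 _ aq0); have := f01 y2 y2R; rewrite E -/k2; lra.
have s1' : - de <= dot e y1 - t0.
  have : dot e (y2 - y1) <= de.
    apply: le_trans (dot_le _ _) _; rewrite en mul1r eucl_distC//.
  by rewrite dotDr dotNr; lra.
(* With the [b] below, the parabola in [s] vanishes at [s = - 2 de] and equals the height [2 a q de]
   of the crease at [s = 2 de]; [c'] makes the last term of [g] worth [2 a q de] on the sphere of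
   radius [K de]. So [v + g >= k1] on the boundary of [A], while it is smaller at [y1], and the
   minimum is interior. *)
pose c' := 2 * (a * q) / (K ^+ 2 * de).
have Kde : 0 < K ^+ 2 * de by rewrite mulr_gt0// exprn_gt0.
have c'0 : 0 < c' by rewrite divr_gt0// mulr_gt0.
pose b := a * q / (4 * de).
have b0 : 0 < b by rewrite divr_gt0// mulr_gt0.
pose s z := dot e z - t0.
pose g z := a / 2 * dot (z - x1) (z - x1) - b / 2 * (s z + 2 * de) ^+ 2
   + c' * dot (z - y1) (z - y1).
pose A := [set z | eucl_norm (z - y1) <= K * de] `&`
  ([set z | s z <= 2 * de] `&` [set z | - s z <= 2 * de]).
have cs : continuous s := continuous_sub (@continuous_dot _ _ e) (@continuous_const _ _ _).
have cg : continuous g.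
  have c0 k := @continuous_const R 'rV[R]_n k.
  exact: (continuous_add (continuous_sub (continuous_mul (c0 _) (@continuous_sqdist _ _ x1))
    (continuous_mul (c0 _) (continuous_sqr (continuous_add cs (c0 _)))))
    (continuous_mul (c0 _) (@continuous_sqdist _ _ y1))).
have clA : closed A.
  apply: closedI; first exact: closed_eucl_ball_closed.
  by apply: closedI; apply: closed_sublevel => //; exact: continuous_opp.
have AR z : A z -> eucl_norm z < Rd.
  move=> [/= zy _]; have := eucl_normD (z - y1) y1; rewrite subrK.
  by rewrite /K in zy *; clear -zy yK; lra.
have Ay1 : A y1.
  rewrite /A /= subrr eucl_norm0; split; first by rewrite mulr_ge0 ?(ltW de0) ?(ltW K0).
  by rewrite /s; clear -s1 s1' de0; lra.
have [z0 Az0 zmin] : exists2 z, A z & forall t, A t -> v z + g z <= v t + g t.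
  apply: (@min_attained _ _ A _ v g y1 (K * de)) => //.
  - by move=> z /AR/ltW.
  - by move=> z [].
  - by exists y1.
have fy1 : v y1 + g y1 < k1.
  rewrite /g subrr dot0l mulr0 addr0 addrA -/k1 gtrDl oppr_lt0.
  have s0 : 0 < s y1 + 2 * de by rewrite /s; clear -s1' de0; lra.
  by rewrite mulr_gt0 ?exprn_gt0// divr_gt0.
have fz0 : v z0 + g z0 < k1 by apply: le_lt_trans (zmin _ Ay1) fy1.
have z0R : eucl_norm z0 < Rd := AR _ Az0.
case: (Az0) => /= zy [sz1 sz2].
have fz01 := f01 _ (ltW z0R); have fz02 := f02 _ (ltW z0R).
have gE z : v z + g z = f0 z - b / 2 * (s z + 2 * de) ^+ 2 + c' * dot (z - y1) (z - y1).
  by rewrite /g /f0; ring.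
have bde : b * de = a * q / 4 by rewrite /b; field; rewrite gt_eqF.
have bsq k : b / 2 * (k + 2 * de) ^+ 2 = b / 2 * k ^+ 2 + a * q / 2 * (k + de).
  have -> : b / 2 * (k + 2 * de) ^+ 2 =
    b / 2 * k ^+ 2 + (b * de) * 2 * (k + de) by field.
  by rewrite bde; field.
have szl : - (2 * de) < s z0.
  rewrite ltNge; apply/negP => szl; have szE : s z0 = - (2 * de) by clear -szl sz2; lra.
  move: fz0; rewrite gE szE addNr expr0n mulr0 subr0.
  by have := mulr_ge0 (ltW c'0) (dot_ge0 (z0 - y1)); clear -fz01; lra.
have bb k : `|k| <= 2 * de -> b / 2 * (k + 2 * de) ^+ 2 <= 2 * (a * q) * de.
  move=> kd; have : (k + 2 * de) ^+ 2 <= 16 * de ^+ 2.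
    by move: kd; rewrite ler_norml; clear -de0; nra.
  move=> /(ler_wpM2l (divr_ge0 (ltW b0) (ler0n _ 2))) H; apply: le_trans H _.
  have -> : b / 2 * (16 * de ^+ 2) = 8 * (b * de) * de by field.
  by rewrite bde; clear; lra.
have szn : `|s z0| <= 2 * de by rewrite ler_norml; clear -sz1 sz2; lra.
have bz0 := bb _ szn.
have szr : s z0 < 2 * de.
  rewrite ltNge; apply/negP => szr; have szE : s z0 = 2 * de by clear -szr sz1; lra.
  have aqs : a * q * s z0 = a * q * (2 * de) by rewrite szE.
  move: fz0 fz02; rewrite gE -/(s z0) aqs.
  by have := mulr_ge0 (ltW c'0) (dot_ge0 (z0 - y1)); clear -bz0; lra.
have zy' : eucl_norm (z0 - y1) < K * de.
  rewrite ltNge; apply/negP => zyK; have zyE : eucl_norm (z0 - y1) = K * de by clear -zyK zy; lra.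
  move: fz0; rewrite gE -(sqr_eucl_norm (z0 - y1)) zyE.
  have -> : c' * (K * de) ^+ 2 = 2 * (a * q) * de.
    by rewrite /c'; field; rewrite !gt_eqF.
  by clear -bz0 fz01; lra.
pose d := Num.min (Num.min (2 * de - s z0) (2 * de + s z0)) (K * de - eucl_norm (z0 - y1)).
have d0 : 0 < d by rewrite !lt_min; clear -szl szr zy'; lra.
pose p := (b * (s z0 + 2 * de)) *: e - a *: (z0 - x1) - (2 * c') *: (z0 - y1).
have touch z : eucl_norm (z - z0) < d -> v z0 + dot p (z - z0) +
    (b * dot e (z - z0) ^+ 2 - (a + 2 * c') * dot (z - z0) (z - z0)) / 2 <= v z.
  rewrite !lt_min => /andP[/andP[zd1 zd2] zd3].
  have ez : `|dot e (z - z0)| <= eucl_norm (z - z0).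
    by apply: le_trans (abs_dot_le _ _) _; rewrite en mul1r.
  have sz : s z = s z0 + dot e (z - z0) by rewrite /s dotDr dotNr; ring.
  have Az : A z.
    split => /=; last by rewrite sz; move: ez; rewrite ler_norml; clear -zd1 zd2; lra.
    by have := eucl_distD z0 z y1; clear -zd3; lra.
  have := zmin z Az; rewrite /g sz (sqdistD x1 z0 z) (sqdistD y1 z0 z).
  rewrite /p !(dotDl (_ *: _ - _)) (dotDl (_ *: e)) !dotNl !dotZl.
  set X := dot (z0 - x1) _; set Y := dot (z0 - y1) _; set W := dot e _.
  by clear; lra.
have val : v z0 <= V.
  have : c' * dot (z0 - y1) (z0 - y1) >= 0 by rewrite mulr_ge0 ?dot_ge0// ltW.
  have : a / 2 * dot (z0 - x1) (z0 - x1) >= 0 by rewrite mulr_ge0 ?dot_ge0.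
  move: fz0; rewrite /g /k1.
  have : dot (y1 - x1) (y1 - x1) <= (2 * Rd) ^+ 2.
    by apply: sqdist_le; apply: le_trans (eucl_normB _ _) _; clear -y1R x1R; lra.
  have deR : de <= Rd by have := eucl_norm_ge0 y1; clear -yK C1 de0; nra.
  have : 2 * (a * q) * de <= 4 * a * Rd ^+ 2.
    have : q * de <= 2 * Rd * Rd by apply: ler_pM => //; exact: ltW.
    by move=> /(ler_wpM2l (ltW a0)); clear; lra.
  move=> Q1 /(ler_wpM2l a20).
  have : 0 <= a * Rd ^+ 2 by rewrite mulr_ge0 ?sqr_ge0 ?(ltW a0).
  by rewrite exprMn; clear -vV bz0 Q1; lra.
have grad : eucl_norm p <= V.
  have vy : 0 <= v y1 by exact: v0.
  rewrite /p; apply: le_trans (eucl_normB _ _) _.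
  have := eucl_normB ((b * (s z0 + 2 * de)) *: e) (a *: (z0 - x1)).
  rewrite !eucl_normZ en mulr1.
  have -> : `|b * (s z0 + 2 * de)| = b * s z0 + 2 * (b * de).
    rewrite ger0_norm; first by ring.
    by rewrite mulr_ge0 ?(ltW b0)//; clear -szl; lra.
  have : b * s z0 <= b * (2 * de) by rewrite ler_wpM2l ?(ltW b0).
  rewrite bde (gtr0_norm a0) (gtr0_norm (mulr_gt0 (ltr0n R 2) c'0)).
  have zx : eucl_norm (z0 - x1) <= 2 * Rd.
    by apply: le_trans (eucl_normB _ _) _; clear -z0R x1R; lra.
  have c2 : 2 * c' * eucl_norm (z0 - y1) <= 2 * c' * (K * de).
    by rewrite ler_wpM2l// mulr_ge0 ?(ltW c'0).
  have c2E : 2 * c' * (K * de) = 4 * (a * q) / K.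
    by rewrite /c'; field; rewrite !gt_eqF.
  have c3 : 4 * (a * q) / K <= a * q.
    by rewrite ler_pdivrMr//; clear -K32 aq0; nra.
  have azx : a * eucl_norm (z0 - x1) <= a * (2 * Rd) by rewrite ler_wpM2l// ltW.
  have aqR : a * q <= a * (2 * Rd) by rewrite ler_wpM2l// ltW.
  have aRR : a * Rd <= a * Rd ^+ 2.
    by rewrite ler_wpM2l ?(ltW a0)// expr2 ler_peMl.
  have aRR0 : 0 <= a * Rd ^+ 2 by rewrite mulr_ge0 ?sqr_ge0 ?(ltW a0).
  by clear -bde vV vy c2 c2E c3 azx aqR aRR aRR0; lra.
have ac0 : 0 <= a + 2 * c' by rewrite addr_ge0 ?(ltW a0)// mulr_ge0 ?(ltW c'0).
(* [K = 32 C0] gives [2 C0 c' <= b / 2], and [q > 8 (C0 + 1) de] gives [b / 2 > (C0 + 1) a]; so the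
   tested quantity exceeds [a >= 1]. *)
have := vS z0 p e (a + 2 * c') b d z0R ac0 (ltW b0) ee d0 touch val grad.
apply/negP; rewrite -ltNge.
have C0c : C0 * (2 * c') <= b / 2.
  have -> : C0 * (2 * c') = (4 * C0) * (a * q) / de / K ^+ 2.
    by rewrite /c'; field; rewrite !gt_eqF.
  have -> : b / 2 = (a * q) / de / 8 by rewrite /b; field; rewrite gt_eqF.
  have D0 : 0 < a * q / de by rewrite divr_gt0.
  rewrite ler_pdivrMr ?exprn_gt0//.
  have : 32 * C0 <= K ^+ 2 by rewrite /K; clear -C1; nra.
  have -> : 4 * C0 * (a * q) / de = (a * q / de) * (4 * C0) by ring.
  move=> H.
  have -> : a * q / de / 8 * K ^+ 2 = (a * q / de) * (K ^+ 2 / 8) by field; rewrite gt_eqF.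
  by rewrite ler_wpM2l ?(ltW D0)//; clear -H; lra.
have bq : 2 * (C0 + 1) * a < b.
  by rewrite /b ltr_pdivlMr ?mulr_gt0//; clear -qL a0; nra.
by clear -C0c bq a1; lra.
Qed.

End Contact.

(** * Propagation of contact to nearby points at a larger opening *)

Section Spreading.
Context {R : realType} {n : nat}.
Implicit Types (x y z c e p : 'rV[R]_n) (v : 'rV[R]_n -> R).

(* The radial barrier [E a s^2 exp (- ka |z - z0| / s)] is a strict subsolution away
   from [z0], so the excess of [v] over the paraboloid at [y0] propagates to some
   point near [z0]. *)
Lemma barrier_spread (C0 Rd V a s R1 : R) v x y0 z0 :
  let ka := 32 * C0 in let E := (C0 + 1) * expR (ka * R1) in
  1 <= C0 -> 1 <= Rd -> 1 <= a -> 0 < s -> s <= 1 ->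
  {within [set z | eucl_norm z <= Rd], continuous v} ->
  (forall z, eucl_norm z <= Rd -> 0 <= v z) ->
  quad_super C0 [set z | eucl_norm z < Rd]
    (fun t q s => t <= V -> q <= V -> s <= 1) v ->
  v y0 + (4 * Rd ^+ 2 + ka * E) * a <= V ->
  contact_at Rd v a x y0 ->
  eucl_norm (y0 - z0) < R1 * s -> eucl_norm z0 + R1 * s < Rd ->
  exists2 y1, eucl_norm (y1 - z0) <= s / 8 &
    eucl_norm y1 <= Rd /\
    v y1 + a / 2 * dot (y1 - x) (y1 - x) <=
    v y0 + a / 2 * dot (y0 - x) (y0 - x) + E * a * s ^+ 2.
Proof.
move=> ka E C1 Rd1 a1 s0 s1 cv v0 vS vV [xR y0R H] y0z z0R.
have ka32 : 32 <= ka by rewrite /ka; lra.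
have E0 : 0 < E by rewrite mulr_gt0 ?expR_gt0//; lra.
have kas : 0 < ka / s by rewrite divr_gt0//; lra.
pose G t := E * a * s ^+ 2 * expR (- (ka / s) * t).
have a0' : 0 < a by lra.
have Eas : 0 < E * a * s ^+ 2 by rewrite mulr_gt0 ?exprn_gt0// mulr_gt0.
have G0 t : 0 < G t by rewrite mulr_gt0 ?expR_gt0.
pose G1 t := - (ka / s) * G t.
have dG (t : R) : is_derive t (1 : R) G (G1 t).
  by apply: is_derive_eq; rewrite /GRing.scale /= /G1 /G; lra.
have dG1 (t : R) : is_derive t (1 : R) G1 ((ka / s) ^+ 2 * G t).
  have ? := dG t.
  by apply: is_derive_eq; rewrite /GRing.scale /= /G1 /G; lra.
have Glt t u : t < u -> G u < G t.
  by move=> tu; rewrite ltr_pM2l// ltr_expR !mulNr ltrN2 ltr_pM2l.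
have GleE t : 0 <= t -> G t <= E * a * s ^+ 2.
  move=> t0; rewrite ler_piMr ?(ltW Eas)// -expR0 ler_expR mulNr oppr_le0.
  by rewrite mulr_ge0// ltW.
pose k1 := v y0 + a / 2 * dot (y0 - x) (y0 - x).
pose g z := a / 2 * dot (z - x) (z - x) - G (eucl_norm (z - z0)).
have cg : continuous g.
  have c0 k := @continuous_const R 'rV[R]_n k.
  exact: (continuous_sub (continuous_mul (c0 _) (@continuous_sqdist _ _ x))
    (continuous_mul (c0 _) (continuous_postcomp (@continuous_expR R)
      (continuous_mul (c0 _) (@continuous_eucl_dist _ _ z0))))).
have AR z : eucl_norm (z - z0) <= R1 * s -> eucl_norm z < Rd.
  by move=> zz; have := eucl_normD (z - z0) z0; rewrite subrK; lra.
have [zs zsA zmin] : exists2 z, eucl_norm (z - z0) <= R1 * s &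
    forall t, eucl_norm (t - z0) <= R1 * s -> v z + g z <= v t + g t.
  apply: (@min_attained _ _ [set z | eucl_norm (z - z0) <= R1 * s] _ v g z0 (R1 * s)) => //.
  - by move=> z /AR/ltW.
  - exact: closed_eucl_ball_closed.
  - by exists y0 => /=; exact: ltW.
have zsR := AR _ zsA.
have fzs : v zs + g zs < k1 - G (R1 * s).
  apply: le_lt_trans (zmin y0 (ltW y0z)) _.
  by rewrite /g addrA -/k1; have := Glt _ _ y0z; lra.
have fk1 := H zs (ltW zsR).
have zin : eucl_norm (zs - z0) < R1 * s.
  rewrite lt_neqAle zsA andbT; apply/eqP => zE.
  by move: fzs; rewrite /g zE /k1; lra.
have fzs' : v zs + a / 2 * dot (zs - x) (zs - x) <= k1 + E * a * s ^+ 2.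
  by move: fzs; rewrite /g; have := GleE _ (eucl_norm_ge0 (zs - z0)); have := G0 (R1 * s); lra.
have [near|far] := lerP (eucl_norm (zs - z0)) (s / 8).
  by exists zs => //; split => //; exact: ltW.
exfalso.
set rho := eucl_norm (zs - z0) in far zin fzs.
have rho0 : 0 < rho by apply: lt_trans far; rewrite divr_gt0.
pose g2 := (ka / s) ^+ 2 * G rho.
have g20 : 0 < g2 by rewrite mulr_gt0 ?exprn_gt0.
pose d := Num.min (R1 * s - rho) 1.
have d0 : 0 < d by rewrite lt_min ltr01 subr_gt0 zin.
have zsz0 : zs != z0.
  by apply/eqP => zE; move: rho0; rewrite /rho zE subrr eucl_norm0 ltxx.
have := @quad_super_radial _ _ C0 _ _ v G G1 z0 x zs a g2 (3 / 4 * g2) d 1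
  vS (ltW (lt_le_trans ltr01 a1)) zsR zsz0 d0.
have g3 : 0 <= 3 / 4 * g2 by rewrite mulr_ge0// ltW.
have g4 : 3 / 4 * g2 < g2 by clear -g20; lra.
rewrite -/rho => /(_ g3 g4 ltr01 (fun t _ => dG t)).
move=> /(_ _ (dG1 rho)) H1.
have a0 : 0 <= a / 2 by rewrite divr_ge0// ltW.
have {H1}: 3 / 4 * g2 - C0 * (a - G1 rho / rho + 1) <= 1.
  apply: H1.
  - by move=> t _; rewrite /G1 mulNr oppr_le0 mulr_ge0 ?ltW.
  - move=> z; rewrite lt_min => /andP[zd _].
    have zA : eucl_norm (z - z0) <= R1 * s.
      by have := eucl_distD zs z z0; rewrite -/rho; clear -zd; lra.
    by have := zmin z zA; rewrite /g -/rho; clear; lra.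
  - have := mulr_ge0 a0 (dot_ge0 (zs - x)).
    have : dot (y0 - x) (y0 - x) <= (2 * Rd) ^+ 2.
      by apply: sqdist_le; apply: le_trans (eucl_normB _ _) _; clear -y0R xR; lra.
    move=> /(ler_wpM2l a0); move: fzs'; rewrite /k1 exprMn.
    have : E * a * s ^+ 2 <= ka * E * a.
      have : s ^+ 2 <= 1 by rewrite expr_le1 ?(ltW s0).
      have Ea : 0 < E * a by rewrite mulr_gt0//; lra.
      move=> /(ler_wpM2l (ltW Ea)); rewrite mulr1 => H1; apply: le_trans H1 _.
      by rewrite -mulrA ler_peMl ?(ltW Ea)//; clear -ka32; lra.
    have : 0 <= Rd ^+ 2 * a by rewrite mulr_ge0 ?sqr_ge0// ltW.
    by clear -vV; lra.
  - apply: le_trans (eucl_normB _ _) _; rewrite !eucl_normZ -/rho.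
    rewrite normrM normfV (gtr0_norm rho0) divfK ?gt_eqF//.
    rewrite /G1 mulNr normrN (gtr0_norm (mulr_gt0 kas (G0 _))) (ger0_norm (_ : 0 <= a)).
    2: exact: ltW.
    have : ka / s * G rho <= ka * E * a.
      have H1 := ler_wpM2l (ltW kas) (GleE _ (ltW rho0)).
      apply: le_trans H1 _.
      have -> : ka / s * (E * a * s ^+ 2) = ka * E * a * s by field; rewrite gt_eqF.
      have ka0 : 0 <= ka by clear -ka32; lra.
      by rewrite ler_piMr// mulr_ge0 ?(ltW a0')// mulr_ge0 ?(ltW E0).
    have : eucl_norm (zs - x) <= 2 * Rd.
      by apply: le_trans (eucl_normB _ _) _; clear -zsR xR; lra.
    move=> /(ler_wpM2l (ltW (lt_le_trans ltr01 a1))).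
    have aRR : a * Rd <= a * Rd ^+ 2.
      by rewrite ler_wpM2l ?(ltW a0')// expr2 ler_peMl// (le_trans ler01).
    have := v0 _ y0R; have : 0 <= a * Rd ^+ 2 by rewrite mulr_ge0 ?sqr_ge0// ltW.
    by clear -vV aRR; lra.
(* In these units [G'' = ka^2 gs], and [rho > s / 8] gives [- C0 G' / rho <= ka^2 gs / 4]. The
   factor [expR (ka * R1)] in [E] keeps [gs] above [(C0 + 1) a] up to radius [R1 s], which absorbs
   [C0 a] and the constants. *)
pose gs := G rho / s ^+ 2.
have gs0 : 0 < gs by rewrite divr_gt0// exprn_gt0.
have g2E : g2 = ka ^+ 2 * gs by rewrite /g2 /gs; field; rewrite gt_eqF.
have gsE : (C0 + 1) * a <= gs.
  have -> : gs = (C0 + 1) * a * (expR (ka * R1) * expR (- (ka / s) * rho)).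
    by rewrite /gs /G /E; field; rewrite gt_eqF.
  rewrite -expRD ler_peMr//; first by rewrite mulr_ge0 ?(ltW a0')// addr_ge0// (le_trans ler01).
  rewrite -expR0 ler_expR.
  have : ka / s * rho <= ka / s * (R1 * s) by rewrite ler_wpM2l ?ltW.
  have -> : ka / s * (R1 * s) = ka * R1 by field; rewrite gt_eqF.
  by clear -zin kas; lra.
have G1E : - G1 rho / rho <= 8 * ka * gs.
  have -> : - G1 rho = ka / s * G rho by rewrite /G1 mulNr opprK.
  rewrite ler_pdivrMr//.
  have -> : ka / s * G rho = 8 * ka * gs * (s / 8) by rewrite /gs; field; rewrite gt_eqF.
  have kgs : 0 <= 8 * ka * gs by rewrite mulr_ge0 ?(ltW gs0)//; clear -ka32; lra.
  by rewrite ler_wpM2l// ltW.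
have := ler_wpM2l (le_trans ler01 C1) G1E.
have -> : C0 * (8 * ka * gs) = ka ^+ 2 * gs / 4 by rewrite /ka; field.
rewrite g2E => H1 H2.
have k2 : 512 * gs <= ka ^+ 2 * gs / 2.
  have : 32 ^+ 2 <= ka ^+ 2 by rewrite ler_sqr ?nnegrE//; clear -ka32; lra.
  by move=> /(ler_wpM2r (ltW gs0)); clear; lra.
by move: H1 H2; clear -k2 gsE gs0 a1 C1; nra.
Qed.

(** Adding a steep paraboloid of opening [64 E a] centred at [x'] forces the minimum close to [x'].
    The sum of the two paraboloids is again one, with the weighted mean of [x] and [x'] as vertex,
    so varying [x'] varies the vertex. *)
Lemma contact_near (Rd E a s : R) v x x' y0 y1 :
  1 <= a -> 0 < E -> 0 < s ->
  {within [set z | eucl_norm z <= Rd], continuous v} ->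
  contact_at Rd v a x y0 -> eucl_norm y1 <= Rd ->
  v y1 + a / 2 * dot (y1 - x) (y1 - x) <=
    v y0 + a / 2 * dot (y0 - x) (y0 - x) + E * a * s ^+ 2 ->
  eucl_norm x' <= Rd -> eucl_norm (y1 - x') <= s / 4 ->
  exists2 y, eucl_norm (y - x') <= s / 3 &
    contact_at Rd v (a * (1 + 64 * E)) ((1 + 64 * E)^-1 *: (x + (64 * E) *: x')) y.
Proof.
move=> a1 E0 s0 cv [xR y0R H] y1R y1E x'R y1x'.
set Th := 64 * E; have Th0 : 0 < Th by rewrite mulr_gt0.
pose g z := a / 2 * dot (z - x) (z - x) + Th * a / 2 * dot (z - x') (z - x').
have cg : continuous g.
  have c0 k := @continuous_const R 'rV[R]_n k.
  exact: (continuous_add (continuous_mul (c0 _) (@continuous_sqdist _ _ x))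
    (continuous_mul (c0 _) (@continuous_sqdist _ _ x'))).
have [y yR ymin] : exists2 z, eucl_norm z <= Rd &
    forall t, eucl_norm t <= Rd -> v z + g z <= v t + g t.
  apply: (@min_attained _ _ [set z | eucl_norm z <= Rd] _ v g 0 Rd) => //.
  - have -> : [set z | eucl_norm z <= Rd] = [set z : 'rV[R]_n | eucl_norm (z - 0) <= Rd].
      by apply/funext => z; rewrite /= subr0.
    exact: closed_eucl_ball_closed.
  - by move=> z; rewrite subr0.
  - by exists x.
have Tha : 0 < Th * a by rewrite mulr_gt0//; lra.
exists y.
  have := ymin y1 y1R; rewrite /g; have := H y yR.
  have := ler_wpM2l (ltW (divr_gt0 Tha (ltr0n _ 2))) (sqdist_le y1x').
  move=> H1 H2 H3.
  (* With [Th = 64 E] the excess [E a s^2] is [Th a / 2] times [s^2 / 32]; together with [s^2 / 16]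
     this is [3 / 32 s^2], below [(s / 3)^2]. *)
  have : Th * a / 2 * dot (y - x') (y - x') <= E * a * s ^+ 2 + Th * a / 2 * (s / 4) ^+ 2.
    by lra.
  have -> : E * a * s ^+ 2 + Th * a / 2 * (s / 4) ^+ 2 = Th * a / 2 * (3 / 32 * s ^+ 2).
    by rewrite /Th; field.
  rewrite ler_pM2l ?divr_gt0// => H4.
  rewrite ler_eucl_sqr ?divr_ge0 ?(ltW s0)//; apply: le_trans H4 _.
  by have := sqr_ge0 s; lra.
have Th1 : 0 < 1 + Th by lra.
set xb := _ *: _.
have xbE z : (1 + Th) * dot z xb = dot z x + Th * dot z x'.
  by rewrite dotZr dotDr dotZr mulrA divff ?gt_eqF// mul1r.
split => //.
  rewrite eucl_normZ gtr0_norm ?invr_gt0// mulrC ler_pdivrMr//.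
  apply: le_trans (eucl_normD _ _) _; rewrite eucl_normZ (gtr0_norm Th0).
  by have := ler_wpM2l (ltW Th0) x'R; lra.
clearbody xb.
move=> z zR; have := ymin z zR; rewrite /g.
have Q t : a * (1 + Th) / 2 * dot (t - xb) (t - xb) =
  a / 2 * dot (t - x) (t - x) + Th * a / 2 * dot (t - x') (t - x')
  + (a * (1 + Th) / 2 * dot xb xb - a / 2 * dot x x - Th * a / 2 * dot x' x').
  have : a * ((1 + Th) * dot t xb) = a * (dot t x + Th * dot t x') by rewrite xbE.
  rewrite !dotE (dotC xb t) (dotC x t) (dotC x' t); lra.
by rewrite !Q; lra.
Qed.

End Spreading.

(** * Passing to the limit along ever closer points *)

Section GrowthOfContactSets.
Context {R : realType} {n : nat}.
Implicit Types (x y z c : 'rV[R]_n) (v : 'rV[R]_n -> R).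
Local Notation N := (n%:R : R).

Lemma within_continuous_eps (A : set 'rV[R]_n) v p (eps : R) :
  {within A, continuous v} -> A p -> 0 < eps ->
  exists2 d, 0 < d & forall z, A z -> eucl_norm (z - p) < d -> `|v z - v p| < eps.
Proof.
move=> /subspace_continuousP/(_ p) cv Ap eps0.
have /cvgrPdist_lt/(_ eps eps0) := cv Ap.
rewrite near_withinE => /near_eucl[d d0 H].
by exists d => // z Az zp; rewrite distrC; exact: H.
Qed.

(** By compactness the points [ys j] have a cluster point, near which [v (ys j)] and [v (zs j)] are
    almost equal. This replaces a common point of the two contact sets. *)
Lemma close_points_values (Rd : R) v k1 k2 :
  {within [set z | eucl_norm z <= Rd], continuous v} ->
  (forall j : nat, exists y z : 'rV[R]_n, [/\ eucl_norm y <= Rd, eucl_norm z <= Rd,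
     v y <= k1, k2 <= v z & forall i, `|y ord0 i - z ord0 i| <= 1 / 2 ^+ j]) ->
  k2 <= k1.
Proof.
move=> cv /choice[ys /choice[zs H]].
rewrite leNgt; apply/negP => k12.
pose A := [set z : 'rV[R]_n | eucl_norm (z - 0) <= Rd].
have cA : compact A := @closed_eucl_ball_compact _ _ 0 Rd.
have Ays : (ys @ \oo) A.
  by exists 0%N => // j _; rewrite /A /= subr0; case: (H j).
have [p [Ap clp]] := cA (ys @ \oo) _ Ays.
have AE : A = [set z | eucl_norm z <= Rd] by apply/funext => z; rewrite /A /= subr0.
rewrite -AE in cv.
have [d d0 Hd] := @within_continuous_eps A v p ((k2 - k1) / 2) cv Ap ltac:(lra).
have [J HJ] : exists J : nat, forall j, (J <= j)%N -> (N + 1) / 2 ^+ j < d / 2.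
  have N1 : 0 < N + 1 by rewrite ltr_wpDl.
  have e0 : 0 < d / 2 / (N + 1) by rewrite !divr_gt0.
  have [J _ HJ] := @near_infty_natSinv_expn_lt R (PosNum e0).
  exists J => j /HJ /=; rewrite mul1r => H'.
  by rewrite mulrC -ltr_pdivlMr.
have B1 : nbhs p [set y | eucl_norm (y - p) < d / 2].
  by apply: (near_eucl _ _).2; exists (d / 2); first by rewrite divr_gt0.
have B2 : (ys @ \oo) [set y | exists2 j, (J <= j)%N & y = ys j].
  by exists J => // j /= Jj; exists j.
have [_ [[j Jj ->] /= yp]] := clp _ _ B2 B1.
have [yR zR yk zk yz] := H j.
have := Hd (ys j); rewrite AE => /(_ yR ltac:(lra)).
have yzd : eucl_norm (ys j - zs j) < d / 2.
  apply: le_lt_trans (HJ j Jj).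
  apply: le_trans (@eucl_le_coord _ _ _ (1 / 2 ^+ j) _ _) _.
  - by rewrite divr_ge0// exprn_ge0.
  - by move=> i; rewrite !mxE.
  - by rewrite mulrA mulr1 ler_wpM2r ?lerDl// invr_ge0 exprn_ge0.
have := Hd (zs j); rewrite AE => /(_ zR).
have := eucl_distD (ys j) (zs j) p; rewrite (eucl_distC (zs j) (ys j)) => H1 /(_ ltac:(lra)).
by rewrite !ltr_norml; lra.
Qed.

End GrowthOfContactSets.

(** * Constants and the density of contact points in a dyadic cube *)

Section InteriorEstimate.
Context {R : realType} {n : nat}.
Implicit Types (x y z c : 'rV[R]_n) (v : 'rV[R]_n -> R).
Local Notation N := (n%:R : R).

(** Leaves room around the unit cube for the distance [32 C0 de], [de <= N + 1], that
    [contact_lipschitz] requires. *)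
Definition ks_radius (C0 : R) : R := 33 * C0 * (N + 1).
(** The constant [E] of [barrier_spread] for [R1 = 2 N + 1]. *)
Definition ks_height (C0 : R) : R := (C0 + 1) * expR (32 * C0 * (2 * N + 1)).
Definition ks_ratio (C0 : R) : R := 1 + 64 * ks_height C0.
(** A bound for the values and gradients of all tests used. [14 = 2 + 12] adds the bound of
    [contact_value] to the margin in [contact_lipschitz], at the increased opening; the last term is
    the margin for the gradient of the barrier in [barrier_spread]. *)
Definition ks_slope (C0 a : R) : R :=
  1 + (14 * ks_ratio C0 * ks_radius C0 ^+ 2 + 32 * C0 * ks_height C0) * a.

Lemma ks_height_gt0 C0 : 1 <= C0 -> 0 < ks_height C0.
Proof. by move=> C1; rewrite mulr_gt0 ?expR_gt0//; lra. Qed.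

Lemma ks_ratio_ge1 C0 : 1 <= C0 -> 1 <= ks_ratio C0.
Proof. by move=> /ks_height_gt0; rewrite /ks_ratio; lra. Qed.

Lemma ks_radius_ge C0 : 1 <= C0 -> 33 * (N + 1) <= ks_radius C0.
Proof. by move=> C1; rewrite ler_wpM2r ?addr_ge0//; lra. Qed.

Lemma abs_natr_sub_ge1 (a b : nat) : a != b -> 1 <= `|a%:R - b%:R : R|.
Proof.
case: ltngtP => // [ab|ba] _.
  have : a.+1%:R <= b%:R :> R by rewrite ler_nat.
  by rewrite -addn1 natrD => H; rewrite distrC ger0_norm; lra.
have : b.+1%:R <= a%:R :> R by rewrite ler_nat.
by rewrite -addn1 natrD => H; rewrite ger0_norm; lra.
Qed.

Lemma cube01_norm y : cube 0 1 y -> eucl_norm y <= N / 2.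
Proof.
move=> yc; apply: eucl_le_coord; first by rewrite invr_ge0.
by move=> i; have := yc i; rewrite mxE subr0 mul1r.
Qed.

(* The vertices are taken on a grid of [2 ^ (n (j - m))] points in the cube; by
   [contact_lipschitz] their contact points lie in distinct cubes of level [j]. *)
Lemma contact_density (C0 V a : R) (m : nat) v c sp ep (j : nat) :
  let Rd := ks_radius C0 in
  1 <= C0 -> 1 <= a ->
  {within [set z | eucl_norm z <= Rd], continuous v} ->
  (forall z, eucl_norm z <= Rd -> 0 <= v z) ->
  quad_super C0 [set z | eucl_norm z < Rd]
    (fun t q s => t <= V -> q <= V -> s <= 1) v ->
  ks_slope C0 a <= V ->
  128 * (C0 + 1) * (N + 1) ^+ 2 < 2 ^+ m ->
  (exists2 x0, eucl_norm x0 <= Rd & v x0 <= 1) ->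
  0 < sp <= 1 -> cube c sp `<=` cube 0 1 ->
  contact Rd v a `&` cube c sp !=set0 ->
  (2 ^+ (n * m))^-1 * 2 ^+ (n * j) <=
  (hits (contact Rd v (a * ks_ratio C0)) j (child c sp ep) (sp / 2))%:R :> R.
Proof.
move=> Rd C1 a1 cv v0 vS vV mP [x0 x0R vx0] /andP[sp0 sp1] sub [y0 [[x cx] y0c]].
have N0 : 0 <= N by [].
have RdN := ks_radius_ge C1; rewrite -/Rd in RdN.
have Rd1 : 1 <= Rd by lra.
have E0 := ks_height_gt0 C1; have Th1 := ks_ratio_ge1 C1.
set E := ks_height C0 in E0.
set Th := ks_ratio C0 in Th1 *.
set s := sp / 2; have s0 : 0 < s by rewrite divr_gt0.
have s1 : s <= 1 by rewrite /s; lra.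
set z0 := child c sp ep.
have aR0 : 0 <= Rd ^+ 2 * a by rewrite mulr_ge0 ?sqr_ge0//; lra.
have aTR : Rd ^+ 2 * a <= Th * (Rd ^+ 2 * a) by rewrite ler_peMl.
have vb b y : 0 <= b -> contact Rd v b y -> 0 <= v y <= 1 + 2 * b * Rd ^+ 2.
  by move=> b0; apply: contact_value vx0 => //; lra.
have Vy0 : v y0 + (4 * Rd ^+ 2 + 32 * C0 * E) * a <= V.
  have /andP[_ H] := vb a y0 (le_trans ler01 a1) (ex_intro _ x cx).
  move: vV; rewrite /ks_slope -/Rd -/E -/Th; lra.
have z0c : cube c sp z0.
  apply: (@child_sub_cube _ _ c sp ep) => i; rewrite subrr normr0 divr_ge0//.
  exact: ltW.
have z0N := cube01_norm (sub _ z0c).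
(* In each coordinate [y0] is at most [3 / 2 s] from the centre of the child, whence
   [R1 = 2 N + 1]. *)
have y0z : eucl_norm (y0 - z0) < (2 * N + 1) * s.
  apply: (@le_lt_trans _ _ (N * (3 / 2 * s))).
    apply: eucl_le_coord => [|i]; first by lra.
    by have := y0c i; rewrite !mxE /s; case: ifP => _; rewrite !ler_norml; clear; lra.
  have : 0 <= N * s by rewrite mulr_ge0// ltW.
  lra.
have z0R1 : eucl_norm z0 + (2 * N + 1) * s < Rd.
  have : (2 * N + 1) * s <= (2 * N + 1) * 1 by rewrite ler_wpM2l//; lra.
  lra.
have [y1 y1z [y1R y1E]] := barrier_spread C1 Rd1 a1 s0 s1 cv v0 vS Vy0 cx y0z z0R1.
(* The subtraction truncates: for [j < m] the grid has one point, and one hit is enough because the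
   required count is then at most [1]. *)
set k := (j - m)%N.
pose del := s / (8 * (N + 1)).
have del0 : 0 < del by rewrite divr_gt0//; lra.
pose xg (g : {ffun 'I_n -> 'I_(2 ^ k)}) : 'rV[R]_n :=
  z0 + \row_i (del * ((g i)%:R / 2 ^+ k)).
have p2 i : 0 < (2 : R) ^+ i by rewrite exprn_gt0.
have xgz g : eucl_norm (xg g - z0) <= s / 8.
  apply: (@le_trans _ _ (N * del)).
    apply: eucl_le_coord => [|i]; first exact: ltW.
    rewrite !mxE addrC addKr ger0_norm; last first.
      by rewrite mulr_ge0 ?(ltW del0)// divr_ge0// ltW.
    rewrite ler_piMr ?(ltW del0)// ler_pdivrMr// mul1r -natrX ler_nat.
    exact: ltnW.
  have -> : s / 8 = (N + 1) * del by rewrite /del; field; clear -N0; lra.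
  by rewrite ler_wpM2r ?(ltW del0)// lerDl.
have /choice[yg ygP] : forall g, exists y, eucl_norm (y - xg g) <= s / 3 /\
    contact_at Rd v (a * Th) (Th^-1 *: (x + (64 * E) *: xg g)) y.
  move=> g.
  have xgR : eucl_norm (xg g) <= Rd.
    have := eucl_normD (xg g - z0) z0; by rewrite subrK; have := xgz g; clear -z0N s1 RdN N0; lra.
  have y1xg : eucl_norm (y1 - xg g) <= s / 4.
    by have := eucl_distD z0 y1 (xg g); rewrite (eucl_distC z0); have := xgz g; clear -y1z; lra.
  have [y H1 H2] := contact_near a1 E0 s0 cv cx y1R y1E xgR y1xg.
  by exists y.
(* The contact points stay in the child because [s / 3 + s / 8 < s / 2]. *)
have ygc g : cube z0 s (yg g).
  move=> i; have [H1 _] := ygP g.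
  have := coord_le_eucl (yg g - z0) i; rewrite !mxE => H2; apply: le_trans H2 _.
  by have := eucl_distD (xg g) (yg g) z0; have := xgz g; clear -H1 s0; lra.
have yg01 g : cube 0 1 (yg g).
  by apply: sub; apply: (@child_sub_cube _ _ c sp ep); exact: ygc.
have aTh1 : 1 <= a * Th by rewrite -[leLHS]mulr1; apply: ler_pM.
have hitsN : ((2 ^ k) ^ n <= hits (contact Rd v (a * Th)) j z0 s)%N.
  rewrite -[X in (X <= _)%N](_ : #|[set: {ffun 'I_n -> 'I_(2 ^ k)}]%SET| = _); last first.
    by rewrite cardsT card_ffun !card_ord.
  apply: (@hits_separated _ _ _ _ _ yg); first exact: ltW.
    by move=> g _; split => //; exists (Th^-1 *: (x + (64 * E) *: xg g)); have [] := ygP g.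
  move=> g g' _ _ gg'; apply: contrapT => /forallNP H.
  have {}H i : `|yg g ord0 i - yg g' ord0 i| <= s / 2 ^+ j.
    by rewrite leNgt; apply/negP.
  pose de := (N + 1) * (s / 2 ^+ j).
  have sj0 : 0 < s / 2 ^+ j by rewrite divr_gt0.
  have de0 : 0 < de by rewrite mulr_gt0//; lra.
  have yde : eucl_norm (yg g - yg g') <= de.
    apply: (@le_trans _ _ (N * (s / 2 ^+ j))).
      by apply: eucl_le_coord => [|i]; [exact: ltW|rewrite !mxE].
    by rewrite ler_wpM2r ?(ltW sj0)// lerDl.
  have [_ cg] := ygP g; have [_ cg'] := ygP g'.
  have deR : eucl_norm (yg g) + 32 * C0 * de < Rd.
    have := cube01_norm (yg01 g).
    have : de <= N + 1.
      have sj1 : s / 2 ^+ j <= 1.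
        rewrite ler_pdivrMr// mul1r; apply: le_trans s1 _.
        by rewrite exprn_ege1// ler1n.
      by rewrite /de ler_piMr// addr_ge0.
    have C0' : 0 <= 32 * C0 by clear -C1; lra.
    by move=> /(ler_wpM2l C0'); rewrite /Rd /ks_radius; clear -C1 N0; nra.
  have Vg : v (yg g) + 12 * (a * Th) * Rd ^+ 2 <= V.
    have /andP[_ H1] := vb (a * Th) (yg g) (le_trans ler01 aTh1) (ex_intro _ (Th^-1 *: (x + (64 * E) *: xg g)) cg).
    have : 0 <= C0 * E * a.
      by rewrite mulr_ge0 ?(le_trans ler01 a1)// mulr_ge0 ?(ltW E0)// (le_trans ler01 C1).
    by move: vV; rewrite /ks_slope -/Rd -/E -/Th; clear -H1; lra.
  have := contact_lipschitz C1 Rd1 aTh1 de0 cv v0 vS Vg deR cg cg' yde.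
  rewrite -scalerBr opprD addrACA subrr add0r -scalerBr scalerA.
  have -> : xg g - xg g' = \row_i (del * (((g i)%:R - (g' i)%:R) / 2 ^+ k)).
    by apply/rowP => i; rewrite !mxE; ring.
  have [i gi] : exists i, g i != g' i.
    apply: contrapT => /forallNP gE; move/eqP: gg'; apply; apply/ffunP => i.
    by apply/eqP/negPn/negP => /gE.
  rewrite eucl_normZ => Hl.
  (* Averaging with the common point [x] shrinks the grid by the factor [64 E / (1 + 64 E)], so
     vertices stay at least half a grid step apart. *)
  have E64 : 2^-1 <= `|Th^-1 * (64 * E)|.
    have E1 : 1 <= 64 * E.
      rewrite /E /ks_height; have : 1 <= expR (32 * C0 * (2 * N + 1)).
        rewrite -[leLHS]expR0 ler_expR; have C0' : 0 <= 32 * C0 by clear -C1; lra.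
        by apply: mulr_ge0 => //; clear -N0; lra.
      by move=> /(ler_wpM2l (addr_ge0 (le_trans ler01 C1) ler01)); clear -C1; lra.
    have Th0 : 0 < Th := lt_le_trans ltr01 Th1.
    rewrite gtr0_norm; last by rewrite mulr_gt0 ?invr_gt0// mulr_gt0.
    by rewrite ler_pdivlMl// /Th /ks_ratio -/E; clear -E1; lra.
  have Dl : del / 2 ^+ k <= eucl_norm (\row_i (del * (((g i)%:R - (g' i)%:R) / 2 ^+ k)) : 'rV[R]_n).
    have := coord_le_eucl (\row_i (del * (((g i)%:R - (g' i)%:R) / 2 ^+ k)) : 'rV[R]_n) i.
    rewrite mxE; apply: le_trans.
    rewrite normrM (gtr0_norm del0) ler_pM2l// normrM normfV (gtr0_norm (p2 k)).
    rewrite -[leLHS]mul1r ler_wpM2r ?invr_ge0 ?(ltW (p2 _))//.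
    exact: abs_natr_sub_ge1.
  have Hl' : 2^-1 * (del / 2 ^+ k) <= 8 * (C0 + 1) * de.
    apply: le_trans Hl; apply: ler_pM => //.
    by rewrite divr_ge0 ?ltW.
  (* If [j = m + k], comparing half a grid step with the Lipschitz bound gives
     [2 ^+ m <= 128 (C0 + 1) (N + 1)^2], against [mP]. If [j < m], the coordinates range over ['I_1]
     and cannot differ. *)
  have [jm|mj] := leqP m j.
    have jE : (2 : R) ^+ j = 2 ^+ m * 2 ^+ k by rewrite -exprD /k subnKC.
    move: Hl'; rewrite /de /del jE => Hl'.
    have : s * 2 ^+ m <= s * (128 * (C0 + 1) * (N + 1) ^+ 2).
      have K0 : 0 < 16 * (N + 1) * 2 ^+ m * 2 ^+ k by rewrite !mulr_gt0//; lra.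
      have := ler_wpM2r (ltW K0) Hl'.
      have -> : 2^-1 * (s / (8 * (N + 1)) / 2 ^+ k) * (16 * (N + 1) * 2 ^+ m * 2 ^+ k)
        = s * 2 ^+ m by field; rewrite !gt_eqF//=; lra.
      have -> : 8 * (C0 + 1) * ((N + 1) * (s / (2 ^+ m * 2 ^+ k))) * (16 * (N + 1) * 2 ^+ m * 2 ^+ k)
        = s * (128 * (C0 + 1) * (N + 1) ^+ 2) by field; rewrite !gt_eqF//=.
      by [].
    by rewrite ler_pM2l// leNgt mP.
  move/eqP: gi; apply; apply/val_inj.
  have k0 : k = 0%N by apply/eqP; rewrite subn_eq0 ltnW.
  have := ltn_ord (g i); have := ltn_ord (g' i).
  by move: (g i) (g' i); rewrite k0 => -[[|?] ?] -[[|?] ?].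
apply: le_trans (_ : ((2 ^ k) ^ n)%N%:R <= _); last by rewrite ler_nat.
rewrite -expnM natrX ler_pdivrMl// -exprD -!natrX ler_nat leq_exp2l//.
by rewrite [(k * n)%N]mulnC -mulnDr leq_mul2l -leq_subLR leqnn orbT.
Qed.

End InteriorEstimate.

(** * A function and its reflection cannot both be small somewhere *)

Section TwoSidedBound.
Context {R : realType} {n : nat}.
Implicit Types (x y z c : 'rV[R]_n) (v : 'rV[R]_n -> R).
Local Notation N := (n%:R : R).

(** The initial [32] puts the first contact point within [1 / 4] of its vertex, since
    [16 |y - x0|^2 <= v x0 <= 1]; it thus lies in the unit cube. *)
Definition ks_opening (C0 : R) (k : nat) : R := 32 * ks_ratio (n := n) C0 ^+ k.

Lemma ks_opening_ge C0 k : 1 <= C0 -> 32 <= ks_opening C0 k.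
Proof.
by move=> C1; rewrite /ks_opening ler_peMr// exprn_ege1// ks_ratio_ge1.
Qed.

Lemma ks_openingS C0 k : ks_opening C0 k.+1 = ks_opening C0 k * ks_ratio (n := n) C0.
Proof. by rewrite /ks_opening exprSr mulrA. Qed.

Lemma ks_opening_mono C0 k l : 1 <= C0 -> (k <= l)%N ->
  ks_opening C0 k <= ks_opening C0 l.
Proof.
by move=> C1 kl; rewrite /ks_opening ler_pM2l// ler_weXn2l// ks_ratio_ge1.
Qed.

(** By [contact_density] and [hits_growth], each increase of the opening multiplies the proportion
    of missed cubes by at most [1 - 2 ^- (n * m)]. The rate is the same at all levels [j], which
    allows [j] to tend to infinity with [K] fixed. *)
Lemma contact_growth (C0 V : R) (m K : nat) v x0 :
  let Rd := ks_radius (n := n) C0 in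
  1 <= C0 ->
  {within [set z | eucl_norm z <= Rd], continuous v} ->
  (forall z, eucl_norm z <= Rd -> 0 <= v z) ->
  quad_super C0 [set z | eucl_norm z < Rd]
    (fun t q s => t <= V -> q <= V -> s <= 1) v ->
  ks_slope (n := n) C0 (ks_opening C0 K) <= V ->
  128 * (C0 + 1) * (N + 1) ^+ 2 < 2 ^+ m ->
  (forall i, `|x0 ord0 i| <= 1 / 4) -> v x0 <= 1 ->
  forall k, (k <= K)%N -> forall j,
  2 ^+ (n * j) - (hits (contact Rd v (ks_opening C0 k)) j 0 1)%:R <=
  (1 - (2 ^+ (n * m))^-1) ^+ k * 2 ^+ (n * j) :> R.
Proof.
move=> Rd C1 cv v0 vS vV mP x0q vx0.
have N0 : 0 <= N by [].
have RdN := ks_radius_ge (n := n) C1; rewrite -/Rd in RdN.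
have x0R : eucl_norm x0 <= Rd.
  by apply: le_trans (eucl_le_coord _ x0q) _; lra.
have base : contact Rd v (ks_opening C0 0) `&` cube 0 1 !=set0.
  pose g z := 32 / 2 * dot (z - x0) (z - x0).
  have cg : continuous g := continuous_mul (@continuous_const _ _ _) (@continuous_sqdist _ _ x0).
  have [y yR ymin] : exists2 z, eucl_norm z <= Rd &
      forall t, eucl_norm t <= Rd -> v z + g z <= v t + g t.
    apply: (@min_attained _ _ [set z | eucl_norm z <= Rd] _ v g 0 Rd) => //.
    - have -> : [set z | eucl_norm z <= Rd] = [set z : 'rV[R]_n | eucl_norm (z - 0) <= Rd].
        by apply/funext => z; rewrite /= subr0.
      exact: closed_eucl_ball_closed.
    - by move=> z; rewrite subr0.
    - by exists x0.
  exists y; split.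
    by exists x0; rewrite /ks_opening expr0 mulr1; split.
  have yx : eucl_norm (y - x0) <= 1 / 4.
    rewrite ler_eucl_sqr//; have := ymin x0 x0R; rewrite /g subrr dot0l mulr0 addr0.
    by have := v0 _ yR; lra.
  move=> i; rewrite mxE subr0.
  have := coord_le_eucl (y - x0) i; rewrite !mxE => H.
  by have := le_trans H yx; have := x0q i; rewrite !ler_norml; lra.
have p1 : 1 <= (2 : R) ^+ (n * m) by rewrite exprn_ege1//; lra.
have mu1 : 0 <= ((2 : R) ^+ (n * m))^-1 <= 1.
  by rewrite invr_ge0 invf_le1 ?(lt_le_trans ltr01 p1)// p1 (le_trans ler01 p1).
elim=> [|k IH] kK j; first by rewrite expr0 mul1r gerBl.
have a32 := ks_opening_ge k C1.
have sub0 : contact Rd v (ks_opening C0 0) `<=` contact Rd v (ks_opening C0 k).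
  apply: contact_mono; last exact: ks_opening_mono.
  by have := ks_opening_ge 0 C1; lra.
have subS : contact Rd v (ks_opening C0 k) `<=` contact Rd v (ks_opening C0 k.+1).
  by apply: contact_mono; [lra|exact: ks_opening_mono].
pose good c s := 0 < s <= 1 /\ cube c s `<=` cube (0 : 'rV[R]_n) 1.
have gchild c s ep : good c s -> good (child c s ep) (s / 2).
  move=> [s01 H]; split; first by lra.
  by move=> y /child_sub_cube/H.
have := @hits_growth _ _ _ _ good (2 ^+ (n * m))^-1 subS mu1 gchild _ 0 1 j _ _.
move=> /(_ _ _ _)/le_trans; apply.
- move=> c s ep j' [s01 sub] meet; rewrite ks_openingS.
  apply: (contact_density (C0 := C0) (V := V) (a := ks_opening C0 k)) => //.
  + by lra.
  + apply: le_trans vV; rewrite /ks_slope lerD2l ler_wpM2l//.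
      have := ks_ratio_ge1 (n := n) C1; have := ks_height_gt0 (n := n) C1 => E0 Th1.
      by rewrite addr_ge0// mulr_ge0 ?sqr_ge0 ?(ltW E0)//; lra.
    by apply: ks_opening_mono => //; exact: ltnW.
  + by exists x0.
- by split => //; lra.
- by case: base => y [y1 y2]; exists y; split => //; exact: sub0.
rewrite exprS -mulrA; apply: ler_wpM2l; first by rewrite subr_ge0; case/andP: mu1.
exact: IH (ltnW kK) j.
Qed.

(** [contact_value] gives [v <= V] on one contact set and [v >= S - V] on the other, and points of
    the two sets get arbitrarily close. That [V] is fixed before [S] makes this contradictory for
    large [S]. *)
Lemma two_sided_bound (C0 : R) : 1 <= C0 ->
  exists2 V : R, 1 <= V & forall v (S : R) x0,
  let Rd := ks_radius (n := n) C0 in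
  {within [set z | eucl_norm z <= Rd], continuous v} ->
  (forall z, eucl_norm z <= Rd -> 0 <= v z <= S) ->
  quad_super C0 [set z | eucl_norm z < Rd]
    (fun t q s => t <= V -> q <= V -> s <= 1) v ->
  quad_super C0 [set z | eucl_norm z < Rd]
    (fun t q s => t <= V -> q <= V -> s <= 1) (fun z => S - v z) ->
  (forall i, `|x0 ord0 i| <= 1 / 4) -> v x0 <= 1 -> S - v 0 <= 1 -> S <= 2 * V.
Proof.
move=> C1.
have [m mP] : exists m : nat, 128 * (C0 + 1) * (N + 1) ^+ 2 < 2 ^+ m.
  pose X := 128 * (C0 + 1) * (N + 1) ^+ 2.
  have X0 : 0 <= X by rewrite mulr_ge0 ?sqr_ge0//; lra.
  exists (Num.bound X).
  apply: lt_trans (archi_boundP X0) _.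
  by rewrite -natrX ltr_nat ltn_expl.
set mu := (2 ^+ (n * m))^-1 : R.
have p1 : 1 <= (2 : R) ^+ (n * m) by rewrite exprn_ege1//; lra.
have mu0 : 0 < mu by rewrite invr_gt0; lra.
have mu1 : mu <= 1 by rewrite /mu invf_le1 ?(lt_le_trans ltr01 p1).
(* After [K] steps each contact set misses less than half of the cubes, which is what [hits_common]
   needs. *)
have [K KP] : exists K : nat, (1 - mu) ^+ K < 1 / 2.
  have : (1 - mu) ^+ j @[j --> \oo] --> (0 : R).
    by apply: cvg_expr; rewrite ger0_norm; lra.
  move=> /cvgrPdist_lt/(_ (1 / 2) ltac:(lra))[K _ /(_ K (leqnn K))] /=.
  by rewrite sub0r normrN => H; exists K; apply: le_lt_trans (ler_norm _) H.
set a := ks_opening C0 K.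
have a32 : 32 <= a := ks_opening_ge K C1.
set Rd := ks_radius C0.
have RdN := ks_radius_ge (n := n) C1; rewrite -/Rd in RdN.
have N0 : 0 <= N by [].
have E0 := ks_height_gt0 (n := n) C1; have Th1 := ks_ratio_ge1 (n := n) C1.
have slope_ge : 1 + 2 * a * Rd ^+ 2 <= ks_slope (n := n) C0 a.
  rewrite /ks_slope -/Rd.
  have H : 0 <= Rd ^+ 2 * a by rewrite mulr_ge0 ?sqr_ge0//; lra.
  have := ler_wpM2r H Th1.
  have C0' : 0 <= C0 by lra.
  have : 0 <= C0 * ks_height (n := n) C0 * a.
    by rewrite mulr_ge0 ?(le_trans _ a32)// mulr_ge0 ?(ltW E0).
  by lra.
exists (ks_slope (n := n) C0 a).
  apply: le_trans slope_ge; rewrite lerDl mulr_ge0 ?sqr_ge0//; lra.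
move=> v S x0; rewrite -/Rd => Rd' cv vS01 vsup wsup x0q vx0 w0.
have v0 z : eucl_norm z <= Rd -> 0 <= v z by move=> /vS01/andP[].
have cw : {within [set z | eucl_norm z <= Rd], continuous (fun z => S - v z)}.
  by move=> z; exact: (cvgB (cvg_cst _) (cv z)).
have w0' z : eucl_norm z <= Rd -> 0 <= S - v z by move=> /vS01/andP[_]; rewrite subr_ge0.
have z0q i : `|(0 : 'rV[R]_n) ord0 i| <= 1 / 4 by rewrite mxE normr0; lra.
have gv := contact_growth C1 cv v0 vsup (lexx _) mP x0q vx0 (leqnn K).
have gw := contact_growth C1 cw w0' wsup (lexx _) mP z0q w0 (leqnn K).
set V := ks_slope C0 a.
suff : S - V <= V by lra.
apply: (close_points_values cv) => j.
have p0 : 0 < (2 : R) ^+ (n * j) by rewrite exprn_gt0.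
have := ltr_pM2r p0 ((1 - mu) ^+ K) (1 / 2); rewrite KP => KP'.
have [y [z [yA zB yc zc yz]]] := @hits_common _ _ (contact Rd v a)
  (contact Rd (fun z => S - v z) a) j 0 1 ltac:(
    by rewrite -(ltr_nat R) natrD natrX; have := gv j; have := gw j; rewrite -/mu -/a -/Rd; lra).
have x0R : eucl_norm x0 <= Rd.
  by apply: le_trans (eucl_le_coord _ x0q) _; lra.
have Rd0 : 0 <= Rd by lra.
have a0 : 0 <= a by lra.
have z0R : eucl_norm (0 : 'rV[R]_n) <= Rd by rewrite eucl_norm0.
exists y, z; split => //.
- by have [? []] := yA.
- by have [? []] := zB.
- by have /andP[_ /le_trans] := contact_value a0 Rd0 x0R v0 vx0 yA; apply.
- have /andP[_ H] := contact_value a0 Rd0 z0R w0' w0 zB.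
  by have := le_trans H slope_ge; rewrite -/V; lra.
Qed.

End TwoSidedBound.

(** * Primitives and increments of functions on the half line *)

Section Primitives.
Context {R : realType}.
Local Notation mu := (@lebesgue_measure R).
Implicit Types f g J : R -> R.

(** Integration starts at [-1] so that the derivative at [0] is two-sided. *)
Lemma continuous_has_primitive f : continuous f ->
  exists J, forall x : R, -1 < x -> is_derive x (1 : R) J (f x).
Proof.
move=> cf; exists (fun x => \int[mu]_(t in [set` `[-1, x]]) (f t)).
move=> x x1.
have intf : mu.-integrable `[-1, x + 1] (EFin \o f).
  apply: continuous_compact_integrable; first exact: segment_compact.
  exact: continuous_subspaceT.
have [dJ JE] := @continuous_FTC1_closed R f (-1) x (x + 1) ltac:(lra) intf x1 (cf x).
apply: DeriveDef; first exact: dJ.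
by rewrite -derive1E JE.
Qed.

Lemma integral_primitive f J (a b : R) : continuous f -> -1 < a -> a < b ->
  (forall x : R, -1 < x -> is_derive x (1 : R) J (f x)) ->
  (\int[mu]_(t in `[a, b]) (f t)%:E = (J b - J a)%:E)%E.
Proof.
move=> cf a1 ab dJ.
have cJ x : -1 < x -> {for x, continuous J}.
  move=> x1; apply/differentiable_continuous/derivable1_diffP.
  by have ? := dJ x x1; exact: ex_derive.
rewrite (@continuous_FTC2 R f J a b ab) ?EFinB//.
- exact: continuous_subspaceT.
- split.
  + move=> x; rewrite in_itv /= => /andP[ax _].
    by have ? := dJ x (lt_trans a1 ax); exact: ex_derive.
  + by apply: cvg_at_right_filter; exact: cJ.
  + by apply: cvg_at_left_filter; apply: cJ; lra.
- move=> x; rewrite in_itv /= => /andP[ax _].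
  by have ? := dJ x (lt_trans a1 ax); rewrite derive1E derive_val.
Qed.

Lemma increment_ge J f (k a b : R) : a <= b ->
  {within `[a, b], continuous J} ->
  (forall t : R, a < t < b -> is_derive t (1 : R) J (f t)) ->
  (forall t, a < t < b -> k <= f t) -> k * (b - a) <= J b - J a.
Proof.
rewrite le_eqVlt => /predU1P[->|ab]; first by rewrite !subrr mulr0.
move=> cJ dJ fk.
have dJ' t : t \in `]a, b[ -> is_derive t (1 : R) J (f t) by rewrite in_itv; exact: dJ.
have [c cab ->] := MVT ab dJ' cJ.
by rewrite ler_wpM2r ?subr_ge0 ?(ltW ab)// fk//; move: cab; rewrite in_itv.
Qed.

Lemma increment_le J f (k a b : R) : a <= b ->
  {within `[a, b], continuous J} ->
  (forall t : R, a < t < b -> is_derive t (1 : R) J (f t)) ->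
  (forall t, a < t < b -> f t <= k) -> J b - J a <= k * (b - a).
Proof.
rewrite le_eqVlt => /predU1P[->|ab]; first by rewrite !subrr mulr0.
move=> cJ dJ fk.
have dJ' t : t \in `]a, b[ -> is_derive t (1 : R) J (f t) by rewrite in_itv; exact: dJ.
have [c cab ->] := MVT ab dJ' cJ.
by rewrite ler_wpM2r ?subr_ge0 ?(ltW ab)// fk//; move: cab; rewrite in_itv.
Qed.

(** Constant extension to the left of [s] trades continuity on the half line for continuity
    everywhere; for [s > 0] it also keeps [phi] away from [0], so that [1 / phi] is continuous. *)
Lemma within_0oo_continuous_max (s : R) g : 0 <= s -> {within `[0, +oo[, continuous g} ->
  continuous (fun t : R => g (Num.max s t)).
Proof.
move=> s0 /subspace_continuousP cg x.
have mx : `[0, +oo[%classic (Num.max s x) by rewrite /= in_itv /= andbT le_max s0.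
apply/cvgrPdist_lt => e e0.
have /cvgrPdist_lt/(_ e e0) := cg _ mx.
rewrite near_withinE => /nbhs_ballP[d /= d0 H].
apply/nbhs_ballP; exists d => // y /= xy; apply: H; last first.
  by rewrite /= in_itv /= andbT le_max s0.
move: xy; rewrite /ball /= => xy; apply: le_lt_trans xy.
have [xs|sx] := leP x s; have [ys|sy] := leP y s; rewrite ?subrr ?normr0//.
- by rewrite !ler0_norm; lra.
- by rewrite !ger0_norm; lra.
Qed.

End Primitives.

(** * Monotonicity and positivity of the solutions of [g' = - phi g] *)

Section DecaySolutions.
Context {R : realType} {phi : R -> R} (phiP : admissible_phi phi).
Local Notation mu := (@lebesgue_measure R).
Implicit Types g : R -> R.

Lemma phi_ge t : 0 <= t -> t <= phi t. Proof. by case: phiP => _ _ + _; apply. Qed.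

Lemma phi_ge0 t : 0 <= t -> 0 <= phi t.
Proof. by move=> t0; apply: le_trans (phi_ge t0). Qed.

Lemma phi_mono s t : 0 <= s -> s <= t -> phi s <= phi t.
Proof.
move=> s0; rewrite le_eqVlt => /predU1P[->//|st]; apply/ltW.
by case: phiP => + _ _ _; apply; rewrite ?in_itv /= ?andbT//; lra.
Qed.

Lemma decay_nonincreasing nu g : decay_solution phi nu g ->
  forall s t, 0 <= s -> s <= t -> g t <= g s.
Proof.
move=> [_ cg g0 dg] s t s0 st; rewrite -subr_le0 -(mul0r (t - s)).
apply: (@increment_le _ _ (fun u => - phi (g u))) => //.
- by apply: continuous_subspaceW cg => u /=; rewrite !in_itv /=; lra.
- by move=> u su; apply: dg; lra.
- by move=> u su; rewrite oppr_le0 phi_ge0// g0//; lra.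
Qed.

Lemma decay_continuous nu g : decay_solution phi nu g ->
  continuous (fun t : R => g (Num.max 0 t)).
Proof. by case=> _ cg _ _; exact: within_0oo_continuous_max. Qed.

Lemma decay_primitive nu g : decay_solution phi nu g ->
  exists J : R -> R, [/\ J 0 = 0, forall t : R, 0 <= t -> is_derive t (1 : R) J (g t) &
    forall eps : R, 0 < eps -> (\int[mu]_(t in `[0%R, eps]) (g t)%:E = (J eps)%:E)%E].
Proof.
move=> gP; have ch := decay_continuous gP.
have [J dJ] := continuous_has_primitive ch.
exists (fun t => J t - J 0); split; first by rewrite subrr.
- move=> t t0; have ? := dJ t (lt_le_trans (ltrN10 _) t0).
  by apply: is_derive_eq; rewrite subr0 max_r.
- move=> eps eps0; rewrite -(integral_primitive ch (ltrN10 _) eps0 dJ).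
  by apply: eq_integral => t; rewrite inE /= in_itv /= => /andP[t0 _]; rewrite max_r.
Qed.

(** Monotone convergence along the intervals from [1 / (i + 2)] to [1], whose union is the half-open
    unit interval; the shift by [2] makes each left end smaller than [1]. *)
Lemma inv_phi_integral_unbounded (C : R) :
  exists2 s : R, 0 < s < 1 & (C%:E < \int[mu]_(t in `[s, 1%R]) ((phi t)^-1)%:E)%E.
Proof.
pose F (i : nat) : set R := `[i.+2%:R^-1, 1]%classic.
have mphi : measurable_fun (`]0, 1]%classic : set R) (fun t => (phi t)^-1).
  apply: subspace_continuous_measurable_fun => //.
  apply/subspace_continuousP => x /=; rewrite in_itv /= => /andP[x0 x1].
  have px : phi x != 0 by rewrite gt_eqF// (lt_le_trans x0)// phi_ge// ltW.
  apply: cvgV => //.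
  case: phiP => _ /subspace_continuousP/(_ x) cp _ _.
  have /cp : `[0, +oo[%classic x by rewrite /= in_itv /= andbT ltW.
  apply: cvg_trans; apply: cvg_app; apply: within_subset.
  by move=> y /=; rewrite !in_itv /= andbT => /andP[/ltW].
have bigF : \bigcup_i F i = `]0, 1]%classic.
  apply/seteqP; split=> x.
    move=> [i _]; rewrite /F /= !in_itv /= => /andP[ix ->]; rewrite andbT.
    by apply: lt_le_trans ix; rewrite invr_gt0.
  rewrite /= in_itv /= => /andP[x0 x1].
  have xV : 0 <= x^-1 by rewrite invr_ge0 ltW.
  exists (Num.bound x^-1) => //; rewrite /F /= in_itv /= x1 andbT.
  rewrite -[leRHS]invrK lef_pV2 ?posrE ?invr_gt0//.
  apply: le_trans (ltW (archi_boundP xV)) _.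
  by rewrite ler_nat -addn2 leq_addr.
have nF : nondecreasing_seq F.
  move=> i j ij; rewrite subsetEset => x; rewrite /F /= !in_itv /= => /andP[ix ->].
  rewrite andbT; apply: le_trans ix.
  by rewrite lef_pV2 ?posrE// ler_nat !ltnS.
have : (\int[mu]_(x in F i) ((phi x)^-1)%:E)%E @[i --> \oo] --> +oo%E.
  case: phiP => _ _ _ <-; rewrite -bigF.
  apply: ge0_nondecreasing_set_cvg_integral => //.
  - by move=> i; exact: measurable_itv.
  - move=> i; apply/measurable_EFinP; apply: measurable_funS mphi => //.
    by rewrite -bigF; exact: bigcup_sup.
  - move=> i x; rewrite /F /= in_itv /= => /andP[ix _].
    rewrite lee_fin invr_ge0; apply: phi_ge0.
    by apply: le_trans ix; rewrite invr_ge0.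
move=> /cvgeyPgt/(_ C)[i _ /(_ i (leqnn i)) /= H].
exists i.+2%:R^-1; last exact: H.
by rewrite invr_gt0 ltr0n /= invf_lt1// ltr1n.
Qed.

(* Osgood: along a trajectory [int ds / phi s] is the elapsed time, so descending
   to [0] in finite time would make that integral converge at [0]. *)
Lemma decay_gt0 nu g : 0 < nu -> decay_solution phi nu g -> forall t, 0 <= t -> 0 < g t.
Proof.
move=> nu0 gP t1 t10; have gmono := decay_nonincreasing gP.
case: (gP) => g0 cg gge dg.
rewrite lt_neqAle gge// andbT eq_sym; apply/eqP => gt1.
(* The integral from [s] to [1] is at most the time [t <= t1] spent between [nu] and [s'], plus the
   part from [nu] to [1], where the integrand is at most [nu^-1]. *)
have [s /andP[s0 s1] sC] := inv_phi_integral_unbounded (t1 + nu^-1).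
pose s' := Num.min s nu.
have s'0 : 0 < s' by rewrite lt_min s0.
have [t tt1 gts] : exists2 t, t \in `[0, t1] & g t = s'.
  apply: IVT => //.
  - by apply: continuous_subspaceW cg => u /=; rewrite !in_itv /= andbT => /andP[].
  - by rewrite gt1 g0 min_r ?max_l ?(ltW nu0)// (ltW s'0) /s' ge_min lexx orbT.
move: tt1; rewrite in_itv /= => /andP[t0 tt1].
pose psi x := (phi (Num.max s' x))^-1.
have phi0 x : 0 < phi (Num.max s' x).
  have m0 : 0 < Num.max s' x by rewrite lt_max s'0.
  by rewrite (lt_le_trans m0)// phi_ge// ltW.
have cpsi : continuous psi.
  have cphi : continuous (fun x : R => phi (Num.max s' x)).
    by apply: within_0oo_continuous_max; [exact: ltW|case: phiP].
  by move=> x; apply: cvgV; [rewrite gt_eqF|exact: cphi].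
have [H dH] := continuous_has_primitive cpsi.
have cH x : -1 < x -> {for x, continuous H}.
  move=> x1; apply/differentiable_continuous/derivable1_diffP.
  by have ? := dH x x1; exact: ex_derive.
have cHg : {within `[0, t], continuous (fun u => H (g u))}.
  apply/subspace_continuousP => u ut.
  have cg' : {within `[0, t], continuous g}.
    by apply: continuous_subspaceW cg => x /=; rewrite !in_itv /= andbT => /andP[].
  move: (ut); rewrite /= in_itv /= => /andP[u0 ut'].
  have gu : s' <= g u by rewrite -gts; exact: gmono.
  have gu1 : -1 < g u by lra.
  move/subspace_continuousP: cg' => /(_ u ut) c1.
  exact: (@cvg_comp _ _ _ g H _ _ _ c1 (cH (g u) gu1)).
have E1 : H nu - H s' <= t.
  have : (- 1) * (t - 0) <= H (g t) - H (g 0).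
    apply: (@increment_ge _ (fun u => H (g u)) (fun=> -1)) => //.
    move=> u /andP[u0 ut].
    have gu : s' <= g u by rewrite -gts; apply: gmono; exact: ltW.
    have ? := dg u u0.
    have ? := dH (g u) (lt_le_trans (lt_trans (ltrN10 _) s'0) gu).
    apply: is_derive_eq.
    rewrite /psi max_r// /GRing.scale /= mulrN mulVf// gt_eqF//.
    by have := phi0 (g u); rewrite max_r.
  by rewrite gts g0; lra.
have cH01 a b : -1 < a -> {within `[a, b], continuous H}.
  move=> a1; apply: continuous_in_subspaceT => x; rewrite inE /= in_itv /= => /andP[ax _].
  by apply: cH; lra.
have E2 : H 1 - H nu <= nu^-1.
  have [nu1|nu1] := leP nu 1.
    have : H 1 - H nu <= nu^-1 * (1 - nu).
      apply: (@increment_le _ H psi) => //.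
      - by apply: cH01; lra.
      - by move=> x /andP[x0 _]; apply: dH; lra.
      - move=> x /andP[x0 _]; rewrite /psi lef_pV2 ?posrE//.
        have nm : nu <= Num.max s' x by rewrite le_max (ltW x0) orbT.
        by apply: le_trans nm (phi_ge _); rewrite le_max ltW.
    by rewrite mulrBr mulr1 mulVf ?gt_eqF//; lra.
  have : 0 * (nu - 1) <= H nu - H 1.
    apply: (@increment_ge _ H psi) => //; first exact: ltW.
    - by apply: cH01; lra.
    - by move=> x /andP[x0 _]; apply: dH; lra.
    - by move=> x _; rewrite invr_ge0 ltW.
  have : 0 < nu^-1 by rewrite invr_gt0.
  by lra.
have E3 : H s' <= H s.
  have s's : s' <= s by rewrite /s' ge_min lexx.
  rewrite -subr_ge0 -(mul0r (s - s')); apply: (@increment_ge _ H psi) => //.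
  - by apply: cH01; lra.
  - by move=> x /andP[x0 _]; apply: dH; lra.
  - by move=> x _; rewrite invr_ge0 ltW.
have E4 : (\int[mu]_(x in `[s, 1%R]) ((phi x)^-1)%:E = (H 1 - H s)%:E)%E.
  rewrite -(integral_primitive cpsi _ s1 dH); last by lra.
  apply: eq_integral => x; rewrite inE /= in_itv /= => /andP[sx _].
  by rewrite /psi max_r//; apply: le_trans sx; rewrite /s' ge_min lexx.
by move: sC; rewrite E4 lte_fin; lra.
Qed.

End DecaySolutions.

(** * Radial barrier from below on an annulus *)

Section Barriers.
Context {R : realType} {n : nat} {phi : R -> R} (phiP : admissible_phi phi).
Local Notation mu := (@lebesgue_measure R).
Implicit Types (x y z c : 'rV[R]_n) (v : 'rV[R]_n -> R).

Lemma primitive_continuous_max (J g : R -> R) :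
  (forall t : R, 0 <= t -> is_derive t (1 : R) J (g t)) ->
  continuous (fun t : R => J (Num.max 0 t)).
Proof.
move=> dJ; apply: within_0oo_continuous_max => //.
apply: continuous_in_subspaceT => t; rewrite inE /= in_itv /= andbT => t0.
apply/differentiable_continuous/derivable1_diffP.
by have ? := dJ t t0; exact: ex_derive.
Qed.

Lemma decay_increment nu (g J : R -> R) (s t : R) : decay_solution phi nu g ->
  (forall t : R, 0 <= t -> is_derive t (1 : R) J (g t)) -> 0 <= s -> s <= t ->
  g t * (t - s) <= J t - J s <= g s * (t - s).
Proof.
move=> gP dJ s0 st; have gm := decay_nonincreasing phiP gP.
have cJ : {within `[s, t], continuous J}.
  apply: continuous_in_subspaceT => u; rewrite inE /= in_itv /= => /andP[su _].
  apply/differentiable_continuous/derivable1_diffP.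
  by have ? := dJ u (le_trans s0 su); exact: ex_derive.
apply/andP; split.
  apply: (@increment_ge _ J g) => // u /andP[su ut]; first by apply: dJ; lra.
  by apply: gm; lra.
apply: (@increment_le _ J g) => // u /andP[su ut]; first by apply: dJ; lra.
by apply: gm; lra.
Qed.

(** The barrier [G] is convex, decreasing and zero at [rho2], with [- G' = g / B] and [G'']
    proportional to [phi g]. Positivity of [g] bounds its slope below. [kap] depends on [sig] but
    not on [rho1] and [rho2], so [rho2] may later approach [1]. *)
Lemma lower_barrier (f : R -> R -> R) (C0 B nu0 sig : R) :
  (forall nu, 0 < nu -> decay_solution phi nu (f nu)) ->
  1 <= C0 -> 1 <= B -> 0 < nu0 -> 0 < sig ->
  exists2 kap : R, 0 < kap & forall v c rho1 rho2,
    sig <= rho1 -> rho1 < rho2 -> rho2 <= 1 ->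
    {within [set z | eucl_norm (z - c) <= rho2], continuous v} ->
    (forall z, eucl_norm (z - c) <= rho2 -> 0 <= v z) ->
    (forall z, eucl_norm (z - c) <= rho1 -> nu0 <= v z) ->
    quad_super C0 [set z | eucl_norm (z - c) < rho2]
      (fun t q s => B * t <= 1 -> s <= B * phi q + B * phi (B * t)) v ->
    forall z, eucl_norm (z - c) <= rho2 -> kap * (rho2 - eucl_norm (z - c)) <= v z.
Proof.
move=> fP C1 B1 nu00 sig0.
(* Capping by [1] ensures [B * v zs <= 1] at the touching point, where the conditional test
   inequality is invoked. *)
pose nu := Num.min 1 nu0.
have nup : 0 < nu by rewrite lt_min ltr01.
have nu1 : nu <= 1 by rewrite /nu ge_min lexx.
have nunu0 : nu <= nu0 by rewrite /nu ge_min lexx orbT.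
have gP := fP nu nup; set g := f nu in gP.
have [J [J0 dJ _]] := decay_primitive gP.
have gm := decay_nonincreasing phiP gP.
have gp := decay_gt0 phiP nup gP.
have g0 : g 0 = nu by case: gP.
have gnu t : 0 <= t -> g t <= nu by move=> t0; rewrite -g0; exact: gm.
have C0s : 0 < C0 / sig by rewrite divr_gt0//; lra.
(* Chosen so that [G'' = (C0 / sig + 2 B + 1) phi gr]: [C0 / sig] beats [- C0 G' / rho], [2 B] beats
   the two terms in [phi], and the final [1] leaves room for [b < g2] and for [eps]. *)
pose K := B * (C0 / sig + 2 * B + 1).
have K0 : 0 < K by rewrite mulr_gt0//; lra.
have B0 : 0 < B by lra.
exists (g K / B); first by rewrite divr_gt0// gp// ltW.
move=> v c rho1 rho2 sr r12 r21 cv v0 vnu vS.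
pose KB := K * B.
have KB0 : 0 < KB by rewrite mulr_gt0.
pose G t := (J (K * (rho2 - rho1)) - J (K * (t - rho1))) / KB.
pose F t := g (K * (t - rho1)) / B.
have Karg t : rho1 <= t -> 0 <= K * (t - rho1).
  by move=> t1; rewrite mulr_ge0 ?(ltW K0)// subr_ge0.
have Gb t : rho1 <= t -> t <= rho2 -> F rho2 * (rho2 - t) <= G t <= F t * (rho2 - t).
  move=> t1 t2.
  have := @decay_increment nu g J (K * (t - rho1)) (K * (rho2 - rho1)) gP dJ (Karg t t1).
  rewrite ler_pM2l// lerD2r => /(_ t2) /andP[H1 H2].
  rewrite /G ler_pdivlMr// ler_pdivrMr// /F /KB.
  apply/andP; split.
    by apply: le_trans H1; rewrite le_eqVlt; apply/orP; left; apply/eqP; field; rewrite gt_eqF.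
  by apply: le_trans H2 _; rewrite le_eqVlt; apply/orP; left; apply/eqP; field; rewrite gt_eqF.
have kapF : g K / B <= F rho2.
  rewrite ler_wpM2r ?invr_ge0 ?(ltW B0)//; apply: gm; first by apply: Karg; exact: ltW.
  rewrite -[leRHS]mulr1 ler_wpM2l ?(ltW K0)//; lra.
have Fnu t : rho1 <= t -> F t <= nu.
  move=> t1; rewrite /F ler_pdivrMr//; apply: le_trans (gnu _ (Karg t t1)) _.
  by rewrite ler_peMr// ltW.
have Fp t : rho1 <= t -> 0 < F t by move=> t1; rewrite divr_gt0// gp// Karg.
pose A := [set z | eucl_norm (z - c) <= rho2] `&` [set z | - eucl_norm (z - c) <= - rho1].
(* [Num.max 0] extends [- G] continuously inside radius [rho1], where [J] has no prescribed
   behaviour. *)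
pose h z := - ((J (K * (rho2 - rho1)) - J (Num.max 0 (K * (eucl_norm (z - c) - rho1)))) / KB).
have ch : continuous h.
  have c0 k := @continuous_const R 'rV[R]_n k.
  apply: continuous_opp; apply: (fun H => continuous_mul H (c0 _)).
  apply: (continuous_sub (c0 _)).
  exact: (continuous_postcomp (primitive_continuous_max dJ)
    (continuous_mul (c0 _) (continuous_sub (@continuous_eucl_dist _ _ c) (c0 _)))).
have hE z : A z -> h z = - G (eucl_norm (z - c)).
  by move=> [_ /=]; rewrite lerN2 => z1; rewrite /h max_r// Karg.
suff HA z : A z -> G (eucl_norm (z - c)) <= v z.
  move=> z z2; have [z1|z1] := leP rho1 (eucl_norm (z - c)).
    have Az : A z by split => //=; rewrite lerN2.
    apply: le_trans (HA z Az); have /andP[H _] := Gb _ z1 z2; apply: le_trans H.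
    by rewrite ler_wpM2r// subr_ge0.
  apply: le_trans (vnu z (ltW z1)).
  have kn : g K / B <= nu by apply: le_trans kapF (Fnu _ (ltW r12)).
  have k0 : 0 <= g K / B by rewrite divr_ge0 ?(ltW B0)// ltW// gp// ltW.
  apply: le_trans (_ : g K / B * 1 <= _); last by lra.
  by rewrite ler_wpM2l//; have := eucl_norm_ge0 (z - c); lra.
move=> Az; apply: contrapT => /negP; rewrite -ltNge => vG.
have clA : closed A.
  apply: closedI; first exact: closed_eucl_ball_closed.
  by apply: closed_sublevel; apply: continuous_opp; exact: continuous_eucl_dist.
have [zs Azs zmin] : exists2 z, A z & forall t, A t -> v z + h z <= v t + h t.
  apply: (@min_attained _ _ A _ v h c rho2 cv) => //.
  - by move=> y [].
  - by move=> y [].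
  - by exists z.
have := zmin z Az; rewrite !hE// => zz.
case: (Azs) => /= zs2; rewrite lerN2 => zs1.
set rho := eucl_norm (zs - c) in zz zs1 zs2.
have vGs : v zs < G rho by lra.
have rho1' : rho1 < rho.
  rewrite lt_neqAle zs1 andbT; apply/eqP => E.
  have : nu0 <= v zs by apply: vnu; rewrite -/rho E.
  have /andP[_ H] := Gb rho zs1 zs2.
  have : F rho * (rho2 - rho) <= nu * 1.
    by apply: ler_pM; [exact: ltW (Fp _ zs1)|rewrite subr_ge0|exact: Fnu|lra].
  by lra.
have rho2' : rho < rho2.
  rewrite lt_neqAle zs2 andbT; apply/eqP => E.
  have := v0 zs zs2; move: vGs; rewrite /G E subrr mul0r; lra.
have Karg0 : 0 < K * (rho - rho1) by rewrite mulr_gt0// subr_gt0.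
pose G1 t := - F t.
pose g2 := K / B * phi (g (K * (rho - rho1))).
set gr := g (K * (rho - rho1)) in g2.
have gr0 : 0 < gr by apply: gp; exact: ltW.
have phg : gr <= phi gr by apply: (phi_ge phiP); exact: ltW.
pose d := Num.min (rho2 - rho) (rho - rho1).
have d0 : 0 < d by rewrite lt_min !subr_gt0 rho2' rho1'.
have zsc : zs != c.
  by apply/eqP => E; move: rho1' sr; rewrite /rho E subrr eucl_norm0; lra.
have dG (t : R) : `|t - rho| < d -> is_derive t (1 : R) G (G1 t).
  rewrite lt_min => /andP[_]; rewrite ltr_norml => /andP[tl _].
  have t1 : rho1 <= t by clear -tl; lra.
  have ? := dJ _ (Karg t t1).
  apply: is_derive_eq; rewrite /GRing.scale /= /G1 /F /KB.
  by field; rewrite !gt_eqF.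
have dG1 : is_derive rho (1 : R) G1 g2.
  have dg : is_derive (K * (rho - rho1)) (1 : R) g (- phi gr).
    by case: gP => _ _ _; apply.
  apply: is_derive_eq; rewrite /GRing.scale /= /g2.
  by field; rewrite !gt_eqF.
pose b := (C0 / sig + 2 * B + 1 / 2) * phi gr.
have g2E : g2 = (C0 / sig + 2 * B + 1) * phi gr by rewrite /g2 /K; field; rewrite !gt_eqF.
have phi0 : 0 < phi gr := lt_le_trans gr0 phg.
have C00 : 0 <= C0 := le_trans ler01 C1.
have b0 : 0 <= b by rewrite mulr_ge0 ?(ltW phi0)//; clear -C0s B0; lra.
have bg2 : b < g2 by rewrite g2E /b ltr_pM2r//; clear; lra.
have C40 : 0 < 4 * C0 by rewrite mulr_gt0// (lt_le_trans ltr01 C1).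
have eps0 : 0 < phi gr / (4 * C0) by rewrite divr_gt0.
have F0 := Fp _ zs1.
have grE : B * F rho = gr by rewrite /F mulrC divfK// gt_eqF.
have FB : F rho <= gr by rewrite -grE ler_peMl// ltW.
have vF : v zs <= F rho.
  apply: le_trans (ltW vGs) _; have /andP[_ H] := Gb _ zs1 zs2; apply: le_trans H _.
  by rewrite ler_piMr ?(ltW F0)//; clear -rho1' sr sig0 r21; lra.
have Bv : B * v zs <= gr by rewrite -grE ler_wpM2l// ltW.
have Bv0 : 0 <= B * v zs by rewrite mulr_ge0 ?(ltW B0)// v0.
have G10 (t : R) : `|t - rho| < d -> G1 t <= 0.
  rewrite lt_min => /andP[_]; rewrite ltr_norml => /andP[tl _].
  by rewrite oppr_le0 ltW// Fp//; clear -tl; lra.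
have zsmin z' : eucl_norm (z' - zs) < d ->
    v zs - G rho + 0 / 2 * dot (zs - 0) (zs - 0) <=
    v z' - G (eucl_norm (z' - c)) + 0 / 2 * dot (z' - 0) (z' - 0).
  rewrite lt_min => /andP[zd1 zd2].
  have Az' : A z'.
    have := eucl_distD zs z' c; have := eucl_distD z' zs c.
    rewrite (eucl_distC zs z') -/rho => T1 T2; split => /=; first by clear -T1 T2 zd1; lra.
    by rewrite lerN2; clear -T1 T2 zd2; lra.
  by have := zmin z' Az'; rewrite !hE// -/rho; clear; lra.
have := @quad_super_radial _ _ C0 _ _ v G G1 c 0 zs 0 g2 b d _
  vS (lexx 0) rho2' zsc d0 b0 bg2 eps0 dG G10 dG1 zsmin.
rewrite /= -/rho scale0r subr0 add0r => /(_ (le_trans Bv (le_trans (gnu _ (ltW Karg0)) nu1))).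
have -> : eucl_norm ((G1 rho / rho) *: (zs - c)) = F rho.
  have r0 : 0 < rho by clear -rho1' sr sig0; lra.
  rewrite eucl_normZ -/rho normrM normfV (gtr0_norm r0) divfK ?gt_eqF//.
  by rewrite /G1 normrN gtr0_norm.
have phiF : phi (F rho) <= phi gr by apply: (phi_mono phiP) => //; exact: ltW.
have phiv : phi (B * v zs) <= phi gr by apply: (phi_mono phiP).
have Fr : F rho / rho <= phi gr / sig.
  have sr' : sig <= rho by clear -rho1' sr; lra.
  rewrite ler_pdivrMr ?(lt_le_trans sig0)//.
  apply: le_trans (le_trans FB phg) _.
  by rewrite mulrAC ler_pdivlMr// ler_wpM2l ?(ltW phi0).
have H1 := ler_wpM2l C00 Fr.
have H2 := ler_wpM2l (ltW B0) phiF.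
have H3 := ler_wpM2l (ltW B0) phiv.
have H4 : C0 * (phi gr / (4 * C0)) = phi gr / 4 by field; rewrite gt_eqF// (lt_le_trans ltr01 C1).
rewrite /G1 mulNr opprK mulrDr H4 /b.
have -> : (C0 / sig + 2 * B + 1 / 2) * phi gr =
  C0 * (phi gr / sig) + 2 * (B * phi gr) + phi gr / 2 by field; rewrite gt_eqF.
by clear -H1 H2 H3 phi0; lra.
Qed.

End Barriers.

(** * Radial barrier from above outside a unit ball *)

Section UpperBarrier.
Context {R : realType} {n : nat} {phi : R -> R} (phiP : admissible_phi phi).
Local Notation mu := (@lebesgue_measure R).
Implicit Types (x y z c : 'rV[R]_n) (v : 'rV[R]_n -> R).

(** The blow-up is known for small [eps] only; since [g >= 0], [J] is nondecreasing and the bound at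
    some [eps <= K] passes to [K]. *)
Lemma large_decay_solution (K X : R) : decay_integral_blowup phi -> 0 < K ->
  exists nu (g J : R -> R), [/\ 0 < nu, decay_solution phi nu g,
    forall t : R, 0 <= t -> is_derive t (1 : R) J (g t), J 0 = 0 & X <= J K].
Proof.
move=> [f fP blow] K0.
move: blow; rewrite !near_withinE => /nbhs_ballP[d /= d0 H].
pose eps := Num.min (d / 2) K.
have eps0 : 0 < eps by rewrite lt_min K0 divr_gt0.
have epsK : eps <= K by rewrite /eps ge_min lexx orbT.
have epsd : ball 0 d eps.
  rewrite /ball /= sub0r normrN gtr0_norm//; apply: le_lt_trans (_ : d / 2 < d); last by lra.
  by rewrite /eps ge_min lexx.
have /cvgeyPgt/(_ X) := H eps epsd eps0.
move=> [N [Nr HN]].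
pose nu := Num.max 1 (N + 1).
have nu0 : 0 < nu by rewrite lt_max ltr01.
have Nnu : N < nu by rewrite lt_max ltrDl ltr01 orbT.
have gP := fP nu nu0.
have [J [J0 dJ Jint]] := decay_primitive gP.
exists nu, (f nu), J; split => //.
have := HN nu Nnu; rewrite /= Jint// lte_fin => XJ.
apply: le_trans (ltW XJ) _.
have /andP[H1 _] := decay_increment phiP gP dJ (ltW eps0) epsK.
have : 0 <= f nu K * (K - eps).
  rewrite mulr_ge0 ?subr_ge0//; case: gP => _ _ g0 _; apply: g0; exact: ltW.
by lra.
Qed.

(** The barrier [J (K (t - 1)) / K] vanishes at [t = 1], is at least [M] at [t = 2], and is concave
    with initial slope [nu], which gives the linear bound. It is minus the [G] of the proof, because
    the test inequality is available for [- v]. *)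
Lemma upper_barrier (C0 B M : R) : decay_integral_blowup phi ->
  1 <= C0 -> 1 <= B ->
  exists2 nu : R, 0 < nu & forall v c (D U : set 'rV[R]_n),
    let A := D `&` [set z | eucl_norm (z - c) <= 2] in
    closed A -> {within A, continuous v} -> (forall z, A z -> v z <= M) ->
    (forall z, A z -> 1 <= eucl_norm (z - c)) ->
    (forall z, U z -> 1 < eucl_norm (z - c)) ->
    (forall z, A z -> U z \/ v z = 0) ->
    open U -> U `<=` D ->
    quad_super C0 (U `&` [set z | eucl_norm (z - c) < 2])
      (fun _ q s => s <= B * phi q) (fun z => - v z) ->
    forall z, A z -> v z <= nu * (eucl_norm (z - c) - 1).
Proof.
move=> blow C1 B1.
(* As [rho > 1], [C0] covers [- C0 G' / rho]; [B] covers the gradient term, and [1] leaves slack. *)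
pose K := C0 + B + 1.
have K0 : 0 < K by rewrite /K; lra.
have [nu [g [J [nu0 gP dJ J0 JK]]]] := large_decay_solution (K * M) blow K0.
exists nu => // v c D U A clA cv vM A1 U1 AU opU UD vS.
have gm := decay_nonincreasing phiP gP.
have gp := decay_gt0 phiP nu0 gP.
have g0 : g 0 = nu by case: gP.
pose G t := - (J (K * (t - 1)) / K).
pose F t := g (K * (t - 1)).
have Karg t : 1 <= t -> 0 <= K * (t - 1).
  by move=> t1; rewrite mulr_ge0 ?(ltW K0)// subr_ge0.
have Jb t : 1 <= t -> 0 <= J (K * (t - 1)) / K <= nu * (t - 1).
  move=> t1; have := decay_increment phiP gP dJ (lexx 0) (Karg t t1).
  rewrite J0 !subr0 g0 => /andP[H1 H2].
  have gt0 := ltW (gp _ (Karg t t1)).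
  rewrite divr_ge0 ?(ltW K0)//=; last by apply: le_trans H1; rewrite mulr_ge0// Karg.
  by rewrite ler_pdivrMr//; lra.
have Fp t : 1 <= t -> 0 < F t by move=> t1; rewrite gp// Karg.
pose h z := J (Num.max 0 (K * (eucl_norm (z - c) - 1))) / K.
have c0 k := @continuous_const R 'rV[R]_n k.
have ch : continuous h.
  apply: (fun H => continuous_mul H (c0 _)).
  exact: (continuous_postcomp (primitive_continuous_max dJ)
    (continuous_mul (c0 _) (continuous_sub (@continuous_eucl_dist _ _ c) (c0 _)))).
have hE z : A z -> h z = - G (eucl_norm (z - c)).
  by move=> /A1 z1; rewrite /h /G opprK max_r// Karg.
suff HA z : A z -> v z <= - G (eucl_norm (z - c)).
  move=> z Az; apply: le_trans (HA z Az) _; rewrite opprK.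
  by have /andP[] := Jb _ (A1 z Az).
move=> Az; apply: contrapT => /negP; rewrite -ltNge => vG.
have cNv : {within A, continuous (fun z => - v z)} by move=> y; exact: cvgN (cv y).
have [zs Azs zmin] : exists2 z, A z & forall t, A t -> - v z + h z <= - v t + h t.
  apply: (@min_attained _ _ A _ (fun z => - v z) h c 2 cNv) => //.
  - by move=> y [].
  - by exists z.
have := zmin z Az; rewrite !hE// => zz.
case: (Azs) => Dzs /= zs2; have zs1 := A1 _ Azs.
set rho := eucl_norm (zs - c) in zz zs1 zs2.
have vGs : - G rho < v zs by lra.
have Uzs : U zs.
  case: (AU zs Azs) => // v0; move: vGs; rewrite v0 /G opprK.
  by have /andP[] := Jb rho zs1; lra.
have rho1 : 1 < rho := U1 zs Uzs.
have rho2 : rho < 2.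
  rewrite lt_neqAle zs2 andbT; apply/eqP => E.
  have := vM zs Azs; move: vGs; rewrite /G opprK E.
  have -> : K * (2 - 1) = K by ring.
  have : M <= J K / K by rewrite ler_pdivlMr// mulrC.
  by lra.
have Karg0 : 0 < K * (rho - 1) by rewrite mulr_gt0// subr_gt0.
pose G1 t := - F t.
set gr := F rho.
have gr0 : 0 < gr by apply: Fp.
pose g2 := K * phi gr.
have phg : gr <= phi gr by apply: (phi_ge phiP); exact: ltW.
have [dU dU0 HU] : exists2 d, 0 < d & forall y, eucl_norm (y - zs) < d -> U y.
  by apply/near_eucl; move: opU; rewrite openE => /(_ zs Uzs).
pose d := Num.min dU (Num.min (rho - 1) (2 - rho)).
have d0 : 0 < d by rewrite !lt_min dU0 !subr_gt0 rho1.
have zsc : zs != c.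
  by apply/eqP => E; move: rho1; rewrite /rho E subrr eucl_norm0; lra.
have dG (t : R) : `|t - rho| < d -> is_derive t (1 : R) G (G1 t).
  rewrite !lt_min => /andP[_ /andP[+ _]]; rewrite ltr_norml => /andP[tl _].
  have t1 : 1 <= t by lra.
  have ? := dJ _ (Karg t t1).
  apply: is_derive_eq; rewrite /GRing.scale /= /G1 /F.
  by field; rewrite !gt_eqF.
have dG1 : is_derive rho (1 : R) G1 g2.
  have dg : is_derive (K * (rho - 1)) (1 : R) g (- phi gr).
    by case: gP => _ _ _; apply.
  by apply: is_derive_eq; rewrite /GRing.scale /= /g2; lra.
have G10 (t : R) : `|t - rho| < d -> G1 t <= 0.
  rewrite !lt_min => /andP[_ /andP[+ _]]; rewrite ltr_norml => /andP[tl _].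
  by rewrite oppr_le0 ltW// Fp//; lra.
have phi0 : 0 < phi gr by lra.
pose b := (C0 + B + 1 / 2) * phi gr.
have b0 : 0 <= b by rewrite mulr_ge0 ?(ltW phi0)//; lra.
have bg2 : b < g2 by rewrite /g2 /K /b ltr_pM2r//; lra.
have eps0 : 0 < phi gr / (4 * C0) by rewrite divr_gt0//; lra.
have zsmin z' : eucl_norm (z' - zs) < d ->
    - v zs - G rho + 0 / 2 * dot (zs - 0) (zs - 0) <=
    - v z' - G (eucl_norm (z' - c)) + 0 / 2 * dot (z' - 0) (z' - 0).
  rewrite !lt_min => /andP[zd1 /andP[zd2 zd3]].
  have Az' : A z'.
    split; first exact/UD/HU.
    by have := eucl_distD zs z' c; rewrite -/rho /=; lra.
  by have := zmin z' Az'; rewrite !hE// -/rho; lra.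
have := @quad_super_radial _ _ C0 _ _ (fun z => - v z) G G1 c 0 zs 0 g2 b d _
  vS (lexx 0) (conj Uzs rho2) zsc d0 b0 bg2 eps0 dG G10 dG1 zsmin.
rewrite /= -/rho scale0r subr0 add0r.
have r0 : 0 < rho by lra.
have -> : eucl_norm ((G1 rho / rho) *: (zs - c)) = gr.
  rewrite eucl_normZ -/rho normrM normfV (gtr0_norm r0) divfK ?gt_eqF//.
  by rewrite /G1 normrN gtr0_norm.
have Fr : gr / rho <= phi gr.
  rewrite ler_pdivrMr//; apply: le_trans phg _.
  by rewrite ler_peMr ?(ltW phi0)// ltW.
have C00 : 0 <= C0 by lra.
have H1 := ler_wpM2l C00 Fr.
have H4 : C0 * (phi gr / (4 * C0)) = phi gr / 4 by field; rewrite gt_eqF//; lra.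
rewrite /G1 mulNr opprK mulrDr H4 /b -/gr.
by lra.
Qed.

End UpperBarrier.

(** * Positivity in a ball from positivity at its centre *)

Section InteriorLowerBound.
Context {R : realType} {n : nat}.
Implicit Types (x y z c : 'rV[R]_n) (v : 'rV[R]_n -> R) (U : set 'rV[R]_n).

Lemma quad_super_weaken C0 U U' (P P' : R -> R -> R -> Prop) v :
  quad_super C0 U P v -> U' `<=` U ->
  (forall x (q s : R), U' x -> 0 <= q -> P (v x) q s -> P' (v x) q s) ->
  quad_super C0 U' P' v.
Proof.
move=> vP UU PP x0 p e a b d Ux0 a0 b0 ee d0 H.
apply: PP => //; first exact: eucl_norm_ge0.
by apply: vP H => //; exact: UU.
Qed.

Lemma quad_super_shift C0 U (Q : R -> R -> Prop) v (k : R) :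
  quad_super C0 U (fun _ => Q) v -> quad_super C0 U (fun _ => Q) (fun z => k + v z).
Proof.
move=> vP x0 p e a b d Ux0 a0 b0 ee d0 H.
by apply: (vP x0 p e a b d) => // z zd; have := H z zd; lra.
Qed.

Lemma quad_super_rescale C0 U (P : R -> R -> R -> Prop) v c (r h : R) :
  0 < r -> 0 < h -> quad_super C0 U P v ->
  quad_super C0 [set y | U (c + r *: y)]
    (fun t q s => P (r * h * t) (h * q) (h / r * s))
    (fun y => v (c + r *: y) / (r * h)).
Proof.
move=> r0 h0 vP x0 p e a b d Ux0 a0 b0 ee d0 H.
have rh0 : 0 < r * h by rewrite mulr_gt0.
have hr0 : 0 < h / r by rewrite divr_gt0.
have -> : r * h * (v (c + r *: x0) / (r * h)) = v (c + r *: x0).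
  by field; rewrite !gt_eqF.
have -> : h * eucl_norm p = eucl_norm (h *: p) by rewrite eucl_normZ gtr0_norm.
have -> : h / r * (b - C0 * a) = h / r * b - C0 * (h / r * a) by ring.
apply: (vP _ _ e _ _ (r * d)) => //; try by rewrite mulr_ge0 ?(ltW hr0).
  by rewrite mulr_gt0.
move=> z; set x := c + r *: x0 => zd.
pose y := x0 + r^-1 *: (z - x).
have yE : c + r *: y = z.
  rewrite /y scalerDr scalerA divff ?gt_eqF// scale1r addrA -/x.
  by rewrite addrC subrK.
have zx : z - x = r *: (y - x0).
  by rewrite /y addrAC subrr add0r scalerA divff ?gt_eqF// scale1r.
have yd : eucl_norm (y - x0) < d.
  by move: zd; rewrite zx eucl_normZ gtr0_norm// ltr_pM2l.
have := H y yd; rewrite yE -/x => H1.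
rewrite zx !(dotZl, dotZr).
have := ler_wpM2l (ltW rh0) H1.
rewrite (mulrC (r * h) (v z / _)) divfK ?gt_eqF//; apply: le_trans.
rewrite le_eqVlt; apply/orP; left; apply/eqP.
by field; rewrite !gt_eqF.
Qed.

Lemma within_continuous_rescale (D A : set 'rV[R]_n) v c (r k : R) : 0 < r ->
  {within D, continuous v} -> (forall y, A y -> D (c + r *: y)) ->
  {within A, continuous (fun y => v (c + r *: y) / k)}.
Proof.
move=> r0 cv AD.
have cA : {within A, continuous (fun y => v (c + r *: y))}.
  apply/subspace_continuousP => y Ay; apply/cvgrPdist_lt => e e0.
  have [d d0 Hd] := within_continuous_eps cv (AD y Ay) e0.
  rewrite near_withinE; apply: (near_eucl _ _).2; exists (d / r); first exact: divr_gt0.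
  move=> z zy Az; rewrite distrC; apply: Hd; first exact: AD.
  have -> : c + r *: z - (c + r *: y) = r *: (z - y).
    by rewrite opprD addrACA subrr add0r -scalerBr.
  by rewrite eucl_normZ gtr0_norm// mulrC -ltr_pdivlMr.
by move=> y; exact: (cvgM (cA y) (cvg_cst _)).
Qed.

(* A point where [v] does not rise by more than [r h] within distance [l r]: each
   failure moves by [l r] and gains [r h], so [v <= M] stops the search within
   distance [l M / h]. *)
Lemma almost_max_point v (m M l r h : R) : 0 < l -> 0 < r -> 0 < h -> 0 < m ->
  8 * l * M <= h -> l * r <= 1 / 8 -> m <= v 0 ->
  (forall z, eucl_norm z < 1 -> v z <= M) ->
  exists x, [/\ eucl_norm x <= 1 / 8, m <= v x &
    forall z, eucl_norm (z - x) <= l * r -> v z <= v x + r * h].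
Proof.
move=> l0 r0 h0 m0 hM lr mv vM.
have rh0 : 0 < r * h by rewrite mulr_gt0.
apply: contrapT => /forallNP noex.
have key i : exists x, [/\ eucl_norm x <= i%:R * (l * r), eucl_norm x <= 1 / 8 &
    m + i%:R * (r * h) <= v x].
  elim: i => [|i [x [xi x8 xv]]].
    by exists 0; rewrite eucl_norm0 !mul0r addr0; split => //; lra.
  have i0 : 0 <= i%:R * (r * h) by rewrite mulr_ge0// ltW.
  have [z zx vz] : exists2 z, eucl_norm (z - x) <= l * r & v x + r * h < v z.
    apply: contrapT => /forall2NP nz; apply: (noex x); split => //; first by lra.
    by move=> z zx; have [//|/negP] := nz z; rewrite -leNgt.
  exists z; have zl : eucl_norm z <= (i.+1)%:R * (l * r).
    by have := eucl_normD (z - x) x; rewrite subrK -natr1 mulrDl mul1r; lra.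
  have zv : m + (i.+1)%:R * (r * h) <= v z by rewrite -natr1 mulrDl mul1r; lra.
  split => //; apply: le_trans zl _.
  have z1 : eucl_norm z < 1 by have := eucl_normD (z - x) x; rewrite subrK; lra.
  have iM : (i.+1)%:R * (r * h) <= M by have := vM z z1; lra.
  have l8 : 0 <= 8 * l by rewrite mulr_ge0// ltW.
  have := ler_wpM2l l8 iM => H.
  rewrite -(ler_pM2r h0); move: H.
  have -> : 8 * l * (i.+1%:R * (r * h)) = 8 * (i.+1%:R * (l * r) * h) by ring.
  by lra.
have M0 : 0 <= M / (r * h).
  by rewrite divr_ge0 ?(ltW rh0)//; have := vM 0; rewrite eucl_norm0 => /(_ ltr01); lra.
have [x [_ x8 xv]] := key (Num.bound (M / (r * h))).
have := archi_boundP M0; rewrite ltr_pdivrMr// => H.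
by have := vM x ltac:(lra); lra.
Qed.

Context {phi : R -> R} (phiP : admissible_phi phi).

(** Two barriers are needed: the almost maximal point [x] may lie off centre, so the barrier around
    it only reaches the ball of radius [1 / 2] about [0], from where a centred one reaches the unit
    sphere. *)
Lemma interior_lower_bound (f : R -> R -> R) (C0 B m M : R) :
  (forall nu, 0 < nu -> decay_solution phi nu (f nu)) ->
  1 <= C0 -> 1 <= B -> 0 < m ->
  exists2 kap : R, 0 < kap & forall v,
    {within [set z | eucl_norm z < 1], continuous v} ->
    (forall z, eucl_norm z < 1 -> 0 <= v z <= M) -> m <= v 0 ->
    quad_super C0 [set z | eucl_norm z < 1]
      (fun t q s => B * t <= 1 -> s <= B * phi q + B * phi (B * t)) v ->
    quad_super C0 [set z | eucl_norm z < 1]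
      (fun _ q s => s <= B * phi q) (fun z => - v z) ->
    forall z, eucl_norm z < 1 -> kap * (1 - eucl_norm z) <= v z.
Proof.
move=> fP C1 B1 m0.
have [mM|Mm] := leP m M; last first.
  exists 1 => // v _ v01 mv; have := v01 0; rewrite eucl_norm0 => /(_ ltr01).
  by lra.
have [V V1 two] := @two_sided_bound R n C0 C1.
set Rd := ks_radius C0 in two.
have RdN : 33 <= Rd.
  by have := ks_radius_ge (n := n) C1; have : 0 <= n%:R :> R by []; rewrite -/Rd; lra.
have M0 : 0 < M by lra.
have B0 : 0 < B by lra.
pose H := 8 * Rd * M; have H0 : 0 < H by rewrite !mulr_gt0//; lra.
have HV0 : 0 < H * V by rewrite mulr_gt0//; lra.
pose Phi := B * phi (H * V) + B * phi 1.
have Phi0 : 0 < Phi.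
  have p1 : 1 <= phi 1 := phi_ge phiP ler01.
  have p2 := phi_ge0 phiP (ltW HV0).
  have : 0 < B * phi 1 by rewrite mulr_gt0//; lra.
  by have := mulr_ge0 (ltW B0) p2; rewrite /Phi; lra.
(* In turn the bounds keep the ball of radius [Rd r] around [x] in the unit ball, make [m] at least
   [4 r H V], bring the right-hand side below [1] after the zoom, and grant [B t <= 1] for
   [t <= r H V]. [H] and [Phi] are free of [r], so there is no circularity. *)
pose r := Num.min (Num.min (1 / (8 * Rd)) (m / (4 * (H * V))))
                  (Num.min (H / Phi) (1 / (B * (H * V)))).
have r0 : 0 < r by rewrite !lt_min !divr_gt0// ?mulr_gt0//; lra.
have rRd : Rd * r <= 1 / 8.
  have : r <= 1 / (8 * Rd) by rewrite /r !ge_min lexx.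
  by rewrite ler_pdivlMr; lra.
have rm : 4 * (r * H * V) <= m.
  have : r <= m / (4 * (H * V)) by rewrite /r !ge_min lexx !orbT.
  by rewrite ler_pdivlMr ?mulr_gt0//; lra.
have rPhi : r * Phi <= H.
  have : r <= H / Phi by rewrite /r !ge_min lexx !orbT.
  by rewrite ler_pdivlMr.
have rB : B * (r * H * V) <= 1.
  have : r <= 1 / (B * (H * V)) by rewrite /r !ge_min lexx !orbT.
  by rewrite ler_pdivlMr ?mulr_gt0//; lra.
have rH0 : 0 < r * H by rewrite mulr_gt0.
have r40 : 0 < r / 4 by rewrite divr_gt0.
have [k1 k10 low1] := @lower_barrier R n phi phiP f C0 B (r * H) (r / 4) fP C1 B1 rH0 r40.
have k180 : 0 < k1 / 8 by rewrite divr_gt0.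
have [k2 k20 low2] := @lower_barrier R n phi phiP f C0 B (k1 / 8) (1 / 2) fP C1 B1 k180 ltac:(lra).
exists k2 => // v cv v01 mv vS vS'.
have RH : 8 * Rd * M <= H by [].
have vge0 z : eucl_norm z < 1 -> 0 <= v z by move=> /v01/andP[].
have vleM z : eucl_norm z < 1 -> v z <= M by move=> /v01/andP[].
have [x [x8 mx xmax]] := @almost_max_point v m M Rd r H ltac:(lra) r0 H0 m0 RH rRd mv vleM.
have ballx z : eucl_norm (z - x) <= Rd * r -> eucl_norm z < 1.
  by move=> zx; have := eucl_normD (z - x) x; rewrite subrK; clear -phiP zx rRd x8; lra.
have inball y : eucl_norm y <= Rd -> eucl_norm (x + r *: y) < 1.
  move=> yR; apply: ballx; rewrite addrAC subrr add0r eucl_normZ gtr0_norm//.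
  by rewrite mulrC ler_wpM2r// ltW.
(* By [xmax], [S - v'] is nonnegative on the ball of radius [Rd], and it equals [1] at [0]. *)
pose S := (v x + r * H) / (r * H).
pose v' y := v (x + r *: y) / (r * H).
have test t : v' t <= V -> 0 <= v' t -> (B * phi (H * V) + B * phi (B * (r * H * v' t))) <= Phi.
  move=> tV t0; rewrite /Phi lerD2l ler_wpM2l ?(ltW B0)//; apply: (phi_mono phiP).
    by rewrite mulr_ge0 ?(ltW B0)// mulr_ge0 ?(ltW rH0).
  by apply: le_trans rB; rewrite ler_wpM2l ?(ltW B0)// ler_wpM2l ?(ltW rH0).
have v'0 y : eucl_norm y <= Rd -> 0 <= v' y <= S.
  move=> yR; have /andP[vy0 _] := v01 _ (inball y yR).
  rewrite divr_ge0 ?(ltW rH0)//= ler_wpM2r ?invr_ge0 ?(ltW rH0)//.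
  apply: xmax; rewrite addrAC subrr add0r eucl_normZ gtr0_norm//.
  by rewrite mulrC ler_wpM2r// ltW.
have resc (s : R) : H / r * s <= Phi -> s <= 1.
  move=> sP; rewrite -(ler_pM2l (divr_gt0 H0 r0)) mulr1; apply: le_trans sP _.
  by rewrite ler_pdivlMr// mulrC.
have far z : eucl_norm (z - x) <= r / 4 -> r * H <= v z.
  move=> zx; rewrite leNgt; apply/negP => vz.
  pose y0 := r^-1 *: (z - x).
  have y0E : x + r *: y0 = z by rewrite scalerA divff ?gt_eqF// scale1r addrC subrK.
  have : S <= 2 * V.
    apply: (two v' S y0).
    - apply: within_continuous_rescale r0 cv _ => y /= yR; exact: inball.
    - exact: v'0.
    - apply: quad_super_weaken (quad_super_rescale (c := x) r0 H0 vS) _ _.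
        by move=> y /= yR; apply: inball; exact: ltW.
      move=> y q s /= yR q0; rewrite -/(v' y) => P tV qV; apply: resc.
      have v'y0 : 0 <= v' y by have /andP[] := v'0 y (ltW yR).
      have rHv : r * H * v' y <= r * H * V by rewrite ler_wpM2l ?(ltW rH0).
      have Brv : B * (r * H * v' y) <= 1.
        by apply: le_trans rB; rewrite ler_wpM2l ?(ltW B0).
      apply: le_trans (P Brv) _; apply: le_trans (test y tV v'y0).
      rewrite lerD2r ler_wpM2l ?(ltW B0)//; apply: (phi_mono phiP).
        by rewrite mulr_ge0// ltW.
      by rewrite ler_wpM2l// ltW.
    - have := quad_super_rescale (c := x) r0 H0 vS'.
      have -> : (fun z => S - v' z) = (fun z => S + (- v (x + r *: z)) / (r * H)).
        by apply/funext => y; rewrite mulNr.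
      move=> /(quad_super_shift (k := S)) vS''.
      apply: quad_super_weaken vS'' _ _.
        by move=> y /= yR; apply: inball; exact: ltW.
      move=> y q s /= yR q0 P tV qV; apply: resc.
      apply: le_trans P _; apply: (@le_trans _ _ (B * phi (H * V))).
        rewrite ler_wpM2l ?(ltW B0)//; apply: (phi_mono phiP).
          by rewrite mulr_ge0// ltW.
        by rewrite ler_wpM2l// ltW.
      by rewrite /Phi lerDl mulr_ge0 ?(ltW B0)// phi_ge0.
    - move=> i; apply: le_trans (coord_le_eucl y0 i) _.
      rewrite eucl_normZ normfV (gtr0_norm r0) mulrC ler_pdivrMr//; clear -phiP zx; lra.
    - by rewrite /v' y0E ler_pdivrMr// mul1r ltW.
    - rewrite /S /v' scaler0 addr0 -mulrBl addrAC subrr add0r divff ?gt_eqF//.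
  (* [S <= 2 V] reads [v x + r H <= 2 V r H], against [v x >= m >= 4 r H V]. *)
  by rewrite /S ler_pdivrMr// => SV; clear -phiP SV rm mx rH0 m0 V1; nra.
have cvb c rho : (forall z, eucl_norm (z - c) <= rho -> eucl_norm z < 1) ->
    {within [set z | eucl_norm (z - c) <= rho], continuous v}.
  by move=> H1; apply: continuous_subspaceW cv.
have vSb c rho : (forall z, eucl_norm (z - c) <= rho -> eucl_norm z < 1) ->
   quad_super C0 [set z | eucl_norm (z - c) < rho]
     (fun t q s => B * t <= 1 -> s <= B * phi q + B * phi (B * t)) v.
  by move=> H1; apply: quad_super_weaken vS _ _ => // z /= zc; apply: H1; exact: ltW.
have b1 z : eucl_norm (z - x) <= 3 / 4 -> eucl_norm z < 1.
  by move=> zx; have := eucl_normD (z - x) x; rewrite subrK; clear -phiP zx x8; lra.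
have half z : eucl_norm (z - 0) <= 1 / 2 -> k1 / 8 <= v z.
  rewrite subr0 => z2.
  have zx : eucl_norm (z - x) <= 5 / 8 by have := eucl_normB z x; clear -phiP z2 x8; lra.
  have zx' : eucl_norm (z - x) <= 3 / 4 by clear -phiP zx; lra.
  have r43 : r / 4 < 3 / 4.
    have : 33 * r <= Rd * r by rewrite ler_wpM2r// ltW.
    by clear -phiP rRd r0; lra.
  have h34 : (3 / 4 : R) <= 1 by clear -phiP; lra.
  have := @low1 v x (r / 4) (3 / 4) (lexx _) r43 h34 (cvb _ _ b1)
    (fun z zc => vge0 z (b1 z zc)) far (vSb _ _ b1) z zx'.
  apply: le_trans; have : 1 / 8 <= 3 / 4 - eucl_norm (z - x) by clear -phiP zx; lra.
  by move=> /(ler_wpM2l (ltW k10)); clear -phiP; lra.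
move=> z z1; rewrite leNgt; apply/negP => vz.
(* Continuity is known on the open ball only, so the barrier stops at some [rho2 < 1] with
   [k2 (1 - rho2) <= de / 2]. *)
pose de := k2 * (1 - eucl_norm z) - v z.
have de0 : 0 < de by rewrite subr_gt0.
pose rho2 := Num.max (Num.max (3 / 4) (eucl_norm z)) (1 - de / (2 * k2)).
have dek : 0 < de / (2 * k2) by rewrite divr_gt0// mulr_gt0.
have rho21 : rho2 < 1 by rewrite !gt_max z1; clear -phiP dek; lra.
have rho23 : 3 / 4 <= rho2 by rewrite !le_max lexx.
have rho2z : eucl_norm z <= rho2 by rewrite !le_max lexx orbT.
have b2 y : eucl_norm (y - 0) <= rho2 -> eucl_norm y < 1 by rewrite subr0; clear -phiP rho21; lra.
have rho22 : 1 / 2 < rho2 by clear -phiP rho23; lra.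
have := @low2 v 0 (1 / 2) rho2 (lexx _) rho22 (ltW rho21) (cvb _ _ b2)
    (fun z zc => vge0 z (b2 z zc)) half (vSb _ _ b2) z.
rewrite subr0 => /(_ rho2z).
have : 1 - de / (2 * k2) <= rho2 by rewrite !le_max lexx orbT.
move=> /(ler_wpM2l (ltW k20)).
have -> : k2 * (1 - de / (2 * k2)) = k2 - de / 2 by field; rewrite gt_eqF.
by move: de0; rewrite /de; clear -phiP; lra.
Qed.

End InteriorLowerBound.

(** * Derivatives and Hessian of quadratic test functions *)

Section QuadraticTests.
Context {R : realType} {n : nat}.
Implicit Types (x y z e p : 'rV[R]_n).

Lemma is_derive_quadratic (f : 'rV[R]_n -> R) x w (L Q : R) :
  (forall h : R, f (h *: w + x) = f x + h * L + h ^+ 2 * Q) -> is_derive x w f L.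
Proof.
move=> H.
have cvL : h^-1 *: (f (h *: w + x) - f x) @[h --> 0^'] --> L.
  have : (L + h * Q) @[h --> (0 : R)^'] --> L.
    have : (L + h * Q) @[h --> (0 : R)] --> L + 0 * Q.
      by apply: cvgD; [exact: cvg_cst|apply: cvgM; [exact: cvg_id|exact: cvg_cst]].
    rewrite mul0r addr0 => cv; apply: cvg_trans cv.
    by apply: cvg_app; exact: nbhs_dnbhs.
  apply: cvg_trans; apply: near_eq_cvg; near=> h.
  have h0 : h != 0 by near: h; exact: nbhs_dnbhs_neq.
  by rewrite H /GRing.scale /=; field.
apply: DeriveDef; first by apply/cvg_ex; exists L; exact: cvL.
exact: cvg_lim cvL.
Unshelve. all: by end_near. Qed.

Definition quad_poly p e (a b : R) x0 : 'rV[R]_n -> R := fun z =>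
  dot p (z - x0) + (b * dot e (z - x0) ^+ 2 - a * dot (z - x0) (z - x0)) / 2.

Lemma dot_unit_row x i : dot x (unit_row i) = x ord0 i.
Proof.
rewrite /dot (bigD1 i)//= big1 => [|j ji]; first by rewrite !mxE !eqxx mulr1 addr0.
by rewrite !mxE eqxx (negbTE ji) mulr0.
Qed.

Lemma quad_poly_derive p e (a b : R) x0 x i :
  is_derive x (unit_row i) (quad_poly p e a b x0)
    (p ord0 i + b * dot e (x - x0) * e ord0 i - a * (x - x0) ord0 i).
Proof.
pose w : 'rV[R]_n := unit_row i.
apply: (is_derive_quadratic (Q := (b * dot e w ^+ 2 - a * dot w w) / 2)) => h.
rewrite /quad_poly -!dot_unit_row -/w.
have -> : h *: w + x - x0 = (x - x0) + h *: w by rewrite [RHS]addrC addrA.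
move: (x - x0) => y.
rewrite (dotDr p) (dotDr e) dotDl !dotDr !dotZl !dotZr (dotC w y); lra.
Qed.

Lemma partial_quad_poly p e (a b : R) x0 i :
  partial i (quad_poly p e a b x0) =
  fun x => p ord0 i + b * dot e (x - x0) * e ord0 i - a * (x - x0) ord0 i.
Proof.
by apply/funext => x; rewrite /partial; have ? := quad_poly_derive p e a b x0 x i;
  rewrite derive_val.
Qed.

Lemma partial_quad_poly_derive p e (a b : R) x0 x i j :
  is_derive x (unit_row j) (partial i (quad_poly p e a b x0))
    (b * e ord0 j * e ord0 i - a * (i == j)%:R).
Proof.
rewrite partial_quad_poly.
apply: (is_derive_quadratic (Q := 0)) => h.
have -> : h *: unit_row j + x - x0 = (x - x0) + h *: unit_row j by rewrite [RHS]addrC addrA.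
by rewrite dotDr dotZr dot_unit_row !mxE eqxx /=; ring.
Qed.

Lemma quad_poly_C2 p e (a b : R) x0 U : C2_on U (quad_poly p e a b x0).
Proof.
have c0 k := @continuous_const R 'rV[R]_n k.
have cd y : continuous (fun z : 'rV[R]_n => dot y (z - x0)).
  have -> : (fun z => dot y (z - x0)) = (fun z => dot y z - dot y x0).
    by apply/funext => z; rewrite dotDr dotNr.
  exact: (continuous_sub (@continuous_dot _ _ y) (c0 _)).
move=> x _; split.
- suff : continuous (quad_poly p e a b x0) by apply.
  exact: (continuous_add (cd p) (continuous_mul (continuous_sub
    (continuous_mul (c0 _) (continuous_sqr (cd e)))
    (continuous_mul (c0 _) (@continuous_sqdist _ _ x0))) (c0 _))).
- move=> i; split; first by have ? := quad_poly_derive p e a b x0 x i; exact: ex_derive.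
  rewrite partial_quad_poly.
  have -> : (fun x => p ord0 i + b * dot e (x - x0) * e ord0 i - a * (x - x0) ord0 i)
    = (fun x => p ord0 i + b * dot e (x - x0) * e ord0 i - a * dot (unit_row i) (x - x0)).
    by apply/funext => y; rewrite [dot (unit_row i) _]dotC dot_unit_row.
  have ca : continuous (fun x => p ord0 i + b * dot e (x - x0) * e ord0 i).
    exact: (continuous_add (c0 _) (continuous_mul (continuous_mul (c0 _) (cd e)) (c0 _))).
  have cb : continuous (fun x => a * dot (unit_row i) (x - x0)).
    exact: (continuous_mul (c0 _) (cd _)).
  by have := continuous_sub ca cb; apply.
- move=> i j; have D y := partial_quad_poly_derive p e a b x0 y i j; split.
    by have ? := D x; exact: ex_derive.
  have -> : partial j (partial i (quad_poly p e a b x0)) =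
      fun=> b * e ord0 j * e ord0 i - a * (i == j)%:R.
    by apply/funext => y; rewrite /partial; have ? := D y; rewrite derive_val.
  by have := c0 (b * e ord0 j * e ord0 i - a * (i == j)%:R); apply.
Qed.

Lemma gradient_quad_poly p e (a b : R) x0 : gradient (quad_poly p e a b x0) x0 = p.
Proof.
apply/rowP => i; rewrite mxE partial_quad_poly subrr dot0r mxE.
by rewrite !mulr0 mul0r addr0 subr0.
Qed.

Lemma hessian_quad_poly p e (a b : R) x0 :
  hessian (quad_poly p e a b x0) x0 = b *: (e^T *m e) - a%:M.
Proof.
apply/matrixP => i j; have ? := partial_quad_poly_derive p e a b x0 x0 i j.
rewrite mxE {1}/partial derive_val !mxE big_ord1 !mxE -mulr_natr; ring.
Qed.

Lemma quad_hessian_sym e (a b : R) : b *: (e^T *m e) - a%:M \is symmetricmx.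
Proof.
apply/is_hermitianmxP; rewrite expr0 scale1r map_mx_id//.
by rewrite !(linearB, linearZ) /= tr_scalar_mx trmx_mul trmxK.
Qed.

Lemma quad_hessian_form e (a b : R) x :
  (x *m (b *: (e^T *m e) - a%:M) *m x^T) ord0 ord0 = b * dot e x ^+ 2 - a * dot x x.
Proof.
have D y z : (y *m z^T) ord0 ord0 = dot y z.
  by rewrite mxE; apply: eq_bigr => i _; rewrite mxE.
have T (A B : 'M[R]_1) : (A *m B) ord0 ord0 = A ord0 ord0 * B ord0 ord0.
  by rewrite mxE big_ord1.
have -> : x *m (b *: (e^T *m e) - a%:M) *m x^T =
    b *: ((x *m e^T) *m (e *m x^T)) - a *: (x *m x^T).
  by rewrite mulmxBr mulmxBl mul_mx_scalar -!scalemxAr -!scalemxAl !mulmxA.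
have E (A B : 'M[R]_1) (k l : R) :
    (k *: A - l *: B) ord0 ord0 = k * A ord0 ord0 - l * B ord0 ord0.
  by rewrite !mxE.
by rewrite E T !D (dotC x e) expr2.
Qed.

Lemma quad_hessian_trace e (a b : R) : dot e e = 1 ->
  \tr (b *: (e^T *m e) - a%:M) = b - n%:R * a.
Proof.
move=> ee; rewrite linearB linearZ /= mxtrace_mulC mxtrace_scalar.
have -> : \tr (e *m e^T) = 1.
  by rewrite /mxtrace big_ord1 mxE -ee; apply: eq_bigr => i _; rewrite mxE.
by rewrite mulr1 mulr_natl.
Qed.

End QuadraticTests.

(** * Pucci operators through trace and one-sided form bounds *)

Section PucciBounds.
Context {R : realType} {n : nat}.
Implicit Types X : 'M[R]_n.

Lemma size_eigenvalues X : X \is symmetricmx -> size (eigenvalues X) = n.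
Proof.
move=> /symmetric_eigenvaluesP/(congr1 (fun p : {poly R} => size p)).
by rewrite size_char_poly size_prod_XsubC => -[].
Qed.

Lemma sum_eigenvalues X : X \is symmetricmx -> \sum_(e <- eigenvalues X) e = \tr X.
Proof.
move=> Xs; have sz := size_eigenvalues Xs.
have [n0|n0] := posnP n.
  rewrite (size0nil (etrans sz n0)) big_nil /mxtrace big1// => i _.
  by have := leq_trans (ltn_ord i) (eq_leq n0).
have := char_poly_trace X n0.
rewrite [in LHS](symmetric_eigenvaluesP Xs).
have sz0 : size (eigenvalues X) != 0%N by rewrite sz -lt0n.
by have := coefPn_prod_XsubC sz0; rewrite sz => -> /oppr_inj.
Qed.

Lemma eigenvalues_form X e : X \is symmetricmx -> e \in eigenvalues X ->
  exists2 x : 'rV[R]_n, 0 < dot x x & (x *m X *m x^T) ord0 ord0 = e * dot x x.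
Proof.
move=> Xs eX.
have : root (char_poly X) e by rewrite (symmetric_eigenvaluesP Xs) root_prod_XsubC.
rewrite -eigenvalue_root_char => /eigenvalueP[x xX x0].
exists x.
  rewrite lt_neqAle dot_ge0 andbT eq_sym; apply: contra x0 => /eqP/dot_eq0 ->//.
rewrite xX -scalemxAl mxE mxE; congr (_ * _).
by apply: eq_bigr => i _; rewrite mxE.
Qed.

Lemma sum_seq_ge (s : seq R) (k : R) (P : pred R) : 0 <= k ->
  (forall e, e \in s -> - k <= e) -> - ((size s)%:R * k) <= \sum_(e <- s | P e) e.
Proof.
move=> k0; elim: s => [|e s IH] H; first by rewrite big_nil mul0r oppr0.
have IH' := IH (fun e' h => H e' (mem_behead (s := e :: s) h)).
have := H e (mem_head _ _).
rewrite big_cons /= -natr1 mulrDl mul1r; case: ifP => _; lra.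
Qed.

Lemma sum_seq_le (s : seq R) (k : R) (P : pred R) : 0 <= k ->
  (forall e, e \in s -> e <= k) -> \sum_(e <- s | P e) e <= (size s)%:R * k.
Proof.
move=> k0; elim: s => [|e s IH] H; first by rewrite big_nil mul0r.
have IH' := IH (fun e' h => H e' (mem_behead (s := e :: s) h)).
have := H e (mem_head _ _).
rewrite big_cons /= -natr1 mulrDl mul1r; case: ifP => _; lra.
Qed.

Lemma sum_split_sign (s : seq R) :
  \sum_(e <- s) e = \sum_(e <- s | 0 <= e) e + \sum_(e <- s | e < 0) e.
Proof.
rewrite (bigID (fun e => 0 <= e)) /=; congr (_ + _).
by apply: eq_bigl => e; rewrite -ltNge.
Qed.

(** The operator equals [- lam tr X] minus [Lam - lam] times the sum of the negative eigenvalues,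
    and each eigenvalue is at least [- a] by testing the form on an eigenvector. *)
Lemma Pucci_plus_le (lam Lam a : R) X : lam <= Lam -> 0 <= a -> X \is symmetricmx ->
  (forall x : 'rV[R]_n, - a * dot x x <= (x *m X *m x^T) ord0 ord0) ->
  Pucci_plus lam Lam X <= - lam * \tr X + (Lam - lam) * (n%:R * a).
Proof.
move=> lL a0 Xs H; rewrite /Pucci_plus -(sum_eigenvalues Xs) sum_split_sign.
have : - (n%:R * a) <= \sum_(e <- eigenvalues X | e < 0) e.
  rewrite -{1}(size_eigenvalues Xs); apply: sum_seq_ge => // e /(eigenvalues_form Xs)[x xx E].
  by have := H x; rewrite E ler_pM2r.
set N := \sum_(e <- _ | e < 0) e; set P := \sum_(e <- _ | _) e => HN.
have : (Lam - lam) * - (n%:R * a) <= (Lam - lam) * N by rewrite ler_wpM2l ?subr_ge0.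
lra.
Qed.

Lemma Pucci_minus_ge (lam Lam a : R) X : lam <= Lam -> 0 <= a -> X \is symmetricmx ->
  (forall x : 'rV[R]_n, (x *m X *m x^T) ord0 ord0 <= a * dot x x) ->
  - lam * \tr X - (Lam - lam) * (n%:R * a) <= Pucci_minus lam Lam X.
Proof.
move=> lL a0 Xs H; rewrite /Pucci_minus -(sum_eigenvalues Xs) sum_split_sign.
have : \sum_(e <- eigenvalues X | 0 <= e) e <= n%:R * a.
  rewrite -{2}(size_eigenvalues Xs); apply: sum_seq_le => // e /(eigenvalues_form Xs)[x xx E].
  by have := H x; rewrite E ler_pM2r.
set P := \sum_(e <- _ | 0 <= e) e; set N := \sum_(e <- _ | _) e => HP.
have : (Lam - lam) * P <= (Lam - lam) * (n%:R * a) by rewrite ler_wpM2l ?subr_ge0.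
lra.
Qed.

End PucciBounds.

(** * From the viscosity property to quadratic tests *)

Section ViscosityToQuadratic.
Context {R : realType} {n : nat}.
Implicit Types (u : 'rV[R]_n -> R) (U : set 'rV[R]_n).
Context (lam Lam : R) (phi gam : R -> R) (F : 'rV[R]_n -> R -> 'rV[R]_n -> 'M[R]_n -> R).
Context (lam0 : 0 < lam) (lL : lam <= Lam).

(** On [b e^T e - a I] the Pucci bounds produce [lam b - n Lam a]; the summand [1] makes the ratio
    at least [1] even for [n = 0]. *)
Definition ellipticity_ratio : R := n%:R * Lam / lam + 1.

Lemma ellipticity_ratio_ge1 : 1 <= ellipticity_ratio.
Proof.
have Lam0 : 0 <= Lam := le_trans (ltW lam0) lL.
by rewrite /ellipticity_ratio lerDr divr_ge0 ?(ltW lam0)// mulr_ge0.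
Qed.

Lemma lam_ellipticity_ratio (a b : R) : 0 <= a ->
  lam * (b - ellipticity_ratio * a) <= lam * b - n%:R * Lam * a.
Proof.
move=> a0.
have -> : lam * (b - ellipticity_ratio * a) = lam * b - n%:R * Lam * a - lam * a.
  by rewrite /ellipticity_ratio; field; rewrite gt_eqF.
by rewrite gerBl mulr_ge0// ltW.
Qed.

Lemma viscosity_quad_super U u : viscosity_solution F U u ->
  upper_structure lam Lam phi gam F -> (forall x, U x -> 0 <= u x) ->
  quad_super ellipticity_ratio U (fun t q s => lam * s <= phi q + gam t) u.
Proof.
move=> [_ uF] FU u0 x0 p e a b d Ux0 a0 b0 ee d0 H.
have [_] := uF _ (quad_poly_C2 p e a b x0 (U := U)) x0 Ux0.
rewrite gradient_quad_poly hessian_quad_poly => H1.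
have Xs := quad_hessian_sym e a b.
have {H1} : 0 <= F x0 (u x0) p (b *: (e^T *m e) - a%:M).
  apply: H1; apply: (near_eucl _ _).2; exists d => // z zd.
  have := H z zd; rewrite /quad_poly subrr !dot0r expr0n !mulr0; lra.
have := FU x0 (u x0) p _ (u0 x0 Ux0) Xs.
have := @Pucci_plus_le R n lam Lam a _ lL a0 Xs.
rewrite quad_hessian_trace// => /(_ _)/[swap] H2 /[swap] H3 HP.
have {}HP := HP ltac:(by move=> x; rewrite quad_hessian_form; have := mulr_ge0 b0 (sqr_ge0 (dot e x)); lra).
apply: le_trans (lam_ellipticity_ratio b a0) _; lra.
Qed.

(** A quadratic below [- u] is minus a quadratic above [u]. The lower structure condition concerns
    the value [0], and monotonicity of [F] in the value passes from [u x0 >= 0] to it. *)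
Lemma viscosity_quad_sub U u : viscosity_solution F U u ->
  degenerate_elliptic F -> lower_structure lam Lam phi F ->
  (forall x, U x -> 0 <= u x) ->
  quad_super ellipticity_ratio U (fun _ q s => lam * s <= phi q) (fun z => - u z).
Proof.
move=> [_ uF] FE FL u0 x0 p e a b d Ux0 a0 b0 ee d0 H.
have [] := uF _ (quad_poly_C2 (- p) e (- a) (- b) x0 (U := U)) x0 Ux0.
rewrite gradient_quad_poly hessian_quad_poly => H1 _.
have Xs := quad_hessian_sym e (- a) (- b).
have {H1} : F x0 (u x0) (- p) (- b *: (e^T *m e) - (- a)%:M) <= 0.
  apply: H1; apply: (near_eucl _ _).2; exists d => // z zd.
  have := H z zd; rewrite /quad_poly subrr !dot0r expr0n !mulr0 dotNl; lra.
have := FE x0 (- p) (u x0) 0 _ _ Xs Xs (u0 x0 Ux0) (fun=> lexx _).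
have := FL x0 (- p) _ Xs; rewrite eucl_normN.
have := @Pucci_minus_ge R n lam Lam a _ lL a0 Xs.
rewrite quad_hessian_trace// => HP H2 H3 H4.
have {}HP := HP ltac:(by move=> x; rewrite quad_hessian_form; have := mulr_ge0 b0 (sqr_ge0 (dot e x)); lra).
apply: le_trans (lam_ellipticity_ratio b a0) _; lra.
Qed.

End ViscosityToQuadratic.

(** * Nearest boundary points and the inner normal *)

Section BallConditionGeometry.
Context {R : realType} {n : nat}.
Implicit Types (x y z c w p : 'rV[R]_n) (Omega : set 'rV[R]_n).

(** Equality case of Cauchy-Schwarz: the square of [be a - al b] is
    [2 al be (al be - dot a b) <= 0]. *)
Lemma triangle_equality (a b : 'rV[R]_n) : 0 < eucl_norm b ->
  eucl_norm a + eucl_norm b <= eucl_norm (a + b) ->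
  a = (eucl_norm a / eucl_norm b) *: b.
Proof.
move=> b0 H; set al := eucl_norm a in H *; set be := eucl_norm b in b0 H *.
have al0 : 0 <= al := eucl_norm_ge0 a.
have ab : al * be <= dot a b.
  have : (al + be) ^+ 2 <= eucl_norm (a + b) ^+ 2.
    by rewrite ler_sqr ?nnegrE ?eucl_norm_ge0// addr_ge0// ltW.
  rewrite sqr_eucl_norm !dotE (dotC b a) -!sqr_eucl_norm -/al -/be; lra.
have : dot (be *: a - al *: b) (be *: a - al *: b) <= 0.
  rewrite !dotE (dotC b a) -!sqr_eucl_norm -/al -/be.
  have := mulr_ge0 al0 (ltW b0) => ab0.
  have := ler_wpM2l ab0 ab; lra.
move=> H0; have /dot_eq0/eqP : dot (be *: a - al *: b) (be *: a - al *: b) = 0.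
  by apply/eqP; rewrite eq_le H0 dot_ge0.
rewrite subr_eq0 => /eqP E; rewrite mulrC -scalerA -E scalerA mulVf ?gt_eqF//.
by rewrite scale1r.
Qed.

Lemma closure_eucl (A : set 'rV[R]_n) x :
  closure A x <-> forall d : R, 0 < d -> exists2 y, A y & eucl_norm (y - x) < d.
Proof.
split=> [clx d d0|H B].
  have : nbhs x [set y | eucl_norm (y - x) < d] by apply: (near_eucl _ _).2; exists d.
  by move=> /clx[y [Ay yx]]; exists y.
move=> /near_eucl[d d0 dB]; have [y Ay yx] := H d d0.
by exists y; split => //; exact: dB.
Qed.

Lemma open_eucl (A : set 'rV[R]_n) x : open A -> A x ->
  exists2 d : R, 0 < d & forall y, eucl_norm (y - x) < d -> A y.
Proof. by rewrite openE => /(_ x) H /H/near_eucl. Qed.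

Lemma boundary_open Omega x : open Omega -> topo_boundary Omega x ->
  closure Omega x /\ ~ Omega x.
Proof. by move=> /interior_id oO [clx]; rewrite oO. Qed.

(* The set [|z - x| + |z - y| <= |x - y|] is the segment from [x] to [y]. *)
Lemma segment_meets_boundary Omega x y : open Omega -> Omega x -> ~ Omega y ->
  exists2 z, topo_boundary Omega z &
    eucl_norm (z - x) + eucl_norm (z - y) <= eucl_norm (x - y).
Proof.
move=> oO Ox nOy.
pose A := [set z | eucl_norm (z - x) + eucl_norm (z - y) <= eucl_norm (x - y)] `&` ~` Omega.
have clA : closed A.
  apply: closedI; last exact: open_closedC.
  apply: closed_sublevel.
  exact: (continuous_add (@continuous_eucl_dist _ _ x) (@continuous_eucl_dist _ _ y)).
have [z Az zmin] : exists2 z, A z & forall t, A t ->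
    0 + eucl_norm (z - x) <= 0 + eucl_norm (t - x).
  apply: (@min_attained _ _ A setT (fun=> 0) (fun z => eucl_norm (z - x)) x
    (eucl_norm (x - y))) => //.
  - exact: (continuous_subspaceT (@continuous_const R 'rV[R]_n 0)).
  - exact: continuous_eucl_dist.
  - by move=> z [/= H _]; have := eucl_norm_ge0 (z - y); lra.
  - by exists y; split => //=; rewrite subrr eucl_norm0 addr0 eucl_distC.
case: (Az) => /= zxy nOz; exists z => //.
have zx0 : 0 < eucl_norm (z - x).
  rewrite lt_neqAle eucl_norm_ge0 andbT eq_sym; apply/eqP => /eucl_norm_eq0/eqP.
  by rewrite subr_eq0 => /eqP E; apply: nOz; rewrite E.
split; last by rewrite (interior_id _).1.
apply/closure_eucl => d d0.
(* The point [t] of the segment is slightly closer to [x] than [z]; outside [Omega] it would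
   contradict the minimality of [z], so [z] is a limit of points of [Omega]. *)
pose ep := Num.min (1 / 2) (d / (2 * eucl_norm (z - x))).
have ep0 : 0 < ep by rewrite lt_min !divr_gt0// mulr_gt0.
have ep1 : ep <= 1 / 2 by rewrite /ep ge_min lexx.
pose t := z - ep *: (z - x).
have tz : eucl_norm (t - z) = ep * eucl_norm (z - x).
  by rewrite /t addrAC subrr add0r eucl_normN eucl_normZ gtr0_norm.
have tx : eucl_norm (t - x) = (1 - ep) * eucl_norm (z - x).
  have -> : t - x = (1 - ep) *: (z - x) by apply/rowP => i; rewrite !mxE; ring.
  by rewrite eucl_normZ ger0_norm//; lra.
exists t; last first.
  rewrite tz; have : ep <= d / (2 * eucl_norm (z - x)) by rewrite /ep ge_min lexx orbT.
  by rewrite ler_pdivlMr ?mulr_gt0//; lra.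
apply: contrapT => nOt.
have epz : 0 < ep * eucl_norm (z - x) by rewrite mulr_gt0.
have := zmin t; rewrite !add0r tx => /(_ _)/wrap[]; last by lra.
by split => //=; have := eucl_distD z t y; rewrite tx tz; lra.
Qed.

Lemma eucl_dist_attained (S : set 'rV[R]_n) x : closed S -> S !=set0 ->
  exists2 w, S w & eucl_dist x S = eucl_norm (x - w) /\
    forall z, S z -> eucl_norm (x - w) <= eucl_norm (x - z).
Proof.
move=> clS [w0 Sw0].
pose A := [set z | eucl_norm (z - x) <= eucl_norm (w0 - x)] `&` S.
have clA : closed A by apply: closedI => //; exact: closed_eucl_ball_closed.
have [w [/= wx Sw] wmin] : exists2 z, A z & forall t, A t ->
    0 + eucl_norm (z - x) <= 0 + eucl_norm (t - x).
  apply: (@min_attained _ _ A setT (fun=> 0) (fun z => eucl_norm (z - x)) x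
    (eucl_norm (w0 - x))) => //.
  - exact: (continuous_subspaceT (@continuous_const R 'rV[R]_n 0)).
  - exact: continuous_eucl_dist.
  - by move=> z [].
  - by exists w0; split => /=.
have wS z : S z -> eucl_norm (x - w) <= eucl_norm (x - z).
  move=> Sz; rewrite (eucl_distC x w) (eucl_distC x z).
  have [zw|zw] := leP (eucl_norm (z - x)) (eucl_norm (w0 - x)).
    by have := wmin z (conj zw Sz); lra.
  by lra.
exists w => //; split => //; apply/eqP; rewrite eq_le; apply/andP; split.
  apply: ge_inf; last by exists w.
  by exists 0 => _ [z _ <-]; exact: eucl_norm_ge0.
apply: lb_le_inf; first by exists (eucl_norm (x - w)); exists w.
by move=> _ [z Sz <-]; exact: wS.
Qed.

Lemma boundary_eucl_ball c rb w : topo_boundary (eucl_ball c rb) w -> eucl_norm (w - c) = rb.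
Proof.
move=> /(boundary_open (@eucl_ball_open _ _ c rb))[clw nbw].
apply/eqP; rewrite eq_le; apply/andP; split; last by rewrite leNgt; apply/negP.
have : closure [set y | eucl_norm (y - c) <= rb] w.
  by apply: closure_subset clw => y /= /ltW.
by rewrite -(iffLR (closure_id _) (@closed_eucl_ball_closed _ _ c rb)).
Qed.

(** The segment from [x] to the exterior centre [ee] meets the boundary at some [z] with
    [|x - w| <= |x - z|] and [rb <= |z - ee|]. Hence equality holds in the triangle inequality and
    [x], [w], [ee] are aligned. The interior centre is such an [x], so both balls share one
    normal. *)
Lemma ball_condition_normal Omega rb w : open Omega -> 0 < rb ->
  ball_condition Omega rb -> topo_boundary Omega w ->
  exists nu : 'rV[R]_n, [/\ eucl_norm nu = 1,
    eucl_ball (w + rb *: nu) rb `<=` Omega,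
    eucl_ball (w - rb *: nu) rb `<=` ~` Omega &
    forall x, Omega x -> (forall z, topo_boundary Omega z -> eucl_norm (x - w) <= eucl_norm (x - z)) ->
      x = w + eucl_norm (x - w) *: nu].
Proof.
move=> oO rb0 bc Sw.
have [[ei [Oei bi Si]] [ee [Oee be Se]]] := bc w Sw.
have nwi : eucl_norm (w - ei) = rb.
  apply: boundary_eucl_ball.
  have : (topo_boundary (eucl_ball ei rb) `&` topo_boundary Omega) w by rewrite Si.
  by case.
have nwe : eucl_norm (w - ee) = rb.
  apply: boundary_eucl_ball.
  have : (topo_boundary (eucl_ball ee rb) `&` topo_boundary Omega) w by rewrite Se.
  by case.
have far_e z : topo_boundary Omega z -> rb <= eucl_norm (z - ee).
  move=> /(boundary_open oO)[clz _]; rewrite leNgt; apply/negP => ze.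
  have [d d0 Hd] := open_eucl (@eucl_ball_open _ _ ee rb) ze.
  by have [y Oy /Hd/be] := (closure_eucl Omega z).1 clz d d0.
have far_i z : topo_boundary Omega z -> rb <= eucl_norm (z - ei).
  by move=> /(boundary_open oO)[_ nOz]; rewrite leNgt; apply/negP => /bi.
pose nu := rb^-1 *: (w - ee).
have rbnu : rb *: nu = w - ee by rewrite scalerA divff ?gt_eqF// scale1r.
have aligned x : Omega x ->
    (forall z, topo_boundary Omega z -> eucl_norm (x - w) <= eucl_norm (z - x)) ->
    x = w + eucl_norm (x - w) *: nu.
  move=> Ox xmin.
  have [z Sz zx] := segment_meets_boundary oO Ox Oee.
  have H : eucl_norm (x - w) + eucl_norm (w - ee) <= eucl_norm ((x - w) + (w - ee)).
    rewrite addrA subrK nwe; have := xmin z Sz; have := far_e z Sz; lra.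
  have := triangle_equality _ H; rewrite nwe => /(_ rb0) E.
  by apply/eqP; rewrite addrC -subr_eq [X in X == _]E -scalerA.
have eiE : ei = w + rb *: nu.
  have := aligned ei Oei; rewrite (eucl_distC ei w) nwi; apply => z Sz.
  exact: far_i.
exists nu; split.
- by rewrite eucl_normZ nwe gtr0_norm ?invr_gt0// mulVf// gt_eqF.
- by rewrite -eiE.
- by rewrite rbnu opprB addrC subrK.
- move=> x Ox xmin; apply: aligned => // z Sz; rewrite (eucl_distC z x); exact: xmin.
Qed.

End BallConditionGeometry.

(** * Both estimates along the normal, after rescaling to unit size *)

Section BoundaryEstimates.
Context {R : realType} {n : nat}.
Implicit Types (x y z c w nu : 'rV[R]_n) (u : 'rV[R]_n -> R) (Omega U : set 'rV[R]_n).
Context (lam Lam : R) (phi : R -> R) (rb Cstar : R).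
Context (lam0 : 0 < lam) (lL : lam <= Lam) (phiP : admissible_phi phi) (rb0 : 0 < rb).

(** [rb <= B] makes [B t <= 1] imply [r t <= 1], the range of [gamma_bound]; the last entry collects
    [r / lam] from the zoom and the constant in front of [phi]. *)
Definition growth_constant : R := Num.max (Num.max 1 rb) (rb / lam * (1 + `|Cstar|)).
Local Notation B := growth_constant.
Local Notation C0 := (@ellipticity_ratio R n lam Lam).

Lemma growth_constantP : [/\ 1 <= B, rb <= B & rb / lam * (1 + `|Cstar|) <= B].
Proof. by rewrite /growth_constant !le_max !lexx !orbT. Qed.

Lemma rescaled_quad_super gam F U u c (r : R) : 0 < r -> r < rb ->
  viscosity_solution F U u -> gamma_bound phi Cstar gam ->
  upper_structure lam Lam phi gam F -> (forall x, U x -> 0 <= u x) ->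
  quad_super C0 [set y | U (c + r *: y)]
    (fun t q s => B * t <= 1 -> s <= B * phi q + B * phi (B * t))
    (fun y => u (c + r *: y) / r).
Proof.
move=> r0 rrb vs gb FU u0; have [B1 Brb BC] := growth_constantP.
have := quad_super_rescale (c := c) r0 ltr01 (viscosity_quad_super lam0 lL vs FU u0).
rewrite mulr1 => H; apply: quad_super_weaken H _ _ => // y q s /= Uy q0.
set t := u (c + r *: y) / r; rewrite !mul1r => H Bt.
have t0 : 0 <= t by rewrite divr_ge0 ?(ltW r0)// u0.
have B0 : 0 <= B by lra.
have rtB : r * t <= B * t by rewrite ler_wpM2r//; lra.
have rt0 : 0 <= r * t by rewrite mulr_ge0// ltW.
have gt : gam (r * t) <= `|Cstar| * phi (B * t).
  apply: le_trans (gb _ _) _; first by rewrite rt0 (le_trans rtB).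
  have p1 := phi_mono phiP rt0 rtB; have p0 := phi_ge0 phiP rt0.
  apply: le_trans (_ : `|Cstar| * phi (r * t) <= _).
    by rewrite ler_wpM2r// ler_norm.
  by rewrite ler_wpM2l.
have pB0 : 0 <= phi (B * t) by apply: (phi_ge0 phiP); rewrite mulr_ge0.
have pq0 := phi_ge0 phiP q0.
have C1 : 0 <= `|Cstar| := normr_ge0 _.
have rl0 : 0 <= rb / lam by rewrite divr_ge0 ?(ltW rb0) ?(ltW lam0).
have rB : rb / lam <= B.
  by apply: le_trans BC; rewrite ler_peMr//; lra.
have sE : s <= r / lam * (phi q + `|Cstar| * phi (B * t)).
  have : lam * (r^-1 * s) <= phi q + `|Cstar| * phi (B * t) by lra.
  have rl : 0 <= r / lam by rewrite divr_ge0 ?(ltW r0) ?(ltW lam0).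
  move=> /(ler_wpM2l rl).
  by have -> : r / lam * (lam * (r^-1 * s)) = s by field; rewrite !gt_eqF.
apply: le_trans sE _.
have T0 : 0 <= phi q + `|Cstar| * phi (B * t) by rewrite addr_ge0// mulr_ge0.
apply: le_trans (_ : rb / lam * (phi q + `|Cstar| * phi (B * t)) <= _).
  by rewrite ler_wpM2r// ler_wpM2r ?invr_ge0 ?(ltW lam0)// ltW.
rewrite mulrDr lerD ?ler_wpM2r// mulrA ler_wpM2r//.
by apply: le_trans BC; rewrite ler_wpM2l//; lra.
Qed.

Lemma rescaled_quad_sub F U u c (r : R) : 0 < r -> r < rb ->
  viscosity_solution F U u -> degenerate_elliptic F ->
  lower_structure lam Lam phi F -> (forall x, U x -> 0 <= u x) ->
  quad_super C0 [set y | U (c + r *: y)]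
    (fun _ q s => s <= B * phi q) (fun y => - (u (c + r *: y) / r)).
Proof.
move=> r0 rrb vs FE FL u0; have [B1 Brb BC] := growth_constantP.
have := quad_super_rescale (c := c) r0 ltr01 (viscosity_quad_sub lam0 lL vs FE FL u0).
rewrite mulr1.
have -> : (fun y => - u (c + r *: y) / r) = (fun y => - (u (c + r *: y) / r)).
  by apply/funext => y; rewrite mulNr.
move=> H; apply: quad_super_weaken H _ _ => // y q s /= Uy q0; rewrite !mul1r => H.
have pq0 := phi_ge0 phiP q0.
have C1 : 0 <= `|Cstar| := normr_ge0 _.
have rl0 : 0 <= rb / lam by rewrite divr_ge0 ?(ltW rb0) ?(ltW lam0).
have rB : rb / lam <= B.
  by apply: le_trans BC; rewrite ler_peMr//; lra.
have rl : 0 <= r / lam by rewrite divr_ge0 ?(ltW r0) ?(ltW lam0).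
have := ler_wpM2l rl H.
have -> : r / lam * (lam * (r^-1 * s)) = s by field; rewrite !gt_eqF.
move=> sE; apply: le_trans sE _; rewrite ler_wpM2r//; apply: le_trans rB.
by rewrite ler_wpM2r ?invr_ge0 ?(ltW lam0)// ltW.
Qed.

Lemma lower_estimate (f : R -> R -> R) (m M : R) :
  (forall t, 0 < t -> decay_solution phi t (f t)) -> 0 < m ->
  exists2 kap : R, 0 < kap & forall F gam Omega w (r : R) u w' nu,
    let U := Omega `&` eucl_ball w (6 * r) in
    degenerate_elliptic F -> lower_structure lam Lam phi F ->
    gamma_bound phi Cstar gam -> upper_structure lam Lam phi gam F ->
    open Omega -> 0 < r -> r < rb ->
    viscosity_solution F U u -> (forall x, U x -> 0 <= u x) ->
    {within U, continuous u} ->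
    (forall x, Gamma_wr Omega w r x -> m * r <= u x) ->
    (forall x, U x -> u x <= M * r) ->
    topo_boundary Omega w' -> eucl_norm (w' - w) < 2 * r -> eucl_norm nu = 1 ->
    eucl_ball (w' + rb *: nu) rb `<=` Omega ->
    forall d, 0 < d -> d <= r -> kap * d <= u (w' + d *: nu).
Proof.
move=> fP m0; have [B1 _ _] := growth_constantP.
have [kap kap0 H] := interior_lower_bound (n := n) phiP M fP
  (@ellipticity_ratio_ge1 R n lam Lam lam0 lL) B1 m0.
exists kap => // F gam Omega w r u w' nu U FE FL gb FU oO r0 rrb vs u0 cu umin umax
  Sw' w'w nu1 ball d d0 dr.
pose eta := w' + r *: nu.
have dist_nu (s t : R) : eucl_norm ((w' + s *: nu) - (w' + t *: nu)) = `|s - t|.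
  by rewrite opprD addrACA subrr add0r -scalerBl eucl_normZ nu1 mulr1.
have inU z : eucl_norm (z - eta) < r -> U z.
  move=> ze; split.
    apply: ball; rewrite /eucl_ball /=.
    have := eucl_distD eta z (w' + rb *: nu); rewrite /eta dist_nu -/eta.
    by rewrite ler0_norm; lra.
  rewrite /eucl_ball /=; have := eucl_distD eta z w; have := eucl_distD w' eta w.
  have -> : eta - w' = r *: nu by rewrite /eta addrAC subrr add0r.
  by rewrite eucl_normZ nu1 gtr0_norm// mulr1; lra.
have etaU : U eta by apply: inU; rewrite subrr eucl_norm0.
have umeta : m * r <= u eta.
  rewrite leNgt; apply/negP => ueta.
  have e0 : 0 < m * r - u eta by rewrite subr_gt0.
  have [de de0 Hde] := within_continuous_eps cu etaU e0.
  (* [eta] has distance exactly [r] from the boundary and so just fails to be in [Gamma_wr]. As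
     [r < rb], a slightly deeper point [p] on the normal has distance [s] strictly between [r] and
     [3 r], and continuity carries the bound back to [eta]. *)
  pose s := r + Num.min (Num.min (de / 2) (rb - r)) (r / 2).
  have sr : r < s by rewrite /s ltrDl !lt_min subr_gt0 rrb !divr_gt0.
  have s1 : s - r <= de / 2 by rewrite /s addrAC subrr add0r !ge_min lexx.
  have s2 : s <= rb by rewrite /s -lerBrDl !ge_min lexx orbT.
  have s3 : s - r <= r / 2 by rewrite /s addrAC subrr add0r !ge_min lexx !orbT.
  pose p := w' + s *: nu.
  have pO : Omega p.
    by apply: ball; rewrite /eucl_ball /= dist_nu ler0_norm; lra.
  have pw : eucl_norm (p - w) < 6 * r.
    have := eucl_distD w' p w.
    have -> : p - w' = s *: nu by rewrite /p addrAC subrr add0r.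
    by rewrite eucl_normZ nu1 gtr0_norm; lra.
  have bfar z : topo_boundary Omega z -> s <= eucl_norm (p - z).
    move=> /(boundary_open oO)[_ nOz]; rewrite leNgt; apply/negP => pz.
    apply: nOz; apply: ball; rewrite /eucl_ball /=.
    have := eucl_distD p z (w' + rb *: nu); rewrite (eucl_distC z p) /p dist_nu -/p.
    by rewrite ler0_norm; lra.
  have ds : eucl_dist p (topo_boundary Omega) = s.
    apply/eqP; rewrite eq_le; apply/andP; split.
      apply: ge_inf; first by exists 0 => _ [z _ <-]; exact: eucl_norm_ge0.
      exists w' => //; rewrite /p addrAC subrr add0r eucl_normZ nu1 mulr1 gtr0_norm//.
      exact: lt_trans sr.
    apply: lb_le_inf; first by exists (eucl_norm (p - w')); exists w'.
    by move=> _ [z Sz <-]; exact: bfar.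
  have : m * r <= u p by apply: umin; split => //; split => //=; rewrite ds; lra.
  have : `|u p - u eta| < m * r - u eta.
    by apply: Hde; [split|rewrite /p /eta dist_nu ger0_norm; lra].
  by rewrite ltr_norml; lra.
pose v y := u (eta + r *: y) / r.
have resU y : eucl_norm y < 1 -> U (eta + r *: y).
  move=> y1; apply: inU; rewrite addrAC subrr add0r eucl_normZ gtr0_norm//.
  by rewrite -[ltRHS]mulr1 ltr_pM2l.
have vS := rescaled_quad_super (c := eta) r0 rrb vs gb FU u0.
have vS' := rescaled_quad_sub (c := eta) r0 rrb vs FE FL u0.
have := H v _ _ _ _ _ (((d - r) / r) *: nu).
have y1 : eucl_norm (((d - r) / r) *: nu) = 1 - d / r.
  rewrite eucl_normZ nu1 mulr1 ler0_norm; first by field; rewrite gt_eqF.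
  by rewrite mulr_le0_ge0 ?invr_ge0 ?(ltW r0)// subr_le0.
have dr0 : 0 < d / r by rewrite divr_gt0.
have yE : eta + r *: (((d - r) / r) *: nu) = w' + d *: nu.
  rewrite /eta scalerA -addrA -scalerDl; congr (_ + _ *: _).
  by field; rewrite gt_eqF.
rewrite y1 /v yE => HH.
have {}HH : kap * (1 - (1 - d / r)) <= u (w' + d *: nu) / r.
  apply: HH.
  - by apply: within_continuous_rescale cu _ => // y; exact: resU.
  - move=> z z1; have Uz := resU z z1.
    by rewrite divr_ge0 ?(ltW r0) ?u0//= ler_pdivrMr// umax.
  - by rewrite scaler0 addr0 ler_pdivlMr.
  - by apply: quad_super_weaken vS _ _ => // y; exact: resU.
  - by apply: quad_super_weaken vS' _ _ => // y; exact: resU.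
  - lra.
move: HH; rewrite ler_pdivlMr//.
by have -> : kap * (1 - (1 - d / r)) * r = kap * d by field; rewrite gt_eqF.
Qed.

Lemma upper_estimate (M : R) : decay_integral_blowup phi ->
  exists2 k : R, 0 < k & forall F Omega w (r : R) u w' nu,
    let U := Omega `&` eucl_ball w (6 * r) in
    degenerate_elliptic F -> lower_structure lam Lam phi F ->
    open Omega -> 0 < r -> r < rb ->
    viscosity_solution F U u -> (forall x, U x -> 0 <= u x) ->
    {within closure Omega `&` eucl_ball w (6 * r), continuous u} ->
    (forall x, (topo_boundary Omega `&` eucl_ball w (6 * r)) x -> u x = 0) ->
    (forall x, U x -> u x <= M * r) -> 0 <= M ->
    eucl_norm (w' - w) < 2 * r -> eucl_norm nu = 1 ->
    eucl_ball (w' - rb *: nu) rb `<=` ~` Omega ->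
    forall d, 0 < d -> d <= r -> U (w' + d *: nu) -> u (w' + d *: nu) <= k * d.
Proof.
move=> blow; have [B1 _ _] := growth_constantP.
have [k k0 H] := @upper_barrier R n phi phiP _ B M blow
  (@ellipticity_ratio_ge1 R n lam Lam lam0 lL) B1.
exists k => // F Omega w r u w' nu U FE FL oO r0 rrb vs u0 cu ubd umax M0
  w'w nu1 ball d d0 dr Ux.
(* Depth [r] rather than [rb] keeps the ball of radius [2 r] around [c] inside
   [eucl_ball w (6 * r)]. *)
pose c := w' - r *: nu.
have cw : eucl_norm (c - w) < 3 * r.
  have := eucl_distD w' c w; have -> : c - w' = - (r *: nu) by rewrite /c addrAC subrr add0r.
  by rewrite eucl_normN eucl_normZ nu1 gtr0_norm// mulr1; lra.
have cball z : eucl_norm (z - c) < r -> ~ Omega z.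
  move=> zc; apply: ball; rewrite /eucl_ball /=.
  have := eucl_distD c z (w' - rb *: nu).
  have -> : c - (w' - rb *: nu) = (rb - r) *: nu.
    by apply/rowP => i; rewrite !mxE; ring.
  by rewrite eucl_normZ nu1 gtr0_norm ?subr_gt0//; lra.
have resc y : eucl_norm (c + r *: y - c) = r * eucl_norm y.
  by rewrite addrAC subrr add0r eucl_normZ gtr0_norm.
have resd y y' : eucl_norm (c + r *: y - (c + r *: y')) = r * eucl_norm (y - y').
  by rewrite opprD addrACA subrr add0r -scalerBr eucl_normZ gtr0_norm.
pose D := [set y | closure Omega (c + r *: y)].
pose V := [set y | U (c + r *: y)].
have opV : open V.
  have opU : open U by apply: openI => //; exact: eucl_ball_open.
  rewrite openE => y Vy; have [de de0 Hde] := open_eucl opU Vy.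
  apply: (near_eucl _ _).2; exists (de / r); first exact: divr_gt0.
  by move=> z zy; apply: Hde; rewrite resd mulrC -ltr_pdivlMr.
have clD : closed D.
  rewrite -openC openE => y nDy.
  have oC : open (~` closure Omega) by apply: closed_openC; exact: closed_closure.
  have [de de0 Hde] := open_eucl oC nDy.
  apply: (near_eucl _ _).2; exists (de / r); first exact: divr_gt0.
  by move=> z zy; apply: Hde; rewrite resd mulrC -ltr_pdivlMr.
pose v y := u (c + r *: y) / r.
pose A := D `&` [set z | eucl_norm (z - 0) <= 2].
have AB y : A y -> eucl_ball w (6 * r) (c + r *: y).
  move=> [_ /=]; rewrite subr0 => y2; rewrite /eucl_ball /=.
  have := eucl_distD c (c + r *: y) w; rewrite resc.
  by have := ler_wpM2l (ltW r0) y2; lra.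
have clA : closed A.
  by apply: closedI => //; exact: closed_eucl_ball_closed.
have cvA : {within A, continuous v}.
  by apply: within_continuous_rescale r0 cu _ => y Ay; split; [case: Ay|exact: AB].
have AV y : A y -> V y \/ v y = 0.
  move=> Ay; have [Oy|nOy] := pselect (Omega (c + r *: y)).
    by left; split => //; exact: AB.
  right; rewrite /v ubd ?mul0r//; split; last exact: AB.
  by split; [case: Ay|rewrite (interior_id _).1].
have vM y : A y -> v y <= M.
  move=> /AV[Vy|-> //]; rewrite /v ler_pdivrMr//; exact: umax.
have A1 y : A y -> 1 <= eucl_norm (y - 0).
  move=> [/closure_eucl cly _]; rewrite subr0 leNgt; apply/negP => y1.
  have e0 : 0 < r * (1 - eucl_norm y) by rewrite mulr_gt0// subr_gt0.
  have [z Oz zy] := cly _ e0; apply: cball Oz.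
  by have := eucl_distD (c + r *: y) z c; rewrite resc; lra.
have V1 y : V y -> 1 < eucl_norm (y - 0).
  move=> Vy; have [de de0 Hde] := open_eucl opV Vy; rewrite subr0.
  rewrite ltNge; apply/negP => y1.
  (* The set [V] is open, so shrinking [y] by the factor [1 - ep] stays in it; if [|y| <= 1], the
     result is strictly inside the exterior ball, which misses [Omega]. *)
  pose ep := de / (eucl_norm y + 1 + de).
  have N0 := eucl_norm_ge0 y.
  have ep0 : 0 < ep by rewrite divr_gt0//; lra.
  have ep1 : ep < 1 by rewrite ltr_pdivrMr; lra.
  have epE : ep * (eucl_norm y + 1 + de) = de by rewrite /ep divfK// gt_eqF//; lra.
  have [] : V (y - ep *: y).
    apply: Hde; rewrite addrAC subrr add0r eucl_normN eucl_normZ gtr0_norm//.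
    by have := mulr_gt0 ep0 de0; lra.
  move=> + _; apply: cball; rewrite resc.
  have -> : y - ep *: y = (1 - ep) *: y by rewrite scalerBl scale1r.
  rewrite eucl_normZ gtr0_norm; last by lra.
  rewrite -[ltRHS]mulr1 ltr_pM2l//; nra.
have VD : V `<=` D by move=> y [Oy _]; exact: subset_closure.
have vS := rescaled_quad_sub (c := c) r0 rrb vs FE FL u0.
pose y0 := (1 + d / r) *: nu.
have dr0 : 0 < d / r by rewrite divr_gt0.
have y0E : c + r *: y0 = w' + d *: nu.
  rewrite /c /y0 scalerA -addrA -scaleNr -scalerDl; congr (_ + _ *: _).
  by field; rewrite gt_eqF.
have y0n : eucl_norm (y0 - 0) = 1 + d / r.
  by rewrite subr0 eucl_normZ nu1 mulr1 gtr0_norm//; lra.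
have Ay0 : A y0.
  split; first by rewrite /D /= y0E; apply: subset_closure; case: Ux.
  rewrite /= y0n; have : d / r <= 1 by rewrite ler_pdivrMr// mul1r.
  by lra.
have := H v 0 D V clA cvA vM A1 V1 AV opV VD.
move=> /(_ _ y0 Ay0); rewrite y0n /v y0E => HH.
have {}HH : u (w' + d *: nu) / r <= k * (1 + d / r - 1).
  by apply: HH; apply: quad_super_weaken vS _ _ => // y [].
move: HH; rewrite ler_pdivrMr//.
by have -> : k * (1 + d / r - 1) * r = k * d by field; rewrite gt_eqF.
Qed.

End BoundaryEstimates.

Theorem corollary6 (R : realType) (n : nat) (lam Lam : R) (phi : R -> R)
    (rb Cstar m M : R) :
  0 < lam -> lam <= Lam ->
  admissible_phi phi -> decay_integral_blowup phi ->
  0 < rb -> 0 < m ->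
  exists2 c : R, 1 <= c &
  forall (F : 'rV[R]_n -> R -> 'rV[R]_n -> 'M[R]_n -> R) (gam : R -> R)
         (Omega : set 'rV[R]_n) (w : 'rV[R]_n) (r : R) (u : 'rV[R]_n -> R),
    degenerate_elliptic F ->
    lower_structure lam Lam phi F ->
    gamma_bound phi Cstar gam ->
    upper_structure lam Lam phi gam F ->
    is_domain Omega -> ball_condition Omega rb ->
    topo_boundary Omega w -> 0 < r < rb ->
    viscosity_solution F (Omega `&` eucl_ball w (6 * r)) u ->
    (forall x, (Omega `&` eucl_ball w (6 * r)) x -> 0 < u x) ->
    {within closure Omega `&` eucl_ball w (6 * r), continuous u} ->
    (forall x, (topo_boundary Omega `&` eucl_ball w (6 * r)) x -> u x = 0) ->
    ((r^-1)%:E * ereal_inf [set (u x)%:E | x in Gamma_wr Omega w r] = m%:E)%E ->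
    ((r^-1)%:E * ereal_sup [set (u x)%:E | x in eucl_ball w (6 * r) `&` Omega] = M%:E)%E ->
    forall x, (Omega `&` eucl_ball w r) x ->
      c^-1 * eucl_dist x (topo_boundary Omega) <= u x <= c * eucl_dist x (topo_boundary Omega).
Proof.
move=> lam0 lL phiP blow rb0 m0.
have [f fP _] := blow.
have [kap kap0 low] := @lower_estimate R n lam Lam phi rb Cstar lam0 lL phiP rb0 f m M fP m0.
have [k k0 upp] := @upper_estimate R n lam Lam phi rb Cstar lam0 lL phiP rb0 M blow.
exists (Num.max 1 (Num.max kap^-1 k)); first by rewrite le_max lexx.
move=> F gam Omega w r u FE FL gb FU [oO _] bc Sw /andP[r0 rrb] vs upos cu ubd infE supE
  x [Ox xw].
pose U := Omega `&` eucl_ball w (6 * r).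
have u0 y : U y -> 0 <= u y by move=> /upos/ltW.
have umin y : Gamma_wr Omega w r y -> m * r <= u y.
  move=> Gy; have H : (ereal_inf [set (u x)%:E | x in Gamma_wr Omega w r] <= (u y)%:E)%E.
    by apply: ereal_inf_lbound; exists y.
  have : ((r^-1)%:E * ereal_inf [set (u x)%:E | x in Gamma_wr Omega w r]
    <= (r^-1)%:E * (u y)%:E)%E by rewrite lee_pmul2l// lte_fin invr_gt0.
  by rewrite infE -EFinM lee_fin ler_pdivlMl// mulrC.
have umax y : U y -> u y <= M * r.
  move=> [Oy yw]; have H : ((u y)%:E <= ereal_sup [set (u x)%:E | x in eucl_ball w (6 * r) `&` Omega])%E.
    by apply: ereal_sup_ubound; exists y.
  have : ((r^-1)%:E * (u y)%:E <=
    (r^-1)%:E * ereal_sup [set (u x)%:E | x in eucl_ball w (6 * r) `&` Omega])%E.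
    by rewrite lee_pmul2l// lte_fin invr_gt0.
  by rewrite supE -EFinM lee_fin ler_pdivrMl// mulrC.
have clS : closed (topo_boundary Omega).
  have -> : topo_boundary Omega = closure Omega `&` ~` Omega.
    by rewrite /topo_boundary (iffLR (interior_id _) oO).
  by apply: closedI; [exact: closed_closure|exact: open_closedC].
have [w' Sw' [dE wmin]] := eucl_dist_attained x clS (ex_intro _ w Sw).
have [nu [nu1 bi be al]] := ball_condition_normal oO rb0 bc Sw'.
have xE := al x Ox wmin; rewrite -dE in xE.
set d := eucl_dist x _ in dE xE *.
have xwr : eucl_norm (x - w) < r := xw.
have dr : d < r by rewrite dE; apply: le_lt_trans xwr; exact: wmin.
have d0 : 0 < d.
  rewrite dE lt_neqAle eucl_norm_ge0 andbT eq_sym; apply/eqP => /eucl_norm_eq0/eqP.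
  rewrite subr_eq0 => /eqP xw'; have [_] := boundary_open oO Sw'.
  by rewrite -xw'.
have w'w : eucl_norm (w' - w) < 2 * r.
  by have := eucl_distD x w' w; rewrite (eucl_distC w' x) -dE; lra.
have Ux : U x by split => //; rewrite /eucl_ball /=; lra.
have cuU : {within U, continuous u}.
  apply: continuous_subspaceW cu => y [Oy yw]; split => //; exact: subset_closure.
have M0 : 0 <= M.
  have := le_trans (u0 x Ux) (umax x Ux).
  by rewrite pmulr_lge0.
have H1 := low F gam Omega w r u w' nu FE FL gb FU oO r0 rrb vs u0 cuU umin umax
  Sw' w'w nu1 bi d d0 (ltW dr).
have H2 : u x <= k * d.
  have := upp F Omega w r u w' nu FE FL oO r0 rrb vs u0 cu ubd umax M0
    w'w nu1 be d d0 (ltW dr).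
  by rewrite -xE; apply.
rewrite -xE in H1; apply/andP; split.
  apply: le_trans H1; rewrite ler_wpM2r ?(ltW d0)//.
  rewrite -[leRHS]invrK lef_pV2 ?posrE ?invr_gt0//; first by rewrite !le_max lexx !orbT.
  by rewrite lt_max ltr01.
apply: le_trans H2 _; rewrite ler_wpM2r ?(ltW d0)//.
by rewrite !le_max lexx !orbT.
Qed.
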